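(* Suppose that there are constants $\gamma>0$ and $\lambda>0$ such that $$\liminf_{t\to\infty}\int_t^{t+\gamma}a(s)\,ds>0\quad\text{and}\quad \liminf_{t\to\infty}\int_t^{t+\lambda}\Big(r(s)-\tfrac12\sigma^2(s)\Big)ds>0 .$$ Then the equation $$dx(t)=x(t)\big[(r(t)-a(t)x(t))\,dt+\sigma(t)\,dB(t)\big]$$ is globally attractive, that is, $$\lim_{t\to\infty}|x(t)-y(t)|=0\quad\text{a.s.}$$ for any two positive solutions $x(t)$ and $y(t)$ of the equation.
   Context: Setting: $(\Omega,\mathcal F,P)$ is a complete probability space with a filtration $\{\mathcal F_t\}_{t\ge 0}$ satisfying the usual conditions, $B(t)$ is a standard one-dimensional Brownian motion on it, and $r,a,\sigma:[0,\infty)\to\mathbb R$ are (deterministic) continuous bounded functions with $a$ and $\sigma$ nonnegative. The equation is understood in the Itô sense. For any initial value $x_0\in R_+=(0,\infty)$ there is a unique solution $x(t)$ on $t\ge 0$ with $x(0)=x_0$, and it remains in $R_+$ with probability one; such solutions are called positive solutions. Two solutions $x(t)$, $y(t)$ are driven by the same Brownian motion $B(t)$. *)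

(* Defs.v *)
From HB Require Import structures.
From mathcomp Require Import all_boot all_order all_algebra.
From mathcomp Require Import all_classical all_reals all_analysis.
From mathcomp Require Import measurable_realfun.

Set Implicit Arguments.
Unset Strict Implicit.
Unset Printing Implicit Defensive.

Import Order.TTheory GRing.Theory Num.Theory.
Import numFieldNormedType.Exports.

Local Open Scope classical_set_scope.
Local Open Scope ring_scope.

(* A process is a function [X : R -> T -> R]; only the times [0 <= t] matter,
   and all the conditions below are restricted to them. *)

Section Processes.
Context (R : realType) (d : measure_display) (T : measurableType d)
  (P : probability T R).
Implicit Types (F : R -> set (set T)) (X H B : R -> T -> R).

(* For a complete [P], the usual conditions: an increasing and right-continuous
   family of sub-sigma-algebras, with all the [P]-null sets in [F 0]. *)
Record usual_filtration F : Prop := UsualFiltration {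
  filtration_sigma_algebra : forall t : R, 0 <= t -> sigma_algebra setT (F t);
  filtration_measurable : forall t : R, 0 <= t -> F t `<=` measurable;
  filtration_mono : forall s t : R, 0 <= s -> s <= t -> F s `<=` F t;
  filtration_right_continuous : forall (t : R) A, 0 <= t ->
    (forall u : R, t < u -> F u A) -> F t A;
  filtration_null_sets : P.-negligible `<=` F 0 }.

Definition adapted F X : Prop :=
  forall t : R, 0 <= t -> forall C : set R, measurable C -> F t (X t @^-1` C).

Definition continuous_paths X : Prop :=
  {ae P, forall w, {within `[0, +oo[, continuous (X^~ w)}}.

(* The second argument of [normal_prob] is the standard deviation. *)
Record standard_brownian_motion F B : Prop := StandardBrownianMotion {
  brownian_adapted : adapted F B;
  brownian_continuous : continuous_paths B;
  brownian_start : {ae P, forall w, B 0 w = 0};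
  brownian_gaussian : forall s t : R, 0 <= s -> s < t ->
    forall C : set R, measurable C ->
      P [set w | C (B t w - B s w)] = normal_prob 0 (Num.sqrt (t - s)) C;
  brownian_independent : forall s t : R, 0 <= s -> s < t ->
    forall (A : set T) (C : set R), F s A -> measurable C ->
      P (A `&` [set w | C (B t w - B s w)]) =
      (P A * P [set w | C (B t w - B s w)%R])%E }.

(* The simple process that is equal to [sp_coef i] on the time interval
   ]sp_time i, sp_time i.+1], for [i < sp_size]. *)
Record simple_process := SimpleProcess {
  sp_size : nat;
  sp_time : nat -> R;
  sp_coef : nat -> T -> R }.

Definition nonanticipating F (t : R) (phi : simple_process) : Prop :=
  [/\ sp_time phi 0 = 0, sp_time phi (sp_size phi) = t &
    forall i, (i < sp_size phi)%N ->
      [/\ sp_time phi i <= sp_time phi i.+1,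
          forall C : set R, measurable C ->
            F (sp_time phi i) (sp_coef phi i @^-1` C) &
          exists M : R, forall w, `|sp_coef phi i w| <= M]].

Definition simple_value (phi : simple_process) (s : R) (w : T) : R :=
  \sum_(i < sp_size phi)
    sp_coef phi i w * \1_(`]sp_time phi i, sp_time phi i.+1]) s.

Definition simple_integral B (phi : simple_process) (w : T) : R :=
  \sum_(i < sp_size phi)
    sp_coef phi i w * (B (sp_time phi i.+1) w - B (sp_time phi i) w).

Definition cvg0_in_probability (Y : nat -> T -> \bar R) : Prop :=
  (forall n, measurable_fun setT (Y n)) /\
  forall eps : R, 0 < eps ->
    P [set w | (eps%:E <= Y n w)%E] @[n --> \oo] --> 0%E.

(* [I] is (a version of) the Ito integral of [H] with respect to [B] over
   [0, t]: [H] is adapted, almost surely square integrable in time, and [I] is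
   the limit in probability of the integrals of simple processes [phi n] such
   that the time integral of |phi n - H|^2 over [0, t] tends to 0 in
   probability. *)
Definition is_ito_integral F B H (t : R) (I : T -> R) : Prop :=
  [/\ adapted F H,
      {ae P, forall w, measurable_fun `[0, t] (H^~ w) /\
        (\int[lebesgue_measure]_(s in `[0%R, t]) ((H s w) ^+ 2)%:E < +oo)%E},
      measurable_fun setT I &
      exists phi : nat -> simple_process,
        [/\ forall n, nonanticipating F t (phi n),
            cvg0_in_probability (fun n w =>
              \int[lebesgue_measure]_(s in `[0%R, t])
                ((simple_value (phi n) s w - H s w) ^+ 2)%:E)%E &
            cvg0_in_probability (fun n w =>
              `|simple_integral B (phi n) w - I w|%:E)]].

(* [X] is a solution on [0, +oo[ of dX = b(t, X) dt + s(t, X) dB, X(0) = x0. *)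
Definition sde_solution F B (b s : R -> R -> R) (x0 : R) X : Prop :=
  [/\ adapted F X, continuous_paths X, {ae P, forall w, X 0 w = x0},
      {ae P, forall w, forall t : R, 0 <= t ->
        lebesgue_measure.-integrable `[0, t] (EFin \o (fun u => b u (X u w)))} &
      exists I : R -> T -> R, forall t : R, 0 <= t ->
        is_ito_integral F B (fun u w => s u (X u w)) t (I t) /\
        {ae P, forall w, X t w =
          x0 + \int[lebesgue_measure]_(u in `[0, t]) b u (X u w) + I t w}].

Definition positive_solution F B (b s : R -> R -> R) X : Prop :=
  exists x0 : R, [/\ 0 < x0, sde_solution F B b s x0 X &
    {ae P, forall w, forall t : R, 0 <= t -> 0 < X t w}].

Definition globally_attractive F B (b s : R -> R -> R) : Prop :=
  forall X Y, positive_solution F B b s X -> positive_solution F B b s Y ->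
    {ae P, forall w, `|X t w - Y t w| @[t --> +oo] --> 0}.

End Processes.

Definition continuous_bounded (R : realType) (f : R -> R) : Prop :=
  {within `[0, +oo[, continuous f} /\
  exists M : R, forall t : R, 0 <= t -> `|f t| <= M.

(* Main.v *)
Require Import Defs.
From HB Require Import structures.
From mathcomp Require Import all_boot all_order all_algebra.
From mathcomp Require Import all_classical all_reals all_analysis.
From mathcomp Require Import measurable_realfun.
From mathcomp Require Import ring lra.

Set Implicit Arguments.
Unset Strict Implicit.
Unset Printing Implicit Defensive.

Import Order.TTheory GRing.Theory Num.Theory.
Import numFieldNormedType.Exports.

Local Open Scope classical_set_scope.
Local Open Scope ring_scope.

(* By Ito's formula the logarithm of a positive solution is
     ln X(t) = ln x0 + G(t) + N(t) - int_0^t a X,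
   with G(t) = int_0^t (r - sigma^2/2) and N(t) = int_0^t sigma dB, the same N
   for all solutions. This is proved directly: with H = X sigma in the Ito
   integral, the increments of X over a fine grid divided by X(t_k) differ from
   drift + sigma(t_k) dB_k by errors that are small together with their squares,
   and ln (1 + y) = y - y^2/2 + O(|y|^3) is summed along the grid.
   Hence with Phi = exp (G + N) one has (exp (int_0^t a X))' = x0 a Phi, so that
     X = x0 Phi / (1 + x0 A),   A(t) = int_0^t a Phi,
   and |X - Y| <= C Phi / A^2. Kolmogorov's inequality on the intervals [0, 2^k]
   and the Borel-Cantelli lemma give N(t) = o(t), while the hypothesis on
   r - sigma^2/2 gives G(t) >= k t - C; since a has integral at least c > 0 over
   [t - gamma, t], A(t) >= c Phi(t) exp (- eps t), and Phi / A^2 tends to 0. *)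

(** * Almost sure statements through outer probabilities *)

(** An Ito integral is given here only as a limit in probability, with a separate approximating
    sequence for each end time, and no moments of [X] are available. All estimates are therefore
    made outside events of small probability: adapted coefficients are switched off before they
    become large, second moments are computed for the switched sums, and on the good event nothing
    was switched. Statements about whole paths need not be measurable, hence outer probabilities.
    The increments of the integral over a grid only make sense together once a single elementary
    integrand approximates it at all grid times; this is proved before anything else about it. The
    integral of sigma itself is never constructed. The noise [N] is what remains of ln X after the
    drift is removed, and Ito's formula takes the form that [N t] is the limit in probability of
    Riemann sums in which [X] does not occur. This is why [X] and [Y] have the same noise. *)

Section OuterProbability.
Context (R : realType) (d : measure_display) (T : measurableType d)
  (P : probability T R).
Implicit Types (q : R) (Q : T -> Prop).

(* [Q] fails with outer probability at most [q]; [Q] need not be measurable. *)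
Definition whp q Q := exists A : set T,
  [/\ measurable A, (P A <= q%:E)%E & forall w, ~ A w -> Q w].

Lemma whp_mono q q' Q Q' : q <= q' -> (forall w, Q w -> Q' w) ->
  whp q Q -> whp q' Q'.
Proof.
move=> qq QQ [A [mA PA AQ]]; exists A; split=> //; last by move=> w /AQ/QQ.
by rewrite (le_trans PA)// lee_fin.
Qed.

Lemma whpW q Q Q' : (forall w, Q w -> Q' w) -> whp q Q -> whp q Q'.
Proof. exact: whp_mono. Qed.

Lemma whp_and q q' Q Q' : whp q Q -> whp q' Q' ->
  whp (q + q') (fun w => Q w /\ Q' w).
Proof.
move=> [A [mA PA AQ]] [A' [mA' PA' AQ']]; exists (A `|` A'); split.
- exact: measurableU.
- by rewrite (le_trans (measureU2 _ _ _))// EFinD leeD.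
- by move=> w /not_orP[/AQ ? /AQ'].
Qed.

Lemma whp_ae q Q : 0 <= q -> {ae P, forall w, Q w} -> whp q Q.
Proof.
move=> q0 [A [mA PA0 AQ]]; exists A; split=> //; first by rewrite PA0 lee_fin.
by move=> w nAw; apply: contrapT => nQ; apply: nAw; exact: AQ.
Qed.

Lemma whp_forall_lt q n (Q : nat -> T -> Prop) : 0 <= q ->
  (forall i, (i < n)%N -> whp q (Q i)) ->
  whp (q *+ n) (fun w => forall i, (i < n)%N -> Q i w).
Proof.
move=> q0; elim: n => [_|n ih QQ].
  by apply: whp_ae => //; apply: aeW.
rewrite mulrSr; have := whp_and (ih (fun i ni => QQ i (ltnW ni))) (QQ n (leqnn _)).
apply: whpW => w [Qi Qn] i; rewrite ltnS leq_eqVlt => /predU1P[->//|]; exact: Qi.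
Qed.

Lemma ae_of_whp Q : (forall q, 0 < q -> whp q Q) -> {ae P, forall w, Q w}.
Proof.
move=> Qq; have /choice[A AP] : forall n : nat, exists A : set T,
    [/\ measurable A, (P A <= (n.+1%:R^-1)%:E)%E & forall w, ~ A w -> Q w].
  by move=> n; apply: Qq.
have mA : measurable (\bigcap_n A n).
  by apply: bigcapT_measurable => n; case: (AP n).
exists (\bigcap_n A n); split=> //.
  apply/eqP; rewrite eq_le measure_ge0 andbT.
  apply/lee_addgt0Pr => e e0; rewrite add0e.
  have [n _ ne] := near_infty_natSinv_lt (PosNum e0).
  have [mAn PAn _] := AP n.
  apply: (@le_trans _ _ (P (A n))).
    by apply: le_measure; rewrite ?inE//; exact: bigcap_inf.
  by rewrite (le_trans PAn)// lee_fin ltW//; exact: (ne n (leqnn n)).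
move=> w nQ n _; have [_ _ AQ] := AP n.
by apply: contrapT => /AQ.
Qed.

Lemma ae_eq_of_whp (f g : T -> R) :
  (forall q e, 0 < q -> 0 < e -> whp q (fun w => `|f w - g w| <= e)) ->
  {ae P, forall w, f w = g w}.
Proof.
move=> fg; have H n : {ae P, forall w, `|f w - g w| <= n.+1%:R^-1}.
  by apply: ae_of_whp => q q0; apply: fg.
have := ae_foralln H; apply: filterS => w fgw.
apply/eqP; rewrite -subr_eq0 -normr_le0; apply/ler_addgt0Pr => e e0.
have [n _ ne] := near_infty_natSinv_lt (PosNum e0).
by rewrite add0r (le_trans (fgw n))// ltW//; exact: (ne n (leqnn n)).
Qed.

(** No union bound is paid: since [Q n] gets stronger with [n], a failure at [n] is a failure at all
    later indices, so it lies in [C n], which is inside [A n]. The sets [C n] increase and each has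
    measure at most [q], hence so does their union. *)
Lemma whp_foralln q (Q : nat -> T -> Prop) :
  (forall n w, Q n.+1 w -> Q n w) -> (forall n, whp q (Q n)) ->
  whp q (fun w => forall n, Q n w).
Proof.
move=> QS /choice[A AP].
have mA n : measurable (A n) by case: (AP n).
have Qle n m w : (n <= m)%N -> Q m w -> Q n w.
  move=> /subnK <-; elim: (m - n)%N => [//|k ih]; rewrite addSn => /QS; exact: ih.
pose C n := \bigcap_(m in [set m | (n <= m)%N]) A m.
have mC n : measurable (C n) by apply: bigcap_measurableType.
have mUC : measurable (\bigcup_n C n) by apply: bigcup_measurable.
exists (\bigcup_n C n); split=> //.
  have ndC : {homo C : n m / (n <= m)%N >-> (n <= m)%O}.
    move=> n m nm; apply/subsetPset => w Cw k /= mk; apply: Cw => /=.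
    exact: leq_trans mk.
  have := nondecreasing_cvg_mu (mu := P) mC mUC ndC.
  move=> /cvg_lim <-//; apply: lime_le.
    by apply: ereal_nondecreasing_is_cvgn => n m nm /=; apply: le_measure;
      rewrite ?inE//; apply/subsetPset/ndC.
  apply: nearW => n /=; have [_ PAn _] := AP n.
  apply: le_trans PAn; apply: le_measure; rewrite ?inE//.
  by apply: bigcap_inf => /=.
move=> w nC n; apply: contrapT => nQ; apply: nC; exists n => // m /= nm.
by have [_ _ AQ] := AP m; apply: contrapT => /AQ /(Qle _ _ _ nm).
Qed.

(** Continuity from above of the measure on the decreasing complements. It turns a random bound that
    exists on almost every path into one constant valid off a small event. *)
Lemma whp_ex_of_ae (Q : nat -> T -> Prop) :
  (forall n, measurable [set w | Q n w]) ->
  (forall n w, Q n w -> Q n.+1 w) ->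
  {ae P, forall w, exists n, Q n w} ->
  forall q, 0 < q -> exists n, whp q (Q n).
Proof.
move=> mQ QS QE q q0; pose C n := ~` [set w | Q n w].
have mC n : measurable (C n) by exact: measurableC.
have mIC : measurable (\bigcap_n C n) by by apply: bigcapT_measurable.
have Qle n m w : (n <= m)%N -> Q n w -> Q m w.
  by move=> /subnK <-; elim: (m - n)%N => [//|k ih]; rewrite addSn => /ih /QS.
have niC : {homo C : n m / (n <= m)%N >-> (m <= n)%O}.
  by move=> n m nm; apply/subsetPset => w /= nQ /(Qle _ _ _ nm).
have PC0 : P (\bigcap_n C n) = 0%E.
  apply: measure_negligible => //; apply: negligibleS QE => w Cw /= [n].
  exact: (Cw n).
have Ccvg : P (C n) @[n --> \oo] --> 0%E.
  rewrite -PC0; apply: nonincreasing_cvg_mu => //.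
  exact: le_lt_trans (probability_le1 P (mC 0%N)) (ltry _).
have [|n _ nq] := Ccvg [set x | (x < q%:E)%E].
  by apply: open_nbhs_nbhs; split; [exact: open_ereal_lt_ereal|rewrite /= lte_fin].
exists n, (C n); split=> //; first by apply: ltW; exact: (nq n (leqnn _)).
by move=> w /contrapT.
Qed.

(** The Borel-Cantelli lemma for the exceptional sets. *)
Lemma ae_eventually_of_whp (q : nat -> R) (Q : nat -> T -> Prop) :
  (\sum_(n <oo) (q n)%:E < +oo)%E -> (forall n, whp (q n) (Q n)) ->
  {ae P, forall w, exists n, forall m, (n <= m)%N -> Q m w}.
Proof.
move=> qoo /choice[A AP].
have mA n : measurable (A n) by case: (AP n).
exists (lim_sup_set A); split.
- apply: bigcap_measurable => // k _; exact: bigcup_measurable.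
- apply: lim_sup_set_cvg0 => //; apply: le_lt_trans qoo.
  by apply: lee_nneseries => // n _; case: (AP n).
- move=> w nQ n _; apply: contrapT => nA; apply: nQ; exists n => m nm.
  by have [_ _ AQ] := AP m; apply: AQ => Am; apply: nA; exists m.
Qed.

Lemma whp_markov (f : T -> R) (e v : R) : 0 < e -> measurable_fun setT f ->
  (forall w, 0 <= f w) -> (\int[P]_w (f w)%:E <= v%:E)%E ->
  whp (v / e) (fun w => f w <= e).
Proof.
move=> e0 mf f0 fv; exists (setT `&` [set w | (e%:E <= `|(f w)%:E|)%E]); split.
- apply: emeasurable_fun_c_infty => //; apply: measurableT_comp => //.
  exact/measurable_EFinP.
- rewrite mulrC EFinM lee_pdivlMl//.
  apply: le_trans (le_integral_abse _ _ _ _) _ => //; first exact/measurable_EFinP.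
  rewrite (eq_integral (EFin \o f))// => w _.
  by rewrite gee0_abs ?lee_fin.
- move=> w /= nw; rewrite leNgt; apply/negP => ef; apply: nw; split=> //=.
  by rewrite lee_fin (le_trans (ltW ef))// ler_norm.
Qed.

End OuterProbability.

(** * Moments of the normal distribution *)

Section Density.
Context (d : measure_display) (T : measurableType d) (R : realType)
  (nu mu : {measure set T -> \bar R}) (g : T -> R).
Hypotheses (mg : measurable_fun setT g) (g0 : forall x, 0 <= g x)
  (nuE : forall A, measurable A -> nu A = (\int[mu]_(x in A) (g x)%:E)%E).
Local Open Scope ereal_scope.

Import HBNNSimple.

Let ge0_integral_density_nnsfun (f : {nnsfun T >-> R}) :
  \int[nu]_x (f x)%:E = \int[mu]_x ((f x)%:E * (g x)%:E).
Proof.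
under [LHS]eq_integral do rewrite fimfunE -fsumEFin//.
rewrite [LHS]ge0_integral_fsum//; last 2 first.
  - by move=> r; exact/measurable_EFinP/measurableT_comp.
  - by move=> n x _; rewrite EFinM nnfun_muleindic_ge0.
under [RHS]eq_integral.
  move=> x xD; rewrite fimfunE -fsumEFin// muleC ge0_mule_fsumr; last first.
    by move=> r; rewrite EFinM nnfun_muleindic_ge0.
  over.
rewrite [RHS]ge0_integral_fsum//; last 2 first.
  - move=> r; apply: emeasurable_funM; first exact/measurable_EFinP.
    exact/measurable_EFinP/measurableT_comp.
  - move=> n x _; rewrite EFinM mule_ge0//; last by rewrite nnfun_muleindic_ge0.
    by rewrite lee_fin.
apply: eq_fsbigr => r rf; rewrite integralZl_indic_nnsfun//= integral_indic//= setIT.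
rewrite nuE// integral_mkcond.
have [r0|r0] := ltP r 0%R.
  rewrite (_ : f @^-1` [set r] = set0); last first.
    apply/seteqP; split=> // x /= fxr; have : (0 <= f x)%R by [].
    by rewrite fxr leNgt r0.
  rewrite [X in _ * X](_ : _ = 0) ?mule0; last first.
    by rewrite -(integral_mkcond set0) integral_set0.
  by rewrite integral0_eq// => x _; rewrite indic0/= mulr0 mule0.
rewrite -ge0_integralZl//.
- apply: eq_integral => x _; rewrite patchE indicE.
  by case: ifPn => _; rewrite ?mulr1 ?mulr0 ?mule0 ?mule0// muleC.
- by apply/measurable_restrict => //; exact/measurable_funTS/measurable_EFinP.
- by move=> x _; rewrite patchE; case: ifPn => // _; rewrite lee_fin.
Qed.

Lemma ge0_integral_density (f : T -> \bar R) :
  measurable_fun setT f -> (forall x, 0 <= f x) ->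
  \int[nu]_x f x = \int[mu]_x (f x * (g x)%:E).
Proof.
move=> mf f0; pose f_ := nnsfun_approx measurableT mf.
transitivity (lim (\int[nu]_x (f_ n x)%:E @[n --> \oo])).
  rewrite -monotone_convergence//=.
  - apply: eq_integral => ? /[!inE] xD; apply/esym/cvg_lim => //=.
    exact: cvg_nnsfun_approx.
  - by move=> n; exact/measurable_EFinP/measurable_funTS.
  - by move=> n ? _; rewrite lee_fin.
  - by move=> ? _ ? ? mn; rewrite lee_fin; exact/lefP/nd_nnsfun_approx.
under eq_fun do rewrite ge0_integral_density_nnsfun.
rewrite -monotone_convergence//=.
- apply: eq_integral => x _; apply/cvg_lim => //.
  by apply: cvgeZr => //; exact: cvg_nnsfun_approx.
- move=> n; apply: emeasurable_funM; last exact/measurable_EFinP.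
  exact/measurable_EFinP/measurable_funTS.
- by move=> n x _; rewrite mule_ge0// lee_fin.
- move=> x _ a b ab; apply: lee_wpmul2r; first by rewrite lee_fin.
  by rewrite lee_fin; exact/lefP/nd_nnsfun_approx.
Qed.

End Density.

Section NormalMoments.
Context (R : realType) (s : R).
Hypothesis s0 : 0 < s.
Local Notation N := (@normal_prob R 0 s).
Local Open Scope ereal_scope.

Let sN0 : s != 0%R. Proof. exact: lt0r_neq0. Qed.

Lemma ge0_integral_normal_prob (f : R -> R) :
  measurable_fun setT f -> (forall x, 0 <= f x)%R ->
  \int[N]_x (f x)%:E = \int[lebesgue_measure]_x (f x * normal_pdf 0 s x)%:E.
Proof.
move=> mf f0; rewrite (@ge0_integral_density _ _ _ _ lebesgue_measure
  (normal_pdf 0 s))//.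
- exact: measurable_normal_pdf.
- exact: normal_pdf_ge0.
- exact/measurable_EFinP.
Qed.

(* [expR (u * x) * normal_pdf 0 s x] is a multiple of the normal density
   with mean [u * s ^+ 2]. *)
Lemma normal_mgf (u : R) :
  \int[N]_x (expR (u * x))%:E = (expR (u ^+ 2 * s ^+ 2 / 2))%:E.
Proof.
rewrite ge0_integral_normal_prob//; last by apply: measurableT_comp.
under eq_integral => x _.
  rewrite (_ : _ * _ = expR (u ^+ 2 * s ^+ 2 / 2) * normal_pdf (u * s ^+ 2) s x)%R.
    rewrite EFinM; over.
  rewrite !normal_pdfE// mulrCA [in RHS]mulrCA; congr (_ * _)%R.
  by rewrite /normal_fun -!expRD; congr expR; field.
rewrite ge0_integralZl//.
- by rewrite integral_normal_pdf mule1.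
- by apply/measurable_EFinP; exact: measurable_normal_pdf.
- by move=> x _; rewrite lee_fin normal_pdf_ge0.
Qed.

(* Same idea: [expR (v * x ^+ 2)] changes the standard deviation to [s']. *)
Lemma normal_mgf_sqr (s' : R) : (0 < s')%R ->
  \int[N]_x (expR ((s' ^+ 2 - s ^+ 2) / (2 * s ^+ 2 * s' ^+ 2) * x ^+ 2))%:E =
  (s' / s)%:E.
Proof.
move=> s'0; have s'N0 : s' != 0%R by exact: lt0r_neq0.
rewrite ge0_integral_normal_prob//; last first.
  by apply: measurableT_comp => //; apply: measurable_funM.
under eq_integral => x _.
  rewrite (_ : _ * _ = s' / s * normal_pdf 0 s' x)%R.
    rewrite EFinM; over.
  rewrite !normal_pdfE// mulrCA [RHS]mulrA; congr (_ * _)%R; last first.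
    by rewrite /normal_fun -!expRD; congr expR; field; rewrite ?sN0 ?s'N0.
  rewrite /normal_peak -!mulrnAr !sqrtrM ?sqr_ge0 ?ltW// -!expr2 !sqr_sqrtr ?ltW//.
  by rewrite !invfM [in RHS]mulrA; congr (_ * _)%R; field; rewrite sN0 s'N0.
rewrite ge0_integralZl//.
- by rewrite integral_normal_pdf mule1.
- by apply/measurable_EFinP; exact: measurable_normal_pdf.
- by move=> x _; rewrite lee_fin normal_pdf_ge0.
- by rewrite lee_fin divr_ge0// ltW.
Qed.

(** Stated in [\bar R] for nonnegative functions, so that it applies to moments not yet known to be
    finite. *)
Let integral_affine (b c : R) (f : R -> R) : (0 <= b)%R -> (0 <= c)%R ->
  measurable_fun setT f -> (forall x, 0 <= f x)%R ->
  \int[N]_x (b + c * f x)%:E = b%:E + c%:E * \int[N]_x (f x)%:E.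
Proof.
move=> b0 c0 mf f0.
under eq_integral do rewrite EFinD.
rewrite ge0_integralD//; first last.
- by apply/measurable_EFinP => /=; apply: measurable_funM.
- by move=> x _; rewrite lee_fin mulr_ge0.
rewrite integral_cst//= [X in _ * X + _]probability_setT mule1; congr (_ + _).
under eq_integral do rewrite EFinM.
rewrite ge0_integralZl//; first exact/measurable_EFinP.
by move=> x _; rewrite lee_fin.
Qed.

(** The exponent of [normal_mgf_sqr]; it has the sign of s' - s. *)
Let vfun (s' : R) := ((s' ^+ 2 - s ^+ 2) / (2 * s ^+ 2 * s' ^+ 2))%R.

Let vfun_gt0 s' : (s < s')%R -> (0 < vfun s')%R.
Proof.
move=> ss'; have s'0 : (0 < s')%R by exact: lt_trans ss'.
by rewrite divr_gt0 ?mulr_gt0 ?exprn_gt0// subr_gt0 ltr_pXn2r// nnegrE ltW.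
Qed.

Let vfun_lt0 s' : (0 < s')%R -> (s' < s)%R -> (vfun s' < 0)%R.
Proof.
move=> s'0 ss'.
by rewrite pmulr_llt0 ?invr_gt0 ?mulr_gt0 ?exprn_gt0// subr_lt0 ltr_pXn2r// nnegrE ltW.
Qed.

Let mexp (v : R) : measurable_fun setT (fun x : R => expR (v * x ^+ 2)).
Proof. by apply: measurableT_comp => //; apply: measurable_funM. Qed.

(** Integrating 1 + v x^2 <= exp (v x^2) with v = [vfun s'] gives 1 + v m <= s'/s for the second
    moment m. For v > 0 this bounds m above by (s'/s - 1)/v <= s'^2; for v < 0, in the next lemma,
    it bounds m below by s'^2. Letting s' tend to s from either side would give the variance. *)
Let normal_sqr_le (s' : R) : (s < s')%R ->
  \int[N]_x (x ^+ 2)%:E <= (s' ^+ 2)%:E.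
Proof.
move=> ss'; have s'0 : (0 < s')%R by exact: lt_trans ss'.
have s'N0 := lt0r_neq0 s'0; have v0 := vfun_gt0 ss'.
have : 1 + (vfun s')%:E * \int[N]_x (x ^+ 2)%:E <= (s' / s)%:E.
  rewrite -(normal_mgf_sqr s'0) -/(vfun _) -(integral_affine ler01 (ltW v0))//; last first.
    by move=> x; exact: sqr_ge0.
  apply: ge0_le_integral => //.
  - by move=> x _; rewrite lee_fin addr_ge0// mulr_ge0 ?sqr_ge0// ltW.
  - by apply/measurable_EFinP; apply: measurable_funD => //; apply: measurable_funM.
  - by apply/measurable_EFinP; exact: mexp.
  - by move=> x _; rewrite lee_fin expR_ge1Dx.
rewrite -leeBrDl// -lee_pdivlMl// => /le_trans; apply.
rewrite -EFinB -EFinM lee_fin ler_pdivrMl//.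
have -> : (vfun s' * s' ^+ 2 = (s' / s - 1) * ((s' + s) / (2 * s)))%R.
  by rewrite /vfun; field; rewrite sN0 s'N0.
by rewrite ler_peMr ?subr_ge0 ?ler_pdivlMr ?mulr_gt0//; lra.
Qed.

Let normal_sqr_ge (s' : R) : (0 < s')%R -> (s' < s)%R ->
  (s' ^+ 2)%:E <= \int[N]_x (x ^+ 2)%:E.
Proof.
move=> s'0 ss'; have s'N0 := lt0r_neq0 s'0; have v0 := vfun_lt0 s'0 ss'.
have Nv0 : (0 < - vfun s')%R by rewrite oppr_gt0.
have : 1 <= (s' / s)%:E + (- vfun s')%:E * \int[N]_x (x ^+ 2)%:E.
  rewrite -(normal_mgf_sqr s'0) -/(vfun _) -[X in _ <= _ + X]add0e.
  rewrite -(integral_affine (lexx 0) (ltW Nv0))//; last first.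
    by move=> x; exact: sqr_ge0.
  rewrite -ge0_integralD//; first last.
  - by apply/measurable_EFinP; apply: measurable_funD => //; apply: measurable_funM.
  - by move=> x _; rewrite lee_fin addr_ge0// mulr_ge0 ?sqr_ge0// ltW.
  - by apply/measurable_EFinP; exact: mexp.
  rewrite -[leLHS]mule1 -[X in _ * X](@probability_setT _ _ _ N) -integral_cst//.
  apply: ge0_le_integral => //.
  - apply: emeasurable_funD; apply/measurable_EFinP; first exact: mexp.
    by apply: measurable_funD => //; apply: measurable_funM.
  - move=> x _; rewrite -EFinD lee_fin add0r -lerBlDr mulNr opprK.
    exact: expR_ge1Dx.
rewrite addeC -leeBlDr// -lee_pdivrMl// => /(le_trans _); apply.
rewrite -EFinB -EFinM lee_fin ler_pdivlMl//.
have -> : (- vfun s' * s' ^+ 2 = (1 - s' / s) * ((s' + s) / (2 * s)))%R.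
  by rewrite /vfun; field; rewrite sN0 s'N0.
by rewrite ler_piMr ?subr_ge0 ?ler_pdivrMr ?mulr_gt0//; lra.
Qed.

Lemma normal_variance : \int[N]_x (x ^+ 2)%:E = (s ^+ 2)%:E.
Proof.
have I0 : 0 <= \int[N]_x (x ^+ 2)%:E.
  by apply: integral_ge0 => x _; rewrite lee_fin sqr_ge0.
have s2s : (s < 2 * s)%R by rewrite ltr_pMl ?ltr1n.
have Ifin : \int[N]_x (x ^+ 2)%:E \is a fin_num.
  by rewrite ge0_fin_numE// (le_lt_trans (normal_sqr_le s2s))// ltry.
move: I0 normal_sqr_le normal_sqr_ge; rewrite -(fineK Ifin).
move: (fine _) => m; rewrite lee_fin => m0 lem gem; congr EFin; apply/eqP.
have s20 : (0 < s ^+ 2)%R by exact: exprn_gt0.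
(* If m differed from s^2, then s'^2, their midpoint, would lie strictly between them and contradict
   one of the two bounds. *)
pose s' := Num.sqrt ((m + s ^+ 2) / 2).
have s'0 : (0 < s')%R by rewrite sqrtr_gt0; lra.
have s'E : (s' ^+ 2 = (m + s ^+ 2) / 2)%R by rewrite sqr_sqrtr//; lra.
have [ms|sm|//] := ltgtP m (s ^+ 2)%R.
- have s's : (s' < s)%R by rewrite -(@ltr_pXn2r _ 2)// ?nnegrE ?ltW// s'E; lra.
  by have := gem _ s'0 s's; rewrite lee_fin s'E; lra.
- have s's : (s < s')%R by rewrite -(@ltr_pXn2r _ 2)// ?nnegrE ?ltW// s'E; lra.
  by have := lem _ s's; rewrite lee_fin s'E; lra.
Qed.

(** From v^2 x^4 / 2 <= exp (v x^2) with s' = 2 s: then v = 3 / (8 s^2), the right side integrates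
    to 2, and the bound is 256/9 s^4. Only the order s^4 matters later. *)
Lemma normal_fourth_moment : \int[N]_x (x ^+ 4)%:E <= (29 * s ^+ 4)%:E.
Proof.
have s2s : (s < 2 * s)%R by rewrite ltr_pMl ?ltr1n.
have v0 := vfun_gt0 s2s; have s'0 : (0 < 2 * s)%R by lra.
have : 0 + ((vfun (2 * s)) ^+ 2 / 2)%:E * \int[N]_x (x ^+ 4)%:E <= (2 * s / s)%:E.
  rewrite -(normal_mgf_sqr s'0) -/(vfun _) -(integral_affine (lexx 0))//; first last.
  - by move=> x; rewrite exprn_even_ge0.
  - by rewrite divr_ge0// sqr_ge0.
  apply: ge0_le_integral => //.
  - move=> x _; rewrite lee_fin add0r mulr_ge0 ?exprn_even_ge0//.
    by rewrite divr_ge0// sqr_ge0.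
  - by apply/measurable_EFinP; apply: measurable_funD => //; apply: measurable_funM.
  - by apply/measurable_EFinP; exact: mexp.
  - move=> x _; rewrite lee_fin add0r.
    apply: le_trans (expR_ge1Dxn 1 _); last by rewrite mulr_ge0 ?sqr_ge0// ltW.
    rewrite -[leLHS]add0r lerD// le_eqVlt; apply/orP; left; apply/eqP.
    rewrite (_ : 1.+1`! = 2%N)//. by field.
rewrite add0e -lee_pdivlMl ?divr_gt0 ?exprn_gt0// => /le_trans; apply.
rewrite -EFinM lee_fin /vfun.
have -> : (((((2 * s) ^+ 2 - s ^+ 2) / (2 * s ^+ 2 * (2 * s) ^+ 2)) ^+ 2 / 2)^-1
   * (2 * s / s) = 256 / 9 * s ^+ 4)%R.
  field; rewrite sN0 (_ : _ - _ = 3 * s ^+ 2)%R; last by ring.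
  by rewrite mulf_neq0 ?expf_neq0.
by rewrite ler_wpM2r ?exprn_even_ge0//; lra.
Qed.

(** The mean m satisfies 1 + u m <= E exp (u x) = exp (u^2 s^2 / 2) for every u. For small u of the
    sign of m the left side exceeds 1 to first order and the right side only to second order, so m =
    0. *)
Lemma normal_mean : N.-integrable setT (EFin \o @id R) /\ \int[N]_x x%:E = 0.
Proof.
have ix2 : N.-integrable setT (EFin \o (fun x : R => x ^+ 2)%R).
  apply/integrableP; split; first exact/measurable_EFinP.
  under eq_integral do rewrite gee0_abs ?lee_fin ?sqr_ge0//.
  by rewrite normal_variance ltry.
have i1 : N.-integrable setT (cst 1 \+ (EFin \o (fun x : R => x ^+ 2)%R)).
  apply: integrableD => //; exact: finite_measure_integrable_cst.
have ix : N.-integrable setT (EFin \o @id R).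
  apply: le_integrable i1 => //; first exact/measurable_EFinP.
  move=> x _ /=; rewrite lee_fin (@ger0_norm _ (1 + _))%R; last first.
    by rewrite addr_ge0 ?sqr_ge0.
  by rewrite -(real_normK (num_real x)); move: (normr_ge0 x); nra.
split=> //; have fx := integrable_fin_num measurableT ix.
rewrite -(fineK fx); congr EFin; move mE: (fine _) => m.
have mle (u : R) : (1 + u * m <= expR (u ^+ 2 * s ^+ 2 / 2))%R.
  rewrite -lee_fin -normal_mgf//.
  rewrite EFinD EFinM -mE fineK// -integralZl//.
  rewrite -[X in X + _]mule1 -[X in _ * X + _](@probability_setT _ _ _ N) -integral_cst//.
  rewrite -integralD//; first last.
  - exact: integrableZl.
  - exact: finite_measure_integrable_cst.
  apply: le_integral => //.
  - apply: integrableD => //; last exact: integrableZl.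
    exact: finite_measure_integrable_cst.
  - apply/integrableP; split.
      by apply/measurable_EFinP; apply: measurableT_comp => //; apply: measurable_funM.
    under eq_integral do rewrite gee0_abs ?lee_fin ?expR_ge0//.
    by rewrite normal_mgf// ltry.
  - by move=> x _; rewrite /= -EFinM -EFinD lee_fin expR_ge1Dx.
apply/eqP; apply: contrapT => /negP m0.
have m20 : (0 < m ^+ 2)%R by rewrite exprn_even_gt0.
have s20 : (0 < s ^+ 2)%R by exact: exprn_gt0.
(* This u is small enough for exp y <= 1 + 2 y to hold at y = u^2 s^2 / 2. With t the inverse of the
   denominator, a = m^2 and b = s^2, it gives t a <= (t a)(t b), which is impossible as t b < 1. *)
move: m20 s20 (mle (m / ((1 + m ^+ 2) * (1 + s ^+ 2)))%R).
set y := (_ / 2)%R; set a := (m ^+ 2)%R; set b := (s ^+ 2)%R => a0 b0.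
set t := ((1 + a) * (1 + b))^-1%R => le1.
have ab0 : (0 < (1 + a) * (1 + b))%R by rewrite mulr_gt0//; lra.
have t0 : (0 < t)%R by rewrite invr_gt0.
have tE : (t * ((1 + a) * (1 + b)) = 1)%R by rewrite mulVf// lt0r_neq0.
have yE : (y = t * t * a * b / 2)%R by rewrite /y /a /b /t; ring.
have mE2 : (m / ((1 + a) * (1 + b)) * m = t * a)%R by rewrite /a /t; ring.
rewrite mE2 in le1; clearbody y t a b; clear mE2.
have tab : (t * a * b < 1)%R.
  by rewrite -tE -mulrA ltr_pM2l//; nra.
have tb : (t * b < 1)%R by rewrite -tE ltr_pM2l//; nra.
have t1 : (t <= 1)%R.
  by rewrite -tE -{1}(mulr1 t) ler_pM2l//; nra.
have y0 : (0 <= y)%R.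
  by rewrite yE divr_ge0 ?ler0n// !mulr_ge0// ltW.
have y2 : (y <= 1 / 2)%R.
  have tab0 : (0 <= t * a * b)%R by rewrite !mulr_ge0// ltW.
  have : (t * (t * a * b) <= 1)%R by rewrite mulr_ile1// ltW.
  by rewrite yE; nra.
have ey : (expR y <= 1 + 2 * y)%R.
  have := expR_ge1Dx (- y); rewrite expRN => h.
  have e0 := expR_gt0 y.
  have : ((1 - y) * expR y <= 1)%R by rewrite -ler_pdivlMr// mul1r.
  by nra.
have : (t * a <= t * a * (t * b))%R.
  have := le_trans le1 ey; rewrite yE.
  by nra.
by rewrite leNgt gtr_pMr ?tb ?mulr_gt0.
Qed.

(** The constant is 30 = 1 + 29, from (x^2 - s^2)^2 <= s^4 + x^4 and the bound on the fourth
    moment. *)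
Lemma normal_sqr_centered :
  [/\ N.-integrable setT (EFin \o (fun x : R => x ^+ 2 - s ^+ 2)%R),
    \int[N]_x (x ^+ 2 - s ^+ 2)%:E = 0 &
    \int[N]_x ((x ^+ 2 - s ^+ 2) ^+ 2)%:E <= (30 * (s ^+ 2) ^+ 2)%:E].
Proof.
have ix2 : N.-integrable setT (EFin \o (fun x : R => x ^+ 2)%R).
  apply/integrableP; split; first exact/measurable_EFinP.
  under eq_integral do rewrite gee0_abs ?lee_fin ?sqr_ge0//.
  by rewrite normal_variance ltry.
have ic := finite_measure_integrable_cst N (s ^+ 2)%R measurableT.
split.
- exact: (integrableB measurableT ix2 ic).
- rewrite (@integralB_EFin _ _ _ N)//= normal_variance integral_cst//.
  by rewrite [X in _ * X]probability_setT mule1 subee.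
- have : \int[N]_x ((s ^+ 2) ^+ 2 + 1 * x ^+ 4)%:E <= (30 * (s ^+ 2) ^+ 2)%:E.
    rewrite integral_affine//; first last.
    + by move=> x; rewrite exprn_even_ge0.
    + exact: sqr_ge0.
    rewrite mul1e; apply: le_trans (leeD (lexx _) normal_fourth_moment) _.
    by rewrite -EFinD lee_fin; move: (s) => z; rewrite le_eqVlt; apply/orP; left; apply/eqP; ring.
  apply: le_trans; apply: ge0_le_integral => //.
  + by move=> x _; rewrite lee_fin sqr_ge0.
  + by apply/measurable_EFinP; apply: measurable_funX; apply: measurable_funB.
  + by apply/measurable_EFinP; apply: measurable_funD => //; apply: measurable_funM.
  + move=> x _; rewrite lee_fin mul1r.
    have : (0 <= x ^+ 2 * s ^+ 2)%R by rewrite mulr_ge0 ?sqr_ge0.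
    rewrite (_ : x ^+ 4 = (x ^+ 2) ^+ 2)%R; last by rewrite -exprM.
    by move: (x ^+ 2)%R (s ^+ 2)%R => a b; nra.
Qed.

End NormalMoments.

(** * Brownian increments and martingale transforms *)

Section IndependentProduct.
Context (R : realType) (d : measure_display) (T : measurableType d)
  (P : probability T R) (d' : measure_display) (U : measurableType d')
  (X : {RV P >-> R}) (D : {RV P >-> U}) (N : probability U R).
Hypothesis XD_indep : forall (A : set R) (C : set U), measurable A -> measurable C ->
  P ((X @^-1` A) `&` (D @^-1` C)) = (P (X @^-1` A) * N C)%E.
Local Open Scope ereal_scope.

Let mXD : measurable_fun setT (fun w => (X w, D w)).
Proof. exact: measurable_fun_pair. Qed.

Let XD : {RV P >-> (R * U)%type} := mfun_Sub (mem_set mXD).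

Let integral_prod (f : R * U -> \bar R) :
  \int[(distribution P X \x N)]_z f z = \int[distribution P XD]_z f z.
Proof.
apply: eq_measure_integral => A mA _.
by apply: product_measure_unique => // B C mB mC; rewrite -XD_indep.
Qed.

Let ge0_integral_indep (f : R -> \bar R) (h : U -> \bar R) :
  measurable_fun setT f -> (forall x, 0 <= f x) ->
  measurable_fun setT h -> (forall x, 0 <= h x) ->
  \int[P]_w (f (X w) * h (D w)) = \int[P]_w f (X w) * \int[N]_x h x.
Proof.
move=> mf f0 mh h0.
have mfh : measurable_fun setT (fun z : R * U => f z.1 * h z.2).
  by apply: emeasurable_funM; apply: measurableT_comp.
have := ge0_integral_distribution XD mfh (fun z => mule_ge0 (f0 z.1) (h0 z.2)).
rewrite -integral_prod => /esym -> .
rewrite fubini_tonelli1//; last by move=> z; exact: mule_ge0.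
transitivity (\int[distribution P X]_x (f x * \int[N]_y h y)).
  by apply: eq_integral => x _; rewrite /fubini_F/= ge0_integralZl.
rewrite ge0_integralZr//; last exact: integral_ge0.
by rewrite ge0_integral_distribution.
Qed.

(** The joint law of [X] and [D] agrees on rectangles with the product of the law of [X] and [N], so
    it is that product, and Fubini separates the factors. The nonnegative case comes first because
    it gives the integrability that Fubini needs. *)
Lemma integral_indep (h : U -> R) :
  P.-integrable setT (EFin \o X) -> N.-integrable setT (EFin \o h) ->
  P.-integrable setT (fun w => (X w * h (D w))%:E) /\
  \int[P]_w (X w * h (D w))%:E = \int[P]_w (X w)%:E * \int[N]_x (h x)%:E.
Proof.
move=> /[dup] iX /integrableP[mX Xoo] /[dup] ih /integrableP[mh hoo].
have mh' : measurable_fun setT h by exact/measurable_EFinP.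
pose f (z : R * U) := (z.1 * h z.2)%:E.
have mf : measurable_fun setT f.
  apply/measurable_EFinP; apply: measurable_funM; first exact: measurable_fst.
  by apply: measurableT_comp => //; exact: measurable_snd.
have ifXD : P.-integrable setT (f \o XD).
  apply/integrableP; split; first by apply: measurableT_comp.
  under eq_integral => w _ do rewrite /= normrM EFinM.
  rewrite (@ge0_integral_indep (abse \o EFin) (fun x => `|(h x)%:E|))//.
  - have X0 : 0 <= \int[P]_w (abse \o EFin) (X w).
      by apply: integral_ge0 => w _; exact: abse_ge0.
    by apply: lte_mul_pinfty => //; rewrite ge0_fin_numE.
  - by apply: measurableT_comp => //; exact/measurable_EFinP.
  - by move=> x; exact: abse_ge0.
  - by apply: measurableT_comp => //; exact: measurableT_comp.
split; first exact: ifXD.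
have := integral_distribution mf ifXD; rewrite -integral_prod => /esym.
rewrite -integral12_prod_meas1; last first.
  apply/integrableP; split=> //.
  rewrite integral_prod ge0_integral_distribution//; last first.
    by apply: measurableT_comp.
  by case/integrableP : ifXD.
have hfin := integrable_fin_num measurableT ih.
have [c cE] : exists c, \int[N]_x (h x)%:E = c%:E by exists (fine (\int[N]_x (h x)%:E)); rewrite fineK.
rewrite (eq_integral (fun x : R => (x * c)%R%:E)); last first.
  move=> x _; rewrite /fubini_F/= EFinM -cE -integralZl//.
rewrite integral_distribution; first last.
- by under eq_fun do rewrite /= EFinM; exact: integrableZr.
- by apply/measurable_EFinP; exact: measurable_funM.
move=> ->; rewrite cE -integralZr//.
Qed.

End IndependentProduct.

Definition fmeas (R : realType) (T : Type) (G : set (set T)) (X : T -> R) :=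
  forall C : set R, measurable C -> G (X @^-1` C).

(** Makes [G] the sigma-algebra of a measurable type, so that the closure of measurable functions
    under arithmetic and composition can be used for adaptedness. *)
Lemma fmeasP (R : realType) (d : measure_display) (T : measurableType d)
    (G : set (set T)) (X : T -> R) : sigma_algebra setT G ->
  fmeas G X <-> measurable_fun setT (X : g_sigma_algebraType G -> R).
Proof.
move=> sG; split=> [mX _ C mC|mX C mC].
  by rewrite setTI; apply: sub_sigma_algebra; exact: mX.
by have := mX measurableT C mC; rewrite setTI /measurable/= sigma_algebra_id.
Qed.

(** * Orthogonality of martingale differences built from Brownian increments *)

Section BrownianIncrements.
Context (R : realType) (d : measure_display) (T : measurableType d)
  (P : probability T R) (F : R -> set (set T)) (B : R -> T -> R).
Hypotheses (F_usual : usual_filtration P F)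
  (B_brownian : standard_brownian_motion P F B).
Local Notation Nor s t := (@normal_prob R 0 (Num.sqrt (t - s))).

Lemma fmeas_measurable (t : R) (X : T -> R) : 0 <= t -> fmeas (F t) X ->
  measurable_fun setT X.
Proof.
move=> t0 mX _ C mC; rewrite setTI; apply: (filtration_measurable F_usual t0).
exact: mX.
Qed.

Lemma fmeas_le (s t : R) (X : T -> R) : 0 <= s -> s <= t -> fmeas (F s) X ->
  fmeas (F t) X.
Proof. by move=> s0 st mX C mC; apply: (filtration_mono F_usual s0 st); exact: mX. Qed.

Lemma fmeasFP (t : R) (X : T -> R) : 0 <= t ->
  fmeas (F t) X <-> measurable_fun setT (X : g_sigma_algebraType (F t) -> R).
Proof. by move=> t0; apply: fmeasP; exact: (filtration_sigma_algebra F_usual). Qed.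

Lemma fmeas_brownian (s t : R) : 0 <= s -> s <= t -> fmeas (F t) (B s).
Proof.
by move=> s0 st; apply: (fmeas_le s0 st); exact: (brownian_adapted B_brownian s0).
Qed.

Lemma measurable_brownian (t : R) : 0 <= t -> measurable_fun setT (B t).
Proof. by move=> t0; apply: (fmeas_measurable t0); exact: fmeas_brownian. Qed.

Lemma integral_brownian_increment (s t : R) (X : T -> R) (h : R -> R) :
  0 <= s -> s < t -> fmeas (F s) X -> P.-integrable setT (EFin \o X) ->
  (Nor s t).-integrable setT (EFin \o h) ->
  P.-integrable setT (fun w => (X w * h (B t w - B s w))%:E) /\
  (\int[P]_w (X w * h (B t w - B s w))%:E =
   \int[P]_w (X w)%:E * \int[Nor s t]_x (h x)%:E)%E.
Proof.
move=> s0 st FX iX ih; have t0 : 0 <= t by exact: ltW (le_lt_trans s0 st).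
have mX := fmeas_measurable s0 FX.
have mD : measurable_fun setT (fun w => B t w - B s w).
  by apply: measurable_funB; exact: measurable_brownian.
pose X' : {RV P >-> R} := mfun_Sub (mem_set mX).
pose D : {RV P >-> measurableTypeR R} :=
  @mfun_Sub _ _ T (measurableTypeR R) _ (mem_set mD).
have := @integral_indep _ _ _ P _ _ X' D (Nor s t) _ h iX ih; apply => A C mA mC.
have /= -> := brownian_independent B_brownian s0 st (FX _ mA) mC.
by congr (_ * _)%E; have := brownian_gaussian B_brownian s0 st mC.
Qed.

Section DifferenceSums.
Variables (n : nat) (s : nat -> R) (c : nat -> T -> R) (h : nat -> R -> R)
  (v : nat -> R).
Hypotheses (s0 : 0 <= s 0)
  (ss : forall i, (i < n)%N -> s i < s i.+1)
  (mc : forall i, (i < n)%N -> fmeas (F (s i)) (c i))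
  (bc : forall i, (i < n)%N -> exists M, forall w, `|c i w| <= M)
  (mh : forall i, measurable_fun setT (h i))
  (h_mean : forall i, (i < n)%N -> (Nor (s i) (s i.+1)).-integrable setT (EFin \o h i)
     /\ (\int[Nor (s i) (s i.+1)]_x (h i x)%:E = 0)%E)
  (h_var : forall i, (i < n)%N ->
     (\int[Nor (s i) (s i.+1)]_x (h i x ^+ 2)%:E <= (v i)%:E)%E).

Let dB i w := B (s i.+1) w - B (s i) w.
Let S k w := \sum_(0 <= i < k) c i w * h i (dB i w).

Let s_ge0 k : (k <= n)%N -> 0 <= s k.
Proof.
by elim: k => // k ih kn; apply: le_trans (ih (ltnW kn)) _; exact/ltW/ss.
Qed.

(** Second moments add up: [S k] and [c k] are known at time [s k] and [h k] is centered for the law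
    of the next increment, so the cross term 2 S_k c_k h_k integrates to 0. The function [h] is left
    general to cover both [id] (the Ito isometry) and x^2 - ds (quadratic variation). *)
Lemma difference_sum_le :
  [/\ P.-integrable setT (fun w => (S n w ^+ 2)%:E), fmeas (F (s n)) (S n) &
    (\int[P]_w (S n w ^+ 2)%:E <=
     \int[P]_w (\sum_(0 <= i < n) c i w ^+ 2 * v i)%:E)%E].
Proof.
suff: forall k, (k <= n)%N -> [/\ P.-integrable setT (fun w => (S k w ^+ 2)%:E),
   fmeas (F (s k)) (S k),
   P.-integrable setT (fun w => (\sum_(0 <= i < k) c i w ^+ 2 * v i)%:E) &
    (\int[P]_w (S k w ^+ 2)%:E <=
     \int[P]_w (\sum_(0 <= i < k) c i w ^+ 2 * v i)%:E)%E].
  by move=> /(_ n (leqnn n)) [].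
elim=> [_|k ih kn].
  have S0 w : S 0 w = 0 by rewrite /S big_geq.
  have I0 : (fun w => (S 0 w ^+ 2)%:E) = cst 0%E.
    by apply/funext => w; rewrite S0 expr0n.
  have I0' : (fun w => (\sum_(0 <= i < 0) c i w ^+ 2 * v i)%:E) = cst 0%E.
    by apply/funext => w; rewrite big_geq.
  rewrite I0 I0'; split => //; [exact: integrable0| |exact: integrable0].
  rewrite (_ : S 0 = cst 0); last by apply/funext.
  by apply/fmeasFP => //.
have [iS mS iV SV] := ih (ltnW kn).
have sk0 : 0 <= s k by exact: s_ge0 (ltnW kn).
have sS := ss kn; have sSk0 := ltW (le_lt_trans sk0 sS).
have [M cM] := bc kn.
have mck := fmeas_measurable sk0 (mc kn).
have mSk := fmeas_measurable sk0 mS.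
have ic : P.-integrable setT (EFin \o (fun w => c k w ^+ 2)).
  have iM := finite_measure_integrable_cst P (M ^+ 2) measurableT.
  apply: (le_integrable measurableT _ _ iM).
    by apply/measurable_EFinP; exact: measurable_funX.
  move=> w _ /=; rewrite lee_fin !ger0_norm ?sqr_ge0//.
  by rewrite -(real_normK (num_real (c k w))) lerXn2r ?nnegrE// (le_trans _ (cM w)).
(* Dominated by S_k^2 + c_k^2; a bound on [S k] itself is not at hand. *)
have iSc : P.-integrable setT (EFin \o (fun w => 2 * (S k w * c k w))).
  have i2 := integrableD measurableT iS ic.
  apply: (le_integrable measurableT _ _ i2).
    by apply/measurable_EFinP; apply: measurable_funM => //; exact: measurable_funM.
  move=> w _ /=; rewrite lee_fin [leRHS]ger0_norm ?addr_ge0 ?sqr_ge0//.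
  move: (S k w) (c k w) => x y; rewrite ler_norml.
  have := sqr_ge0 (x + y); have := sqr_ge0 (x - y); rewrite sqrrB sqrrD => h1 h2.
  by apply/andP; split; lra.
have [ih0 h0] := h_mean kn.
have ih2 : (Nor (s k) (s k.+1)).-integrable setT (EFin \o (fun x => h k x ^+ 2)).
  apply/integrableP; split; first by apply/measurable_EFinP; apply: measurable_funX; exact: mh.
  under eq_integral do rewrite gee0_abs ?lee_fin ?sqr_ge0//.
  by rewrite (le_lt_trans (h_var kn))// ltry.
have F2Sc : fmeas (F (s k)) (fun w => 2 * (S k w * c k w)).
  apply/fmeasFP => //; apply: measurable_funM => //.
  by apply: measurable_funM; apply/fmeasFP => //; exact: mc.
have Fc2 : fmeas (F (s k)) (fun w => c k w ^+ 2).
  by apply/fmeasFP => //; apply: measurable_funX; apply/fmeasFP => //; exact: mc.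
have [i1 e1] := integral_brownian_increment sk0 sS F2Sc iSc ih0.
have [i2 e2] := integral_brownian_increment sk0 sS Fc2 ic ih2.
have SE w : S k.+1 w = S k w + c k w * h k (dB k w) by rewrite /S big_nat_recr.
have S2E : (fun w => (S k.+1 w ^+ 2)%:E) = (fun w => (S k w ^+ 2)%:E +
    (2 * (S k w * c k w) * h k (dB k w))%:E + (c k w ^+ 2 * h k (dB k w) ^+ 2)%:E)%E.
  by apply/funext => w; rewrite SE -!EFinD; congr EFin; ring.
have VE : (fun w => (\sum_(0 <= i < k.+1) c i w ^+ 2 * v i)%:E) =
    (fun w => (\sum_(0 <= i < k) c i w ^+ 2 * v i)%:E + (c k w ^+ 2 * v k)%:E)%E.
  by apply/funext => w; rewrite big_nat_recr//= EFinD.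
have i3 : P.-integrable setT (fun w => (c k w ^+ 2 * v k)%:E).
  by under eq_fun do rewrite EFinM; exact: integrableZr.
have i12 := integrableD measurableT iS i1.
rewrite S2E VE; split.
- exact: integrableD.
- apply/fmeasFP => //.
  rewrite (_ : S k.+1 = fun w => S k w + c k w * h k (dB k w)); last exact/funext.
  apply: measurable_funD.
    by apply/fmeasFP => //; exact: fmeas_le (ltW sS) mS.
  apply: measurable_funM.
    by apply/fmeasFP => //; apply: fmeas_le (ltW sS) _ => //; exact: mc.
  apply: measurableT_comp => //; apply: measurable_funB; apply/fmeasFP => //.
    exact: fmeas_brownian.
  exact: fmeas_brownian (ltW sS).
- exact: integrableD.
- rewrite !integralD//= e1 h0 mule0 adde0 e2 leeD//.
  under [leRHS]eq_integral do rewrite EFinM.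
  rewrite integralZr//; apply: lee_wpmul2l (h_var kn).
  by apply: integral_ge0 => w _; rewrite lee_fin sqr_ge0.
Qed.

End DifferenceSums.
End BrownianIncrements.

(** * Truncated sums, maximal inequality and quadratic variation along a grid *)

Section MartingaleTransforms.
Context (R : realType) (d : measure_display) (T : measurableType d)
  (P : probability T R) (F : R -> set (set T)) (B : R -> T -> R).
Hypotheses (F_usual : usual_filtration P F)
  (B_brownian : standard_brownian_motion P F B).

(** The switch of the term [i] looks at the running sum up to and including [i], so the sum never
    overshoots [e]: either the last term is switched off, or the whole untruncated sum is at most
    [e]. *)
Lemma sum_truncated_le (f : nat -> R) (e : R) n : 0 <= e -> (forall i, 0 <= f i) ->
  \sum_(0 <= i < n) f i * \1_(`]-oo, e]) (\sum_(0 <= j < i.+1) f j) <= e.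
Proof.
move=> e0 f0; elim: n => [|n ih]; first by rewrite big_geq.
have I01 (x : R) : 0 <= \1_(`]-oo, e]) x <= (1 : R).
  by rewrite indicE ler0n lern1 leq_b1.
rewrite big_nat_recr//=.
have [le|gt] := leP (\sum_(0 <= j < n.+1) f j) e; last first.
  by rewrite indicE memNset ?mulr0 ?addr0//= in_itv/= leNgt gt.
apply: le_trans le; rewrite [leRHS]big_nat_recr//= lerD//.
- by apply: ler_sum_nat => i _; rewrite ler_piMr//; case/andP: (I01 (\sum_(0 <= j < i.+1) f j)).
- by rewrite ler_piMr//; case/andP: (I01 (\sum_(0 <= j < n.+1) f j)).
Qed.

Section Grid.
Variables (n : nat) (s : nat -> R).
Hypotheses (s0 : 0 <= s 0) (ss : forall i, (i < n)%N -> s i < s i.+1).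

Let dB i w := B (s i.+1) w - B (s i) w.

Let s_ge0 k : (k <= n)%N -> 0 <= s k.
Proof.
by elim: k => // k ih kn; apply: le_trans (ih (ltnW kn)) _; exact/ltW/ss.
Qed.

Let s_le i k : (i <= k)%N -> (k <= n)%N -> s i <= s k.
Proof.
move=> /subnK <-; elim: (k - i)%N => [//|m ih]; rewrite addSn => mn.
by rewrite (le_trans (ih (ltnW mn)))// ltW// ss.
Qed.

Lemma integral_brownian_sum_le (c : nat -> T -> R) :
  (forall i, (i < n)%N -> fmeas (F (s i)) (c i)) ->
  (forall i, (i < n)%N -> exists M, forall w, `|c i w| <= M) ->
  [/\ P.-integrable setT (fun w => ((\sum_(0 <= i < n) c i w * dB i w) ^+ 2)%:E),
    measurable_fun setT (fun w => \sum_(0 <= i < n) c i w * dB i w) &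
    (\int[P]_w ((\sum_(0 <= i < n) c i w * dB i w) ^+ 2)%:E <=
     \int[P]_w (\sum_(0 <= i < n) c i w ^+ 2 * (s i.+1 - s i))%:E)%E].
Proof.
move=> mc bc.
have s_sqrt i : (i < n)%N -> 0 < Num.sqrt (s i.+1 - s i).
  by move=> ni; rewrite sqrtr_gt0 subr_gt0 ss.
have := @difference_sum_le R d T P F B F_usual B_brownian n s c (fun=> id)
  (fun i => s i.+1 - s i) s0 ss mc bc _ _ _.
case=> // [i ni|i ni|H1 H2 H3].
- have [] := normal_mean (s_sqrt i ni); split => //.
- by rewrite normal_variance ?s_sqrt// sqr_sqrtr// subr_ge0 ltW// ss.
- by split => //; apply: (fmeas_measurable F_usual (s_ge0 (leqnn n)) H2).
Qed.

(* The coefficients are switched off once the accumulated time integral of the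
   squares exceeds [v]. *)
Lemma whp_brownian_sums (K : nat) (c : nat -> nat -> T -> R) (q v e : R) :
  (forall k i, (i < n)%N -> fmeas (F (s i)) (c k i)) ->
  (forall k i, (i < n)%N -> exists M, forall w, `|c k i w| <= M) ->
  0 <= v -> 0 < e ->
  whp P q (fun w =>
    \sum_(0 <= k < K) \sum_(0 <= i < n) c k i w ^+ 2 * (s i.+1 - s i) <= v) ->
  whp P (q + v / e) (fun w =>
    \sum_(0 <= k < K) (\sum_(0 <= i < n) c k i w * dB i w) ^+ 2 <= e).
Proof.
move=> mc bc v0 e0 qv.
(* The maximum with 0 makes [f i] nonnegative for every [i], as [sum_truncated_le] asks; nothing
   orders the [s i] beyond [n]. *)
pose f i w := \sum_(0 <= k < K) c k i w ^+ 2 * Num.max 0 (s i.+1 - s i).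
have f0 i w : 0 <= f i w.
  by apply: sumr_ge0 => k _; rewrite mulr_ge0 ?sqr_ge0// le_max lexx.
have dsE i : (i < n)%N -> Num.max 0 (s i.+1 - s i) = s i.+1 - s i.
  by move=> ni; apply/max_idPr; rewrite subr_ge0 ltW// ss.
(* The term [i] is included, yet [E i] is known at time [s i]: the coefficients [c k i] are, and the
   length of the step is deterministic. *)
pose E i w := \sum_(0 <= j < i.+1) f j w.
pose c' k i w := c k i w * \1_(`]-oo, v]) (E i w).
have mE i : (i < n)%N -> fmeas (F (s i)) (fun w => \1_(`]-oo, v] : set R) (E i w) : R).
  move=> ni; have si0 := s_ge0 (ltnW ni).
  apply/(fmeasFP F_usual) => //; apply: measurableT_comp => //.
  rewrite /E.
  rewrite (_ : (fun w => _) = (fun w => \sum_(j < i.+1) f j w)); last first.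
    by apply/funext => w; rewrite big_mkord.
  apply: measurable_sum => j; apply: measurable_sum => k.
  apply: measurable_funM => //; apply: measurable_funX.
  have ji : (j <= i)%N by rewrite -ltnS.
  have jn := leq_ltn_trans ji ni.
  apply/(fmeasFP F_usual) => //; apply: (fmeas_le F_usual) (mc k j jn).
    by apply: s_ge0; exact: ltnW.
  by apply: s_le ji _; exact: ltnW.
have mc' k i : (i < n)%N -> fmeas (F (s i)) (c' k i).
  move=> ni; have si0 := s_ge0 (ltnW ni).
  by apply/(fmeasFP F_usual) => //; apply: measurable_funM;
    apply/(fmeasFP F_usual) => //; [exact: mc|exact: mE].
have bc' k i : (i < n)%N -> exists M, forall w, `|c' k i w| <= M.
  move=> ni; have [M cM] := bc k i ni; exists M => w.
  rewrite /c' normrM indicE; apply: le_trans (cM w).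
  by case: (_ \in _); rewrite ?normr1 ?mulr1 ?normr0 ?mulr0.
have H k := integral_brownian_sum_le (mc' k) (bc' k).
(* Markov's inequality is applied once, to the sum over [k], so the exceptional probability does not
   grow with [K]. *)
pose Z w := \sum_(0 <= k < K) (\sum_(0 <= i < n) c' k i w * dB i w) ^+ 2.
have mZ : measurable_fun setT Z.
  apply: measurable_sum => k; apply: measurable_funX.
  by have [_ ? _] := H k.
have vZ : (\int[P]_w (Z w)%:E <= v%:E)%E.
  have mV k : measurable_fun setT
      (fun w => (\sum_(0 <= i < n) c' k i w ^+ 2 * (s i.+1 - s i))%:E).
    apply/measurable_EFinP; under eq_fun do rewrite big_mkord.
    apply: measurable_sum => i; apply: measurable_funM => //; apply: measurable_funX.
    exact: (fmeas_measurable F_usual (s_ge0 (ltnW (ltn_ord i))) (mc' k _ (ltn_ord i))).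
  have V0 k w : (0 <= (\sum_(0 <= i < n) c' k i w ^+ 2 * (s i.+1 - s i))%:E)%E.
    rewrite lee_fin big_mkord; apply: sumr_ge0 => i _.
    by rewrite mulr_ge0 ?sqr_ge0// subr_ge0 ltW// ss.
  under eq_integral do rewrite /Z -sumEFin.
  rewrite ge0_integral_sum//; first last.
  - by move=> k w _; rewrite lee_fin sqr_ge0.
  - by move=> k; apply/measurable_EFinP/measurable_funX; have [_ ? _] := H k.
  apply: (@le_trans _ _ (\sum_(0 <= k < K) \int[P]_w
      (\sum_(0 <= i < n) c' k i w ^+ 2 * (s i.+1 - s i))%:E)%E).
    by apply: lee_sum => k _; have [] := H k.
  rewrite -ge0_integral_sum//.
  rewrite -[leRHS]mule1 -(@probability_setT _ _ _ P) -integral_cst//.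
  apply: ge0_le_integral => //.
  - by move=> w _; exact: sume_ge0.
  - exact: emeasurable_sum.
  - move=> w _; rewrite sumEFin lee_fin exchange_big/=.
    rewrite (eq_big_nat _ _ (F2 := fun i => f i w * \1_(`]-oo, v]) (E i w))).
      exact: sum_truncated_le.
    move=> i /andP[_ ni]; rewrite /f big_distrl/=; apply: eq_bigr => k _.
    rewrite dsE// /c' indicE; case: (_ \in _); rewrite ?mulr1 ?mulr0//.
    by rewrite expr0n mul0r.
have Z0 w : 0 <= Z w by apply: sumr_ge0 => k _; exact: sqr_ge0.
(* On this event all [E i], [i < n], are at most [v]: no coefficient was switched off and [Z] is the
   original sum. *)
have := whp_and qv (whp_markov e0 mZ Z0 vZ); apply: whpW => w [le Zle].
 apply: le_trans Zle; rewrite le_eqVlt; apply/orP; left; apply/eqP.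
  apply: eq_bigr => k _; congr (_ ^+ 2); apply: eq_big_nat => i /andP[_ ni].
  rewrite /c' indicE mem_set ?mulr1//= in_itv/=; apply: le_trans le.
  rewrite exchange_big/= /E [leRHS](@big_cat_nat _ _ _ i.+1)//= -[leLHS]addr0 lerD//.
    apply: ler_sum_nat => j /andP[_ ji]; rewrite /f ler_sum// => k' _.
    by rewrite dsE// (leq_ltn_trans _ ni).
  rewrite big_nat_cond; apply: sumr_ge0 => j; rewrite andbT => /andP[_ jn].
  by apply: sumr_ge0 => k' _; rewrite mulr_ge0 ?sqr_ge0// subr_ge0 ltW// ss.
Qed.

Let s_sub_ge0 i : (i < n)%N -> 0 <= s i.+1 - s i.
Proof. by move=> ni; rewrite subr_ge0 ltW// ss. Qed.

(* Kolmogorov's inequality: the coefficients are switched off once the partial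
   sums leave [-e, e]. *)
Lemma whp_max_brownian_sum (c : nat -> R) (e : R) : 0 < e ->
  whp P ((\sum_(0 <= i < n) c i ^+ 2 * (s i.+1 - s i)) / e ^+ 2)
    (fun w => forall k, (k <= n)%N -> `|\sum_(0 <= i < k) c i * dB i w| <= e).
Proof.
move=> e0; pose S k w := \sum_(0 <= i < k) c i * dB i w.
pose I i w : R := \prod_(j < i.+1) \1_(`[- e, e] : set R) (S j w).
have mS k : (k <= n)%N -> fmeas (F (s k)) (S k).
  move=> kn; apply/(fmeasFP F_usual); first exact: s_ge0.
  rewrite /S; under eq_fun do rewrite big_mkord; apply: measurable_sum => i.
  have ik : (i < k)%N by []; have ni := leq_trans ik kn.
  apply: measurable_funM => //; apply: measurable_funB;
    apply/(fmeasFP F_usual) => //; try exact: s_ge0.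
  - by apply: (fmeas_brownian F_usual B_brownian); [exact: s_ge0|exact: s_le].
  - by apply: (fmeas_brownian F_usual B_brownian); [exact/s_ge0/ltnW|exact: s_le (ltnW ik) kn].
have mI i : (i < n)%N -> fmeas (F (s i)) (I i).
  move=> ni; have si0 := s_ge0 (ltnW ni); apply/(fmeasFP F_usual) => //.
  apply: measurable_prod => j _; have ji : (j <= i)%N by rewrite -ltnS.
  apply: measurableT_comp => //; apply/(fmeasFP F_usual) => //.
  have jn := leq_trans ji (ltnW ni).
  by apply: (fmeas_le F_usual) (mS j jn); [exact: s_ge0|exact: s_le ji (ltnW ni)].
have I01 i w : I i w = 0 \/ I i w = 1.
  rewrite /I; elim/big_ind: _ => [|x y [->|->] [->|->]|j _]; rewrite ?mulr0 ?mulr1 ?mul0r; auto.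
  by rewrite indicE; case: (_ \in _); auto.
pose c' i w := c i * I i w.
have mc' i : (i < n)%N -> fmeas (F (s i)) (c' i).
  move=> ni; have si0 := s_ge0 (ltnW ni).
  by apply/(fmeasFP F_usual) => //; apply: measurable_funM => //;
    apply/(fmeasFP F_usual) => //; exact: mI.
have bc' i : (i < n)%N -> exists M, forall w, `|c' i w| <= M.
  move=> ni; exists `|c i| => w; rewrite /c'.
  by have [->|->] := I01 i w; rewrite ?mulr0 ?mulr1 ?normr0.
have [iZ mZ Zle] := integral_brownian_sum_le mc' bc'.
set Z := (fun w => _) in mZ; pose V := \sum_(0 <= i < n) c i ^+ 2 * (s i.+1 - s i).
have ZV : (\int[P]_w (Z w ^+ 2)%:E <= V%:E)%E.
  apply: le_trans Zle _; rewrite -[leRHS]mule1 -(@probability_setT _ _ _ P) -integral_cst//.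
  apply: ge0_le_integral => //.
  - move=> w _; rewrite lee_fin big_mkord; apply: sumr_ge0 => i _.
    by rewrite mulr_ge0 ?sqr_ge0// s_sub_ge0.
  - apply/measurable_EFinP; under eq_fun do rewrite big_mkord.
    apply: measurable_sum => i; apply: measurable_funM => //; apply: measurable_funX.
    exact: (fmeas_measurable F_usual (s_ge0 (ltnW (ltn_ord i))) (mc' _ (ltn_ord i))).
  - move=> w _; rewrite lee_fin; apply: ler_sum_nat => i /andP[_ ni].
    rewrite ler_wpM2r ?s_sub_ge0// /c' exprMn.
    by have [->|->] := I01 i w; rewrite ?expr0n ?mulr0 ?sqr_ge0// expr1n mulr1.
have mZ2 : measurable_fun setT (fun w => Z w ^+ 2) by exact: measurable_funX.
have e20 : 0 < e ^+ 2 by exact: exprn_gt0.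
have := whp_markov e20 mZ2 (fun w => sqr_ge0 (Z w)) ZV; apply: whpW => w Zw.
pose S' k := \sum_(0 <= i < k) c' i w * dB i w.
(* The switched sum [S'] either still coincides with [S], which has stayed in [-e, e], or is frozen
   at the value with which [S] first left [-e, e]. A final value in [-e, e] therefore excludes an
   exit. *)
have alt k : (forall j, (j <= k)%N -> `|S j w| <= e) /\ S' k = S k w \/
    e < `|S' k| /\ exists2 j, (j <= k)%N & e < `|S j w|.
  elim: k => [|k [[Se SS]|[eS [j jk eSj]]]].
  - left; split; last by rewrite /S' /S !big_geq.
    by move=> j; rewrite leqn0 => /eqP ->; rewrite /S big_geq// normr0 ltW.
  - have Ik : I k w = 1.
      rewrite /I big1// => -[j /= jk] _; rewrite indicE mem_set//= in_itv/=.
      by rewrite -ler_norml Se// -ltnS.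
    have SkE : S' k.+1 = S k.+1 w.
      by rewrite /S' /S !big_nat_recr//= -/(S' k) SS /c' Ik mulr1.
    have [le|gt] := leP `|S k.+1 w| e.
      left; split=> // j; rewrite leq_eqVlt => /predU1P[->//|]; exact: Se.
    by right; rewrite SkE; split=> //; exists k.+1.
  - right; split; last by exists j => //; exact: leqW.
    rewrite /S' big_nat_recr//= /c' (_ : I k w = 0) ?mulr0 ?mul0r ?addr0//.
    have jk1 : (j < k.+1)%N by [].
    rewrite /I (bigD1 (Ordinal jk1))//= indicE memNset ?mul0r//= in_itv/=.
    by rewrite -ler_norml leNgt eSj.
have [[Se _]//|[eZ _]] := alt n.
suff : e ^+ 2 < Z w ^+ 2 by rewrite ltNge Zw.
by rewrite -[Z w ^+ 2]real_normK ?num_real// ltrXn2r// ltW.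
Qed.

(** Chebyshev's inequality for the martingale differences dB^2 - ds, whose second moments are at
    most 30 ds^2. On a grid of mesh t/n the probability is O(1/n), whence the quadratic
    variation. *)
Lemma whp_brownian_sqr_sum (c : nat -> R) (e : R) : 0 < e ->
  whp P ((\sum_(0 <= i < n) c i ^+ 2 * (30 * (s i.+1 - s i) ^+ 2)) / e ^+ 2)
    (fun w => `|\sum_(0 <= i < n) c i * (dB i w ^+ 2 - (s i.+1 - s i))| <= e).
Proof.
move=> e0; pose h i (x : R) := x ^+ 2 - (s i.+1 - s i).
have mh i : measurable_fun setT (h i).
  by apply: measurable_funB => //; exact: measurable_funX.
have hN i : (i < n)%N -> let N := @normal_prob R 0 (Num.sqrt (s i.+1 - s i)) in
    [/\ N.-integrable setT (EFin \o h i), (\int[N]_x (h i x)%:E = 0)%E &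
    (\int[N]_x (h i x ^+ 2)%:E <= (30 * (s i.+1 - s i) ^+ 2)%:E)%E].
  move=> ni /=; have sq0 : 0 < Num.sqrt (s i.+1 - s i) by rewrite sqrtr_gt0 subr_gt0 ss.
  by have := normal_sqr_centered sq0; rewrite sqr_sqrtr// s_sub_ge0.
have mc i : (i < n)%N -> fmeas (F (s i)) (cst (c i)).
  by move=> ni; apply/(fmeasFP F_usual) => //; exact/s_ge0/ltnW.
have bc i : (i < n)%N -> exists M, forall w : T, `|cst (c i) w| <= M.
  by exists `|c i|.
have hmean i : (i < n)%N -> let N := @normal_prob R 0 (Num.sqrt (s i.+1 - s i)) in
    N.-integrable setT (EFin \o h i) /\ (\int[N]_x (h i x)%:E = 0)%E.
  by move=> /hN[].
have hvar i (ni : (i < n)%N) := let: And3 _ _ H := hN i ni in H.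
have [_ mS SV] := difference_sum_le F_usual B_brownian s0 ss mc bc mh hmean hvar.
have {}mS := fmeas_measurable F_usual (s_ge0 (leqnn n)) mS.
have e20 : 0 < e ^+ 2 by exact: exprn_gt0.
have mS2 := measurable_funX 2 mS.
have cV : (\int[P]_w (\sum_(0 <= i < n) cst (c i) w ^+ 2 * (30 * (s i.+1 - s i) ^+ 2))%:E
    <= (\sum_(0 <= i < n) c i ^+ 2 * (30 * (s i.+1 - s i) ^+ 2))%:E)%E.
  by rewrite -[leRHS]mule1 -(@probability_setT _ _ _ P) -integral_cst.
have {cV}SV := le_trans SV cV.
have := whp_markov e20 mS2 (fun w => sqr_ge0 _) SV; apply: whpW => w.
rewrite -[leLHS]real_normK ?num_real//.
by rewrite ler_pXn2r ?nnegrE ?normr_ge0 ?(ltW e0).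
Qed.

End Grid.
End MartingaleTransforms.

Lemma sqr_sum_disjoint (R : comNzRingType) (n : nat) (f : nat -> R) :
  (forall i j, (i < j < n)%N -> f i * f j = 0) ->
  (\sum_(0 <= i < n) f i) ^+ 2 = \sum_(0 <= i < n) f i ^+ 2.
Proof.
elim: n => [|n ih] f0; first by rewrite !big_geq ?expr0n.
rewrite !big_nat_recr//= sqrrD ih; last first.
  by move=> i j /andP[ij jn]; apply: f0; rewrite ij ltnW.
have S0 : (\sum_(0 <= i < n) f i) * f n = 0.
  rewrite mulr_suml big_nat_cond big1// => i; rewrite andbT => /= ni.
  by apply: f0; rewrite ni leqnn.
by rewrite S0 mul0rn addr0.
Qed.

(** Used in [elementary_refine] with two functions [g]: the indicator of x <= y as a function of y,
    which decomposes the integrand over the grid, and the Brownian path, which decomposes its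
    integral. *)
Lemma telescope_grid (R : realDomainType) (G : seq R) (u v : R) (g : R -> R) :
  sorted <%R G -> u \in G -> v \in G -> u <= v ->
  \sum_(0 <= i < (size G).-1) (u <= G`_i < v)%R%:R * (g G`_i.+1 - g G`_i) = g v - g u.
Proof.
move=> sG uG vG uv; pose a := index u G; pose b := index v G.
have aG : (a < size G)%N by rewrite index_mem.
have bG : (b < size G)%N by rewrite index_mem.
have Ga : G`_a = u by exact: nth_index.
have Gb : G`_b = v by exact: nth_index.
have ltE i j : (i < size G)%N -> (j < size G)%N -> (G`_i < G`_j) = (i < j)%N.
  by move=> iG jG; exact: (lt_sorted_ltn_nth 0 sG).
have leE i j : (i < size G)%N -> (j < size G)%N -> (G`_i <= G`_j) = (i <= j)%N.
  by move=> iG jG; exact: (lt_sorted_leq_nth 0 sG).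
have ab : (a <= b)%N by rewrite -leE// Ga Gb.
have bS : (b <= (size G).-1)%N by rewrite -ltnS prednK// (leq_trans _ bG).
rewrite (big_cat_nat _ bS)//= (big_cat_nat _ ab)//=.
rewrite big_nat_cond big1 ?add0r; last first.
  move=> i /andP[/andP[_ ia] _]; rewrite -Ga leE ?(ltn_trans ia aG)//.
  by rewrite leqNgt ia mul0r.
rewrite addrC big_nat_cond big1 ?add0r; last first.
  move=> i /andP[/andP[bi iG] _]; rewrite -Gb ltE//; last by rewrite (leq_trans iG)// leq_pred.
  by rewrite ltnNge bi andbF mul0r.
rewrite -[in RHS]Ga -[in RHS]Gb -(telescope_sumr (fun i => g G`_i))//.
apply: eq_big_nat => i /andP[ai ib].
have iG := ltn_trans ib bG.
by rewrite -Ga -Gb leE ?ltE ?iG// ai ib mul1r.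
Qed.

(** * Ito integrals along grids *)

Section ElementaryIntegrals.
Context (R : realType) (d : measure_display) (T : measurableType d)
  (P : probability T R) (F : R -> set (set T)) (B : R -> T -> R).
Local Notation mu := (@lebesgue_measure R).

(* [elementary p t phi J]: [phi] is an elementary integrand on ]p, t] and [J]
   is its stochastic integral. *)
Inductive elementary (p t : R) : (R -> T -> R) -> (T -> R) -> Prop :=
| Elementary0 : elementary p t (fun _ _ => 0) (fun=> 0)
| Elementary1 u v c : p <= u -> u <= v -> v <= t -> fmeas (F u) c ->
    (exists M, forall w, `|c w| <= M) ->
    elementary p t (fun x w => c w * \1_(`]u, v]) x)
      (fun w => c w * (B v w - B u w))
| ElementaryD phi J phi' J' : elementary p t phi J -> elementary p t phi' J' ->
    elementary p t (fun x w => phi x w + phi' x w) (fun w => J w + J' w).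

Lemma eq_elementary p t phi phi' J J' : elementary p t phi J ->
  (forall x w, phi x w = phi' x w) -> (forall w, J w = J' w) ->
  elementary p t phi' J'.
Proof.
move=> + pp JJ; rewrite (_ : phi' = phi); last by apply/funext => x; apply/funext.
by rewrite (_ : J' = J)//; apply/funext.
Qed.

Lemma elementary_widen p t p' t' phi J : p' <= p -> t <= t' ->
  elementary p t phi J -> elementary p' t' phi J.
Proof.
move=> pp tt; elim=> [|u v c pu uv vt mc bc|? ? ? ? _ ? _ ?].
- exact: Elementary0.
- apply: Elementary1 => //; [exact: le_trans pu|exact: le_trans tt].
- exact: ElementaryD.
Qed.

Lemma elementary_sum p t n (phi : nat -> R -> T -> R) (J : nat -> T -> R) :
  (forall k, (k < n)%N -> elementary p t (phi k) (J k)) ->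
  elementary p t (fun x w => \sum_(0 <= k < n) phi k x w)
    (fun w => \sum_(0 <= k < n) J k w).
Proof.
elim: n => [_|n ih pJ].
  by apply: (eq_elementary (Elementary0 p t)) => *; rewrite big_geq.
have h := ElementaryD (ih (fun k kn => pJ k (ltnW kn))) (pJ n (leqnn _)).
by apply: (eq_elementary h) => *; rewrite big_nat_recr.
Qed.

Lemma measurable_elementary p t phi J w : elementary p t phi J ->
  measurable_fun setT (phi^~ w).
Proof.
elim=> [|u v c _ _ _ _ _|? ? ? ? _ ? _ ?] //; first exact: measurable_funM.
exact: measurable_funD.
Qed.

Lemma elementary_support p t phi J x w : elementary p t phi J ->
  phi x w != 0 -> p < x <= t.
Proof.
elim=> [|u v c pu _ vt _ _|phi1 ? ? ? _ ih _ ih']; first by rewrite eqxx.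
- rewrite mulf_eq0 negb_or indicE => /andP[_]; have [|] := boolP (x \in _); last by rewrite eqxx.
  rewrite inE/= in_itv/= => /andP[ux xv] _.
  by rewrite (le_lt_trans pu)//= (le_trans xv).
- have [->|/ih//] := eqVneq (phi1 x w) 0.
  by rewrite add0r => /ih'.
Qed.

Hypotheses (F_usual : usual_filtration P F)
  (B_brownian : standard_brownian_motion P F B).

(** Every step of [phi] starts at or after [p], when [g] is already known, so the products remain
    nonanticipating. The factor will be a bounded version of 1/X at the start of a grid interval. *)
Lemma elementaryM p t phi J g : 0 <= p -> fmeas (F p) g ->
  (exists M, forall w, `|g w| <= M) -> elementary p t phi J ->
  elementary p t (fun x w => g w * phi x w) (fun w => g w * J w).
Proof.
move=> p0 mg [M gM].
elim=> [|u v c pu uv vt mc [K cK]|phi1 J1 phi2 J2 _ h1 _ h2].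
- by apply: (eq_elementary (Elementary0 p t)) => *; rewrite mulr0.
- have u0 := le_trans p0 pu.
  have mgc : fmeas (F u) (fun w => g w * c w).
    apply/(fmeasFP F_usual) => //; apply: measurable_funM.
      by apply/(fmeasFP F_usual) => //; exact: (fmeas_le F_usual) mg.
    exact/(fmeasFP F_usual).
  have bgc : exists K, forall w, `|g w * c w| <= K.
    by exists (M * K) => w; rewrite normrM ler_pM.
  by apply: (eq_elementary (Elementary1 pu uv vt mgc bgc)) => *; rewrite mulrA.
- by apply: (eq_elementary (ElementaryD h1 h2)) => *; rewrite mulrDr.
Qed.

Lemma elementaryB p t phi J phi' J' : 0 <= p ->
  elementary p t phi J -> elementary p t phi' J' ->
  elementary p t (fun x w => phi x w - phi' x w) (fun w => J w - J' w).
Proof.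
move=> p0 pJ pJ'.
have h : elementary p t (fun x w => -1 * phi' x w) (fun w => -1 * J' w).
  apply: (elementaryM (g := cst (-1))) => //; first exact/(fmeasFP F_usual).
  by exists 1 => w; rewrite normrN1.
by apply: (eq_elementary (ElementaryD pJ h)) => *; rewrite mulN1r.
Qed.

(** [J' r] is the integral of [phi] up to time [r]. It lets one integrand serve all the grid times
    below [t]. *)
Lemma elementary_restrict t phi J : elementary 0 t phi J ->
  exists J' : R -> T -> R, [/\ J' 0 = fun=> 0, J' t = J &
    forall p q, 0 <= p -> p <= q -> q <= t ->
      elementary p q (fun x w => phi x w * \1_(`]p, q]) x)
        (fun w => J' q w - J' p w)].
Proof.
elim=> [|u v c u0 uv vt mc bc|phi1 J1 phi2 J2 _ [J1' [J10 J1t H1]] _ [J2' [J20 J2t H2]]].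
(* The zero integrand, a single step and a sum are treated in turn; for a step the integral up to
   [r] evaluates the Brownian path at [r] clamped to [u, v]. *)
- exists (fun _ _ => 0); split=> // p q _ _ _.
  by apply: (eq_elementary (Elementary0 p q)) => *; rewrite ?mul0r ?subr0.
- pose m r := Num.max u (Num.min v r).
  exists (fun r w => c w * (B (m r) w - B u w)); split.
  + have -> : m 0 = u by apply/max_idPl; rewrite ge_min u0 orbT.
    by apply/funext => w; rewrite subrr mulr0.
  + by apply/funext => w; rewrite /m (min_idPl vt) (max_idPr uv).
  + move=> p q p0 pq qt.
    pose u' := Num.max u p; pose v' := Num.max u' (Num.min v q).
    have uu' : u <= u' by rewrite le_max lexx.
    have u'v' : u' <= v' by rewrite le_max lexx.
    (* Below [u] the restriction vanishes; this case is separate because [u'] may then lie beyond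
       [q]. Otherwise ]u', v'] is the intersection of ]u, v] and ]p, q], written so that u' <= v'
       even when it is empty. *)
    have [qu|uq] := leP q u.
      apply: (eq_elementary (Elementary0 p q)) => [x|] w.
        rewrite -mulrA !indicE; have [|_] := boolP (x \in `]u, v]%classic); last by rewrite mul0r mulr0.
        rewrite inE/= in_itv/= => /andP[ux _]; rewrite memNset ?mulr0//= in_itv/=.
        by rewrite leNgt (le_lt_trans qu ux) andbF.
      have mE r : r <= u -> m r = u by move=> ru; rewrite /m; apply/max_idPl; rewrite ge_min ru orbT.
      by rewrite !mE ?subrr// (le_trans pq).
    have pu' : p <= u' by rewrite le_max lexx orbT.
    have v'q : v' <= q by rewrite !ge_max (ltW uq) pq ge_min lexx orbT.
    have mc' : fmeas (F u') c by exact: (fmeas_le F_usual) mc.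
    apply: (eq_elementary (Elementary1 pu' u'v' v'q mc' bc)) => [x|] w.
      rewrite -mulrA; congr (_ * _); rewrite !indicE -natrM mulnb; congr ((_ _)%:R).
      rewrite !mem_setE/= !in_itv/= /v' /u' gt_max !le_max le_min.
      by case: (ltP u x); case: (ltP p x) => //=; rewrite andbF.
    have mq : m q = Num.max u (Num.min v q) by [].
    rewrite -mulrBr; congr (_ * _); rewrite opprB addrA subrK; rewrite {}mq.
    have [pu|up] := leP p u.
      rewrite /v' /u' (max_idPl pu) /m.
      by rewrite (_ : Num.max u (Num.min v p) = u)//; apply/max_idPl; rewrite ge_min pu orbT.
    have u'E : u' = p by rewrite /u' (max_idPr (ltW up)).
    rewrite /v' u'E /m; have [vp|pv] := leP v p.
      have vq := le_trans vp pq.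
      by rewrite (min_idPl vq) (max_idPr uv) (max_idPl vp) !subrr.
    rewrite (max_idPr (ltW up)).
    have pm : p <= Num.min v q by rewrite le_min ltW.
    by rewrite (max_idPr pm) (max_idPr (ltW (lt_le_trans up pm))).
- exists (fun r w => J1' r w + J2' r w); split.
  + by apply/funext => w; rewrite J10 J20 addr0.
  + by apply/funext => w; rewrite J1t J2t.
  + move=> p q p0 pq qt; apply: (eq_elementary (ElementaryD (H1 p q p0 pq qt) (H2 p q p0 pq qt))).
      by move=> x w; rewrite mulrDl.
    by move=> w; ring.
Qed.

(* Any strictly increasing grid containing the finite set [G0] refines [phi]. *)
Lemma elementary_refine t phi J : elementary 0 t phi J ->
  exists G0 : seq R, all (fun x => 0 <= x) G0 /\
    forall G : seq R, sorted <%R G -> all (fun x => 0 <= x) G -> {subset G0 <= G} ->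
    exists c : nat -> T -> R,
      [/\ forall i, (i < (size G).-1)%N -> fmeas (F G`_i) (c i),
        forall i, (i < (size G).-1)%N -> exists M, forall w, `|c i w| <= M,
        forall x w, phi x w =
          \sum_(0 <= i < (size G).-1) c i w * \1_(`]G`_i, G`_i.+1]) x &
        forall w, J w =
          \sum_(0 <= i < (size G).-1) c i w * (B G`_i.+1 w - B G`_i w)].
Proof.
elim=> [|u v c u0 uv vt mc [M cM]|phi1 J1 phi2 J2 _ [G1 [G10 H1]] _ [G2 [G20 H2]]].
- exists [::]; split=> // G sG G0 _; exists (fun _ _ => 0); split=> //.
  + move=> i iG; apply/(fmeasFP F_usual) => //; apply: (allP G0).
    by rewrite mem_nth// (leq_trans iG)// leq_pred.
  + by move=> i _; exists 0 => w; rewrite normr0.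
  + by move=> x w; rewrite big1// => i _; rewrite mul0r.
  + by move=> w; rewrite big1// => i _; rewrite mul0r.
- exists [:: u; v]; split=> [|G sG G0 uvG]; first by rewrite /= u0 (le_trans u0).
  have uG : u \in G by apply: uvG; rewrite inE eqxx.
  have vG : v \in G by apply: uvG; rewrite !inE eqxx orbT.
  have Gi0 i : (i < (size G).-1)%N -> 0 <= G`_i.
    by move=> iG; apply: (allP G0); rewrite mem_nth// (leq_trans iG)// leq_pred.
  (* The coefficient on a grid interval is [c] or 0; it is [c] only if the interval starts at or
     after [u], when [c] is known. *)
  exists (fun i w => c w * (u <= G`_i < v)%R%:R); split.
  + move=> i iG; apply/(fmeasFP F_usual); first exact: Gi0.
    have [uGi|] := boolP (u <= G`_i < v); last first.
      by rewrite (_ : (fun w => _) = cst 0)//; apply/funext => w; rewrite mulr0.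
    rewrite (_ : (fun w => _) = c); last by apply/funext => w; rewrite mulr1.
    apply/(fmeasFP F_usual); first exact: Gi0.
    by apply: (fmeas_le F_usual) mc => //; case/andP : uGi.
  + move=> i _; exists M => w; rewrite normrM; apply: le_trans (cM w).
    by case: (_ <= _ < _); rewrite ?normr1 ?mulr1 ?normr0 ?mulr0.
  + move=> x w; under eq_bigr do rewrite -mulrA; rewrite -mulr_sumr; congr (_ * _).
    have hE r s : r <= s -> \1_(`]r, s]) x = (x <= s)%R%:R - (x <= r)%R%:R :> R.
      move=> rs; rewrite indicE mem_setE in_itv/=.
      have [xr|rx] := leP x r; first by rewrite (le_trans xr rs) subrr.
      by rewrite subr0.
    rewrite hE// -(telescope_grid (fun y => (x <= y)%R%:R) sG uG vG uv).
    apply: eq_big_nat => i /andP[_ iG]; rewrite hE//.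
    rewrite (lt_sorted_leq_nth 0 sG) ?inE//; last by rewrite -[size G]prednK// ?(leq_trans _ iG)// (leq_trans _ (leq_pred _))// (leq_trans _ iG).
    by rewrite (leq_trans iG)// leq_pred.
  + move=> w; under eq_bigr do rewrite -mulrA; rewrite -mulr_sumr; congr (_ * _).
    by rewrite (telescope_grid (fun y => B y w) sG uG vG uv).
- exists (G1 ++ G2); split=> [|G sG G0 sub]; first by rewrite all_cat G10.
  have [c1 [mc1 bc1 p1 j1]] := H1 G sG G0 (fun x xG => sub x ltac:(by rewrite mem_cat xG)).
  have [c2 [mc2 bc2 p2 j2]] := H2 G sG G0 (fun x xG => sub x ltac:(by rewrite mem_cat xG orbT)).
  exists (fun i w => c1 i w + c2 i w); split.
  + move=> i iG; have Gi0 : 0 <= G`_i.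
      by apply: (allP G0); rewrite mem_nth// (leq_trans iG)// leq_pred.
    by apply/(fmeasFP F_usual) => //; apply: measurable_funD; apply/(fmeasFP F_usual) => //;
      [exact: mc1|exact: mc2].
  + move=> i iG; have [M1 M1c] := bc1 i iG; have [M2 M2c] := bc2 i iG.
    by exists (M1 + M2) => w; rewrite (le_trans (ler_normD _ _))// lerD.
  + by move=> x w; rewrite p1 p2 -big_split/=; apply: eq_bigr => i _; rewrite mulrDl.
  + by move=> w; rewrite j1 j2 -big_split/=; apply: eq_bigr => i _; rewrite mulrDl.
Qed.

End ElementaryIntegrals.

(** * The isometry estimate for elementary integrands *)

Section ElementaryIsometry.
Context (R : realType) (d : measure_display) (T : measurableType d)
  (P : probability T R) (F : R -> set (set T)) (B : R -> T -> R).
Hypotheses (F_usual : usual_filtration P F)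
  (B_brownian : standard_brownian_motion P F B).
Local Notation mu := (@lebesgue_measure R).
Local Notation elementary := (elementary F B).

Lemma integral_sqr_step (n : nat) (s c : nat -> R) :
  (forall i j, (i < j)%N -> (j <= n)%N -> s i < s j) ->
  (\int[mu]_x ((\sum_(0 <= i < n) c i * \1_(`]s i, s i.+1]) x) ^+ 2)%:E =
   (\sum_(0 <= i < n) c i ^+ 2 * (s i.+1 - s i))%:E)%E.
Proof.
move=> slt.
under eq_integral => x _.
  rewrite sqr_sum_disjoint; last first.
    move=> i j /andP[ij jn]; rewrite !indicE !mem_setE !in_itv/=.
    have [si|] := ltP (s i) x; last by rewrite mulr0 mul0r.
    have [xi|] := leP x (s i.+1); last by rewrite mulr0 mul0r.
    have [sj|] := ltP (s j) x; last by rewrite mulr0 mulr0.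
    have := lt_le_trans sj xi; rewrite ltNge.
    have -> // : s i.+1 <= s j.
    by have := ij; rewrite leq_eqVlt => /predU1P[->//|/slt]; move=> /(_ (ltnW jn))/ltW.
  rewrite -sumEFin.
  over.
rewrite ge0_integral_sum//; first last.
- by move=> i x _; rewrite lee_fin sqr_ge0.
- by move=> i; apply/measurable_EFinP; apply: measurable_funX; apply: measurable_funM.
rewrite -sumEFin; apply: eq_big_nat => i /andP[_ ni].
under eq_integral => x _.
  rewrite (_ : _ ^+ 2 = c i ^+ 2 * \1_(`]s i, s i.+1]) x); last first.
    by rewrite exprMn indicE; case: (_ \in _); rewrite ?expr1n ?expr0n.
  rewrite EFinM.
  over.
rewrite ge0_integralZl//; last by rewrite lee_fin sqr_ge0.
- rewrite integral_indic//= setIT [RHS]EFinM; congr (_ * _)%E.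
  have /= -> := @lebesgue_measure_itv R `]s i, s i.+1].
  by rewrite lte_fin slt.
- exact/measurable_EFinP.
Qed.

(** A common refinement of the grids makes all the integrands step functions on one grid, where
    [whp_brownian_sums] applies. This replaces the Ito isometry when the squares of the integrands
    are controlled only in probability. *)
Lemma whp_elementary t (K : nat) (phi : nat -> R -> T -> R) (J : nat -> T -> R)
    (q v e : R) :
  (forall k, (k < K)%N -> elementary 0 t (phi k) (J k)) -> 0 <= v -> 0 < e ->
  whp P q (fun w =>
    \sum_(0 <= k < K) \int[mu]_x (phi k x w ^+ 2)%:E <= v%:E)%E ->
  whp P (q + v / e) (fun w => \sum_(0 <= k < K) J k w ^+ 2 <= e).
Proof.
move=> el v0 e0 qv.
have /choice[G0 HG0] : forall k, exists G0 : seq R, (k < K)%N ->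
  all (fun x => 0 <= x) G0 /\
    forall G : seq R, sorted <%R G -> all (fun x => 0 <= x) G -> {subset G0 <= G} ->
    exists c : nat -> T -> R,
      [/\ forall i, (i < (size G).-1)%N -> fmeas (F G`_i) (c i),
        forall i, (i < (size G).-1)%N -> exists M, forall w, `|c i w| <= M,
        forall x w, phi k x w =
          \sum_(0 <= i < (size G).-1) c i w * \1_(`]G`_i, G`_i.+1]) x &
        forall w, J k w =
          \sum_(0 <= i < (size G).-1) c i w * (B G`_i.+1 w - B G`_i w)].
  move=> k; have [kK|_] := ltnP k K; last by exists [::].
  by have [G0 HG0] := elementary_refine F_usual (el k kK); exists G0.
(* The point 0 is added so that the grid is not empty. *)
pose G := sort <=%R (undup (0 :: flatten [seq G0 k | k <- iota 0 K])).
have sG : sorted <%R G by rewrite /G sort_lt_sorted undup_uniq.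
have GE x : (x \in G) = (x == 0) || (x \in flatten [seq G0 k | k <- iota 0 K]).
  by rewrite /G mem_sort mem_undup inE.
have G_ge0 : all (fun x => 0 <= x) G.
  apply/allP => x; rewrite GE => /predU1P[->//|].
  move=> /flatten_mapP[k]; rewrite mem_iota add0n => /= kK.
  by have [G0k _] := HG0 k kK; exact: (allP G0k).
have subG k : (k < K)%N -> {subset G0 k <= G}.
  move=> kK x xG; rewrite GE; apply/orP; right; apply/flatten_mapP.
  by exists k => //; rewrite mem_iota add0n.
pose n := (size G).-1.
have nG i : (i <= n)%N -> (i < size G)%N.
  move=> i_n; rewrite (leq_ltn_trans i_n)// ltn_predL lt0n size_eq0.
  by apply/eqP => G_nil; have := GE 0; rewrite eqxx G_nil.
have /choice[c Hc] : forall k, exists c : nat -> T -> R,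
      [/\ forall i, (i < n)%N -> fmeas (F G`_i) (c i),
        forall i, (i < n)%N -> exists M, forall w, `|c i w| <= M,
        (k < K)%N -> forall x w, phi k x w =
          \sum_(0 <= i < n) c i w * \1_(`]G`_i, G`_i.+1]) x &
        (k < K)%N -> forall w, J k w =
          \sum_(0 <= i < n) c i w * (B G`_i.+1 w - B G`_i w)].
  move=> k; have [kK|_] := ltnP k K.
    have [_ H] := HG0 k kK; have [c [? ? ? ?]] := H G sG G_ge0 (subG k kK).
    by exists c.
  (* Coefficients for [k >= K] are never summed but must be adapted and bounded. *)
  exists (fun i => cst 0); split=> //.
  - move=> i i_n; apply/(fmeasFP F_usual) => //.
    by apply: (allP G_ge0); rewrite mem_nth// nG// ltnW.
  - by move=> i _; exists 0 => w; rewrite normr0.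
have slt i j : (i < j)%N -> (j <= n)%N -> G`_i < G`_j.
  move=> ij jn; rewrite (lt_sorted_ltn_nth 0 sG)// inE ?nG//.
  exact: leq_trans (ltnW ij) jn.
have := @whp_brownian_sums R d T P F B F_usual B_brownian n (nth 0 G) _ _ K c q v e _ _ v0 e0 _.
move=> /(_ _ _ _ _ _)/whpW; apply.
- move=> w; under eq_big_nat => k /andP[_ kK].
    have [_ _ _ JE] := Hc k; rewrite -(JE kK); over.
  by [].
- by apply: (allP G_ge0); rewrite mem_nth// nG.
- by move=> i i_n; exact: slt.
- by move=> k i i_n; have [H _ _ _] := Hc k; exact: H.
- by move=> k i i_n; have [_ H _ _] := Hc k; exact: H.
- apply: whpW qv => w; under eq_big_nat => k /andP[_ kK].
    have [_ _ pE _] := Hc k.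
    under eq_integral do rewrite (pE kK).
    rewrite integral_sqr_step//; over.
  by rewrite sumEFin lee_fin.
Qed.

Lemma simple_process_elementary t (phi : simple_process R T) :
  nonanticipating F t phi ->
  elementary 0 t (simple_value phi) (simple_integral B phi).
Proof.
case=> t0 tn H; pose n := sp_size phi.
have mono i j : (i <= j)%N -> (j <= n)%N -> sp_time phi i <= sp_time phi j.
  move=> /subnK <-; elim: (j - i)%N => [//|m ih]; rewrite addSn => mn.
  by have [le _ _] := H _ mn; rewrite (le_trans (ih (ltnW mn))).
have el k : (k < n)%N -> elementary 0 t
    (fun x w => sp_coef phi k w * \1_(`]sp_time phi k, sp_time phi k.+1]) x)
    (fun w => sp_coef phi k w * (B (sp_time phi k.+1) w - B (sp_time phi k) w)).
  move=> kn; have [le mc bc] := H k kn; apply: Elementary1 => //.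
  - by rewrite -t0; apply: mono => //; exact: ltnW.
  - by rewrite -tn; exact: mono.
by apply: (eq_elementary (elementary_sum el)) => *; rewrite big_mkord.
Qed.

End ElementaryIsometry.

(** * Increments of an Ito integral over a grid *)

Section ItoApproximation.
Context (R : realType) (d : measure_display) (T : measurableType d)
  (P : probability T R) (F : R -> set (set T)) (B : R -> T -> R).
Hypotheses (F_usual : usual_filtration P F)
  (B_brownian : standard_brownian_motion P F B).
Local Notation mu := (@lebesgue_measure R).
Local Notation elementary := (elementary F B).

Lemma cvg0_in_probability_whp (Y : nat -> T -> \bar R) (e q : R) :
  cvg0_in_probability P Y -> 0 < e -> 0 < q ->
  exists N, forall n, (N <= n)%N -> whp P q (fun w => (Y n w <= e%:E)%E).
Proof.
move=> [mY Y0] e0 q0; have [|N _ NY] := Y0 e e0 [set x | (x < q%:E)%E].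
  by apply: open_nbhs_nbhs; split; [exact: open_ereal_lt_ereal|rewrite /= lte_fin].
exists N => n Nn; exists [set w | (e%:E <= Y n w)%E]; split.
- by rewrite -[X in measurable X]setTI; exact: emeasurable_fun_c_infty.
- by apply: ltW; exact: NY.
- by move=> w /negP; rewrite -ltNge => /ltW.
Qed.

Lemma ito_integral_approx (H : R -> T -> R) (t : R) (I : T -> R) (q e : R) :
  is_ito_integral P F B H t I -> 0 < q -> 0 < e ->
  exists phi J, elementary 0 t phi J /\
    whp P q (fun w => [/\ measurable_fun `[0, t] (H^~ w),
      (\int[mu]_(x in `[0%R, t]) ((phi x w - H x w) ^+ 2)%:E <= e%:E)%E &
      `|J w - I w| <= e]).
Proof.
move=> [_ Hae _ [phi [nphi c1 c2]]] q0 e0.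
have q30 : 0 < q / 3 by rewrite divr_gt0.
have [N1 H1] := cvg0_in_probability_whp c1 e0 q30.
have [N2 H2] := cvg0_in_probability_whp c2 e0 q30.
pose n := maxn N1 N2.
exists (simple_value (phi n)), (simple_integral B (phi n)); split.
  exact: simple_process_elementary.
have h0 := whp_ae (ltW q30) Hae.
have := whp_and h0 (whp_and (H1 n (leq_maxl _ _)) (H2 n (leq_maxr _ _))).
apply: whp_mono => [|w [[mH _] [h1 h2]]]; last by split.
by rewrite le_eqVlt; apply/orP; left; apply/eqP; field.
Qed.

Lemma sqr_sub_le (x y z : R) : (x - y) ^+ 2 <= 2 * (x - z) ^+ 2 + 2 * (y - z) ^+ 2.
Proof. by have := sqr_ge0 (x + y - 2 * z); nra. Qed.

Lemma sqrD_le (x y : R) : (x + y) ^+ 2 <= 2 * x ^+ 2 + 2 * y ^+ 2.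
Proof. by have := sqr_ge0 (x - y); nra. Qed.

Lemma integral_sqr_sub_le (p t : R) (f g h : R -> R) : p <= t ->
  measurable_fun setT f -> measurable_fun setT g -> measurable_fun `[0, t] h ->
  (\int[mu]_(x in `[0%R, p]) ((f x - g x) ^+ 2)%:E <=
   2%:E * \int[mu]_(x in `[0%R, t]) ((f x - h x) ^+ 2)%:E +
   2%:E * \int[mu]_(x in `[0%R, p]) ((g x - h x) ^+ 2)%:E)%E.
Proof.
move=> pt mf mg mh.
have s0t : `[0, p]%classic `<=` (`[0, t]%classic : set R).
  by apply: subset_itvl; rewrite bnd_simp.
have mhp : measurable_fun `[0, p] h by exact: measurable_funS mh.
have m1 q : q <= t -> measurable_fun `[0, q] (fun x => (f x - h x) ^+ 2).
  move=> qt; apply: measurable_funX; apply: measurable_funB; first exact: measurable_funTS.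
  by apply: measurable_funS mh => //; apply: subset_itvl; rewrite bnd_simp.
have m2 : measurable_fun `[0, p] (fun x => (g x - h x) ^+ 2).
  by apply: measurable_funX; apply: measurable_funB => //; exact: measurable_funTS.
apply: (@le_trans _ _ (2%:E * \int[mu]_(x in `[0%R, p]) ((f x - h x) ^+ 2)%:E +
   2%:E * \int[mu]_(x in `[0%R, p]) ((g x - h x) ^+ 2)%:E)%E); last first.
  apply: leeD => //; apply: lee_wpmul2l => //.
  apply: ge0_subset_integral => //.
  - by apply/measurable_EFinP; exact: m1.
  - by move=> x _; rewrite lee_fin sqr_ge0.
rewrite -!ge0_integralZl//; first last.
- by move=> x _; rewrite lee_fin sqr_ge0.
- by apply/measurable_EFinP; exact: m1.
- by move=> x _; rewrite lee_fin sqr_ge0.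
- exact/measurable_EFinP.
rewrite -ge0_integralD//; first last.
- by apply/measurable_EFinP => /=; exact: measurable_funM.
- by move=> x _; rewrite -EFinM lee_fin mulr_ge0 ?sqr_ge0.
- by apply/measurable_EFinP => /=; apply: measurable_funM => //; exact: m1.
- by move=> x _; rewrite -EFinM lee_fin mulr_ge0 ?sqr_ge0.
apply: ge0_le_integral => //.
- by move=> x _; rewrite lee_fin sqr_ge0.
- apply/measurable_EFinP/measurable_funTS => /=.
  by apply: measurable_funX; exact: measurable_funB.
- apply/measurable_EFinP => /=; apply: measurable_funD; apply: measurable_funM => //.
  exact: m1.
- by move=> x _; rewrite -!EFinM -EFinD lee_fin sqr_sub_le.
Qed.

Lemma integral_support (p : R) (f : R -> R) : (forall x, f x != 0 -> 0 < x <= p) ->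
  (\int[mu]_x (f x ^+ 2)%:E = \int[mu]_(x in `[0%R, p]) (f x ^+ 2)%:E)%E.
Proof.
move=> fs; rewrite [RHS]integral_mkcond; apply: eq_integral => x _.
rewrite patchE mem_setE in_itv/=; case: ifPn => // xp.
have [->|/fs /andP[x0 xp']] := eqVneq (f x) 0; first by rewrite expr0n.
by move: xp; rewrite (ltW x0) xp'.
Qed.

(** The definition approximates [I (tau k)] by integrands depending on [k]. But both the restriction
    of [phi] to [0, tau k] and the integrand [phik] attached to [tau k] are close to [H] in square
    mean over [0, tau k], hence to each other, so [whp_elementary] makes their integrals close. *)
Lemma ito_integral_grid_approx (H : R -> T -> R) (t : R) (I : R -> T -> R)
    (n : nat) (tau : nat -> R) (q e : R) :
  (forall p, 0 <= p -> is_ito_integral P F B H p (I p)) ->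
  (forall k, (k <= n)%N -> 0 <= tau k <= t) -> 0 < q -> 0 < e ->
  exists phi J, elementary 0 t phi (J t) /\
   (forall p p', 0 <= p -> p <= p' -> p' <= t ->
      elementary p p' (fun x w => phi x w * \1_(`]p, p']) x)
        (fun w => J p' w - J p w)) /\
    whp P q (fun w => [/\ measurable_fun `[0, t] (H^~ w),
      (\int[mu]_(x in `[0%R, t]) ((phi x w - H x w) ^+ 2)%:E <= e%:E)%E &
      forall k, (k <= n)%N -> `|J (tau k) w - I (tau k) w| <= e]).
Proof.
move=> HI tau0t q0 e0; have t0 : 0 <= t.
  by have /andP[? ?] := tau0t 0%N (leq0n _); exact: le_trans (_ : tau 0%N <= _).
(* The approximation on [0, t] costs [q1] and each of the n + 1 grid times costs 4 [q1]. *)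
pose q1 := q / (5 * n.+1%:R).
have q10 : 0 < q1 by rewrite divr_gt0// mulr_gt0.
pose e2 := (e / 2) ^+ 2; have e20 : 0 < e2 by rewrite exprn_gt0// divr_gt0.
(* The squared distance of [phi] and [phik] integrates to at most 2 e1 + 2 e1, so the second bound
   makes the Markov term 4 e1 / e2 at most [q1]. *)
pose e1 := Num.min (e / 2) (e2 * q1 / 4).
have e10 : 0 < e1 by rewrite lt_min !divr_gt0// mulr_gt0.
have e1e : e1 <= e / 2 by rewrite ge_min lexx.
have e1q : 4 * e1 / e2 <= q1.
  have e1q4 : e1 <= e2 * q1 / 4 by rewrite ge_min lexx orbT.
  by rewrite ler_pdivrMr//; lra.
have [phi [Jt [el good]]] := ito_integral_approx (HI t t0) q10 e10.
have [J [J0 JtE elJ]] := elementary_restrict F_usual el.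
exists phi, J; rewrite JtE; split=> //; split=> //.
pose Q w := [/\ measurable_fun `[0, t] (H^~ w),
  (\int[mu]_(x in `[0%R, t]) ((phi x w - H x w) ^+ 2)%:E <= e1%:E)%E &
   `|Jt w - I t w| <= e1].
suff main k : (k < n.+1)%N -> whp P (4 * q1) (fun w => `|J (tau k) w - I (tau k) w| <= e).
  have q40 : 0 <= 4 * q1 by rewrite mulr_ge0// ltW.
  have := whp_and good (whp_forall_lt q40 main).
  apply: whp_mono => [|w [[mH h1 _] h2]].
    rewrite -[_ *+ n.+1]mulr_natr; have n1 : 1 <= n.+1%:R :> R by rewrite ler1n.
    have : q1 * (5 * n.+1%:R) = q by rewrite /q1 divfK// mulf_neq0.
    by move: n1 q10; move: (n.+1%:R) (q1) => x y n1 y0 <-; nra.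
  split=> //; apply: le_trans h1 _; rewrite lee_fin (le_trans e1e)//; lra.
move=> kn; have /andP[k0 kt] := tau0t k kn.
have [phik [Jk [elk goodk]]] := ito_integral_approx (HI _ k0) q10 e10.
have elpsi : elementary 0 t (fun x w => phi x w * \1_(`]0, tau k]) x - phik x w)
    (fun w => J (tau k) w - Jk w).
  apply: (elementary_widen (lexx 0) kt); apply: (elementaryB F_usual) => //.
  have h := elJ 0 (tau k) (lexx _) k0 kt.
  apply: (eq_elementary h) => // w.
  by rewrite J0 subr0.
have v0 : 0 <= 4 * e1 by rewrite mulr_ge0// ltW.
have gg := whp_and good goodk.
have psi2 : whp P (q1 + q1) (fun w => \sum_(0 <= k' < 1)
    \int[mu]_x ((phi x w * \1_(`]0%R, tau k]) x - phik x w) ^+ 2)%:E <= (4 * e1)%:E)%E.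
  apply: whpW gg => w [[mH h1 _] [_ h2 _]]; rewrite big_nat1.
  rewrite (integral_support (p := tau k)); last first.
    move=> x; apply: contraNT => xk; rewrite indicE mem_setE in_itv/= (negbTE xk).
    rewrite mulr0 sub0r oppr_eq0; apply: contraNT xk; exact: elementary_support elk.
  have mphi := measurable_elementary w el; have mphik := measurable_elementary w elk.
  apply: (@le_trans _ _ (\int[mu]_(x in `[0%R, tau k]) ((phi x w - phik x w) ^+ 2)%:E)%E).
    apply: ge0_le_integral => //.
    - by move=> x _; rewrite lee_fin sqr_ge0.
    - apply/measurable_EFinP/measurable_funTS => /=; apply: measurable_funX.
      by apply: measurable_funB => //; exact: measurable_funM.
    - apply/measurable_EFinP/measurable_funTS => /=; apply: measurable_funX.
      exact: measurable_funB.
    - move=> x /=; rewrite in_itv/= lee_fin => /andP[x0 xk].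
      rewrite indicE mem_setE in_itv/= xk andbT lt_neqAle x0 andbT.
      (* At 0 the indicator of the half-open interval vanishes, and so does [phik]. *)
      have [x0E|_] := eqVneq 0 x; last by rewrite mulr1.
      rewrite mulr0 sub0r (_ : phik x w = 0) ?oppr0 ?expr0n ?sqr_ge0//.
      by apply/eqP; apply: contraTT isT => /(elementary_support elk); rewrite -x0E ltxx.
  apply: le_trans (integral_sqr_sub_le kt mphi mphik mH) _.
  have -> : (4 * e1)%:E = (2%:E * e1%:E + 2%:E * e1%:E)%E.
    by rewrite -!EFinM -EFinD; congr EFin; ring.
  by apply: leeD; apply: lee_wpmul2l.
have hk := whp_elementary (P := P) F_usual B_brownian
  (fun k' (_ : (k' < 1)%N) => elpsi) v0 e20 psi2.
have := whp_and goodk hk.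
apply: whp_mono => [|w [[_ _ JkI]]]; first lra.
have e20' : 0 <= e / 2 by rewrite ltW// divr_gt0.
rewrite big_nat1 -[leLHS]real_normK ?num_real// ler_pXn2r ?nnegrE// => h.
rewrite -(subrK (Jk w) (J (tau k) w)) -addrA.
apply: le_trans (ler_normD _ _) _; lra.
Qed.

Section Blocks.
Variables (n : nat) (tau : nat -> R) (t : R).
Hypotheses (tau0 : tau 0%N = 0) (taun : tau n = t)
  (tau_lt : forall k, (k < n)%N -> tau k < tau k.+1).

Let tau_le i k : (i <= k)%N -> (k <= n)%N -> tau i <= tau k.
Proof.
move=> /subnK <-; elim: (k - i)%N => [//|m ih]; rewrite addSn => mn.
by rewrite (le_trans (ih (ltnW mn)))// ltW// tau_lt.
Qed.

Let indic_sub (r s x : R) : r <= s ->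
  \1_(`]r, s]) x = (x <= s)%R%:R - (x <= r)%R%:R :> R.
Proof.
move=> rs; rewrite indicE mem_setE in_itv/=.
have [xr|rx] := leP x r; first by rewrite (le_trans xr rs) subrr.
by rewrite subr0.
Qed.

Let sum_indic x :
  \sum_(0 <= k < n) \1_(`]tau k, tau k.+1]) x = \1_(`]0, t]) x :> R.
Proof.
rewrite indic_sub; last by rewrite -tau0 -taun; exact: tau_le.
rewrite -taun -[in RHS]tau0 -(telescope_sumr (fun k => (x <= tau k)%R%:R))//.
by apply: eq_big_nat => k /andP[_ kn]; rewrite indic_sub// ltW// tau_lt.
Qed.

Let indic_disjoint i j x : (i < j < n)%N ->
  \1_(`]tau i, tau i.+1]) x * \1_(`]tau j, tau j.+1]) x = 0 :> R.
Proof.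
move=> /andP[ij jn]; rewrite !indicE !mem_setE !in_itv/=.
have [xi|] := leP x (tau i.+1); last by rewrite andbF mul0r.
by rewrite [tau j < x]ltNge (le_trans xi) ?mulr0//; exact: tau_le ij (ltnW jn).
Qed.

(** On its block [psi k] is g_k f - s_k = g_k (f - h) + (g_k h - s_k), whose square is at most 2 K^2
    (f - h)^2 + 2 th^2. The blocks are disjoint, so squaring commutes with the sum over [k]. *)
Lemma integral_blocks_le (f h : R -> R) (g s : nat -> R) (K th e : R) :
  measurable_fun setT f -> measurable_fun `[0, t] h ->
  (forall k, (k < n)%N -> `|g k| <= K) -> 0 <= e ->
  (forall k, (k < n)%N -> forall x, tau k < x <= tau k.+1 -> `|g k * h x - s k| <= th) ->
  (\int[mu]_(x in `[0%R, t]) ((f x - h x) ^+ 2)%:E <= e%:E)%E ->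
  let psi k x := g k * (f x * \1_(`]tau k, tau k.+1]) x)
    - s k * \1_(`]tau k, tau k.+1]) x in
  (\sum_(0 <= k < n) \int[mu]_x (psi k x ^+ 2)%:E <=
    (2 * K ^+ 2 * e + 2 * th ^+ 2 * t)%:E)%E /\
  (\int[mu]_x ((\sum_(0 <= k < n) psi k x) ^+ 2)%:E =
   \sum_(0 <= k < n) \int[mu]_x (psi k x ^+ 2)%:E)%E.
Proof.
move=> mf mh gK e0 ghs fh psi.
have t0 : 0 <= t by rewrite -tau0 -taun; exact: tau_le.
have psiE k x : psi k x = (g k * f x - s k) * \1_(`]tau k, tau k.+1]) x.
  by rewrite /psi; ring.
have mpsi k : measurable_fun setT (psi k).
  by rewrite /psi; apply: measurable_funB; repeat apply: measurable_funM => //.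
have psi_sum : (\int[mu]_x ((\sum_(0 <= k < n) psi k x) ^+ 2)%:E =
   \sum_(0 <= k < n) \int[mu]_x (psi k x ^+ 2)%:E)%E.
  rewrite -ge0_integral_sum//; first last.
  - by move=> k x _; rewrite lee_fin sqr_ge0.
  - by move=> k; apply/measurable_EFinP; apply: measurable_funX; exact: mpsi.
  apply: eq_integral => x _; rewrite sumEFin sqr_sum_disjoint//.
  by move=> i j ij; rewrite !psiE mulrACA indic_disjoint// mulr0.
split=> //; rewrite -psi_sum.
pose G x := 2 * K ^+ 2 * (f x - h x) ^+ 2 + 2 * th ^+ 2.
have mG : measurable_fun `[0, t] G.
  apply: measurable_funD => //; apply: measurable_funM => //; apply: measurable_funX.
  by apply: measurable_funB => //; exact: measurable_funTS.
have G0 x : 0 <= G x.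
  by apply: addr_ge0; apply: mulr_ge0 => //; first apply: mulr_ge0; rewrite ?sqr_ge0.
apply: (@le_trans _ _ (\int[mu]_(x in `[0%R, t]) (G x)%:E)%E).
  rewrite integral_mkcond [leRHS]integral_mkcond.
  apply: ge0_le_integral => //.
  - by move=> x _; rewrite patchE; case: ifPn => // _; rewrite lee_fin sqr_ge0.
  - rewrite patch_setT; apply/measurable_EFinP; apply: measurable_funX.
    rewrite (_ : (fun x => _) = fun x => \sum_(k < n) psi k x); last first.
      by apply/funext => x; rewrite big_mkord.
    by apply: measurable_sum => k; exact: mpsi.
  - by apply/measurable_restrict => //; apply/measurable_EFinP; rewrite setTI.
  - move=> x _; rewrite !patchE in_setT sqr_sum_disjoint; last first.
      by move=> i j ij; rewrite !psiE mulrACA indic_disjoint// mulr0.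
    apply: (@le_trans _ _ (\sum_(0 <= k < n) G x * \1_(`]tau k, tau k.+1]) x)%:E).
      rewrite lee_fin; apply: ler_sum_nat => k /andP[_ kn].
      rewrite psiE indicE mem_setE in_itv/=; have [xk|xk] := boolP (tau k < x <= tau k.+1); last first.
        by rewrite !mulr0 expr0n.
      rewrite !mulr1; have -> : g k * f x - s k = g k * (f x - h x) + (g k * h x - s k) by ring.
      apply: le_trans (sqrD_le _ _) _; rewrite /G lerD//.
        rewrite exprMn mulrA ler_wpM2r ?sqr_ge0// ler_wpM2l//.
        by rewrite -[leLHS]real_normK ?num_real// lerXn2r ?nnegrE ?gK// (le_trans _ (gK k kn)).
      have hk := ghs k kn x xk.
      by rewrite ler_wpM2l// -[leLHS]real_normK ?num_real// lerXn2r ?nnegrE// (le_trans _ hk).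
    rewrite -mulr_sumr sum_indic mem_setE in_itv/= indicE mem_setE in_itv/=.
    case: ifPn => [/andP[x0 ->]|x0t]; rewrite lee_fin.
      by rewrite andbT; case: (0 < x); rewrite ?mulr1 ?mulr0.
    suff -> : (0 < x <= t) = false by rewrite mulr0.
    by apply: contraNF x0t => /andP[/ltW -> ->].
rewrite /G; under eq_integral do rewrite EFinD EFinM.
rewrite ge0_integralD//; first last.
- by move=> x _; rewrite lee_fin mulr_ge0 ?sqr_ge0.
- apply: emeasurable_funM => //; apply/measurable_EFinP; apply: measurable_funX.
  by apply: measurable_funB => //; exact: measurable_funTS.
- by move=> x _; apply: mule_ge0; rewrite lee_fin ?sqr_ge0// mulr_ge0 ?sqr_ge0.
rewrite ge0_integralZl//; first last.
- by rewrite lee_fin mulr_ge0 ?sqr_ge0.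
- by move=> x _; rewrite lee_fin sqr_ge0.
- apply/measurable_EFinP; apply: measurable_funX.
  by apply: measurable_funB => //; exact: measurable_funTS.
rewrite integral_cst//; have /= -> := @lebesgue_measure_itv R `[0, t].
rewrite EFinD leeD//; first by rewrite [leRHS]EFinM; apply: lee_wpmul2l => //; rewrite lee_fin mulr_ge0 ?sqr_ge0.
rewrite lte_fin; case: ifPn => [_|]; first by rewrite -EFinB subr0 -EFinM.
by move=> _; rewrite mule0 lee_fin mulr_ge0// mulr_ge0 ?sqr_ge0.
Qed.

(** [D k] is the error made in replacing g_k dI_k by s_k dB_k. Up to the approximation of [I] it is
    the integral of the block integrand [psi k]. Later g_k = 1/X(t_k), H = X sigma and s_k =
    sigma(t_k), so that [th] is small on a fine grid. *)
Lemma whp_ito_increments (H I : R -> T -> R) (g : nat -> T -> R)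
    (s : nat -> R) (K th q0 q e : R) :
  (forall p, 0 <= p -> is_ito_integral P F B H p (I p)) ->
  (forall k, (k < n)%N -> fmeas (F (tau k)) (g k)) ->
  (forall k, (k < n)%N -> forall w, `|g k w| <= K) ->
  0 < K -> 0 < q -> 0 < e ->
  whp P q0 (fun w => forall k, (k < n)%N -> forall x, tau k < x <= tau k.+1 ->
    `|g k w * H x w - s k| <= th) ->
  let D k w := g k w * (I (tau k.+1) w - I (tau k) w)
    - s k * (B (tau k.+1) w - B (tau k) w) in
  whp P (q0 + q + 4 * th ^+ 2 * t / e) (fun w =>
    \sum_(0 <= k < n) D k w ^+ 2 <= 3 * e /\ (\sum_(0 <= k < n) D k w) ^+ 2 <= 3 * e).
Proof.
move=> HI mg gK K0 qp ep gH D.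
have tau_ge0 k : (k <= n)%N -> 0 <= tau k by move=> kn; rewrite -tau0; exact: tau_le.
have tau_let k : (k <= n)%N -> tau k <= t by move=> kn; rewrite -taun; exact: tau_le.
have t0 : 0 <= t by rewrite -tau0 tau_let.
pose N := n.+1%:R : R; have N1 : 1 <= N by rewrite ler1n.
have N0 : 0 < N by exact: lt_le_trans N1.
(* The second bound keeps the Markov term 4 K^2 e1 / e below q/2; the third absorbs the errors 2 K
   e1 of the n approximated increments, both summed and squared. *)
pose e1 := Num.min 1 (Num.min (q * e / (8 * K ^+ 2)) (e / (8 * N ^+ 2 * K ^+ 2))).
have K20 : 0 < K ^+ 2 by exact: exprn_gt0.
have N20 : 0 < N ^+ 2 by exact: exprn_gt0.
have e10 : 0 < e1 by rewrite !lt_min ltr01 !divr_gt0 ?mulr_gt0.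
have e1le1 : e1 <= 1 by rewrite ge_min lexx.
have e1q : 8 * K ^+ 2 * e1 <= q * e.
  by rewrite mulrC -ler_pdivlMr ?mulr_gt0// !ge_min lexx orbT.
have e1N : 8 * N ^+ 2 * K ^+ 2 * e1 <= e.
  by rewrite mulrC -ler_pdivlMr ?mulr_gt0// !ge_min lexx !orbT.
have q20 : 0 < q / 4 by rewrite divr_gt0.
have tau0t k : (k <= n)%N -> 0 <= tau k <= t by move=> kn; rewrite tau_ge0// tau_let.
have [phi [J [el [elJ good]]]] := ito_integral_grid_approx HI tau0t q20 e10.
pose psi k x w := g k w * (phi x w * \1_(`]tau k, tau k.+1]) x)
    - s k * \1_(`]tau k, tau k.+1]) x.
pose Jpsi k w := g k w * (J (tau k.+1) w - J (tau k) w)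
    - s k * (B (tau k.+1) w - B (tau k) w).
have elpsi k : (k < n)%N -> elementary 0 t (psi k) (Jpsi k).
  move=> kn; have kk : tau k <= tau k.+1 by exact: ltW (tau_lt kn).
  apply: (elementary_widen (tau_ge0 k (ltnW kn)) (tau_let k.+1 kn)).
  apply: (elementaryB F_usual); first exact: tau_ge0 (ltnW kn).
    apply: (elementaryM F_usual); [exact: tau_ge0 (ltnW kn)|exact: mg|by exists K; exact: gK|].
    by apply: elJ => //; [exact: tau_ge0 (ltnW kn)|exact: tau_let].
  have ms : fmeas (F (tau k)) (cst (s k) : T -> R).
    by apply/(fmeasFP F_usual) => //; exact: tau_ge0 (ltnW kn).
  apply: (Elementary1 B (lexx _) kk (lexx _) ms).
  by exists `|s k|.
(* The sum of all blocks is an additional integrand with index [n]: one application of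
   [whp_elementary] then bounds the sum of the squares and the square of the sum. *)
pose Phi k := if (k < n)%N then psi k else fun x w => \sum_(0 <= i < n) psi i x w.
pose JPhi k := if (k < n)%N then Jpsi k else fun w => \sum_(0 <= i < n) Jpsi i w.
have elPhi k : (k < n.+1)%N -> elementary 0 t (Phi k) (JPhi k).
  by rewrite /Phi /JPhi; case: ifPn => [kn _|_ _]; [exact: elpsi|exact: elementary_sum].
(* The outer factor 2: the blocks together and their sum have the same integral of squares. *)
pose V := 2 * (2 * K ^+ 2 * e1 + 2 * th ^+ 2 * t).
have V0 : 0 <= V.
  have h1 : 0 <= 2 * K ^+ 2 * e1 by rewrite !mulr_ge0// ltW.
  have h2 : 0 <= 2 * th ^+ 2 * t by rewrite mulr_ge0// mulr_ge0 ?sqr_ge0.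
  by rewrite /V mulr_ge0// addr_ge0.
have gg := whp_and gH good.
have PhiV : whp P (q0 + q / 4) (fun w =>
    \sum_(0 <= k < n.+1) \int[mu]_x (Phi k x w ^+ 2)%:E <= V%:E)%E.
  apply: whpW gg => w [gHw [mH h1 _]].
  have mphi := measurable_elementary w el.
  have [b1 b2] := integral_blocks_le mphi mH (fun k kn => gK k kn w) (ltW e10) gHw h1.
  rewrite big_nat_recr//= /Phi ltnn b2.
  rewrite (eq_big_nat _ _ (F2 := fun k => (\int[mu]_x (psi k x w ^+ 2)%:E)%E)); last first.
    by move=> k /andP[_ ->].
  rewrite /V mulrDl mul1r EFinD; exact: leeD.
have := whp_and good (whp_elementary F_usual B_brownian elPhi V0 ep PhiV).
apply: whp_mono => [|w [[_ _ JI] Je]].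
  have VE : V / e = 4 * K ^+ 2 * e1 / e + 4 * th ^+ 2 * t / e.
    by rewrite /V; field; rewrite lt0r_neq0.
  have : 4 * K ^+ 2 * e1 / e <= q / 2 by rewrite ler_pdivrMr//; lra.
  by rewrite VE; lra.
have DJ k : (k < n)%N -> `|D k w - Jpsi k w| <= 2 * K * e1.
  move=> kn.
  have -> : D k w - Jpsi k w =
    g k w * (- (J (tau k.+1) w - I (tau k.+1) w) + (J (tau k) w - I (tau k) w)).
    by rewrite /D /Jpsi; ring.
  rewrite normrM (_ : 2 * K * e1 = K * (2 * e1)); last by ring.
  apply: ler_pM => //; first exact: gK.
  apply: le_trans (ler_normD _ _) _; rewrite normrN mulr_natl mulr2n.
  by apply: lerD; apply: JI => //; exact: ltnW.
have nN : n%:R <= N :> R by rewrite ler_nat.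
have n0 : 0 <= n%:R :> R by [].
have e1e1 : e1 * e1 <= e1 by rewrite ler_piMr// ltW.
move: Je; rewrite big_nat_recr//= {2}/JPhi ltnn.
rewrite (eq_big_nat _ _ (F2 := fun k => Jpsi k w ^+ 2)); last first.
  by move=> k /andP[_ kn]; rewrite /JPhi kn.
move=> Je.
have A0 : 0 <= \sum_(0 <= k < n) Jpsi k w ^+ 2 by apply: sumr_ge0 => k _; exact: sqr_ge0.
have B0 := sqr_ge0 (\sum_(0 <= k < n) Jpsi k w).
have Ke0 : 0 <= K ^+ 2 * (e1 * e1).
  by apply: mulr_ge0; [exact: ltW|apply: mulr_ge0; exact: ltW].
have nn0 : 0 <= n%:R * n%:R :> R by rewrite mulr_ge0.
have Ke : n%:R * n%:R * (K ^+ 2 * (e1 * e1)) <= N ^+ 2 * (K ^+ 2 * e1).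
  rewrite [N ^+ 2]expr2; apply: ler_pM => //.
  - exact: ler_pM.
  - by rewrite ler_wpM2l// ltW.
have nn : n%:R <= n%:R * n%:R :> R by rewrite -natrM ler_nat; case: (n) => // m; rewrite leq_pmulr.
split.
- have : \sum_(0 <= k < n) D k w ^+ 2 <=
     \sum_(0 <= k < n) (2 * Jpsi k w ^+ 2 + 2 * (2 * K * e1) ^+ 2).
    apply: ler_sum_nat => k /andP[_ kn].
    rewrite -[in leLHS](subrK (Jpsi k w) (D k w)) addrC.
    apply: le_trans (sqrD_le _ _) _; rewrite lerD// ler_wpM2l//.
    rewrite -[leLHS]real_normK ?num_real// lerXn2r ?nnegrE ?DJ//.
    by rewrite !mulr_ge0// ltW.
  move=> /le_trans; apply; rewrite big_split/= -mulr_sumr sumr_const_nat subn0.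
  rewrite -[X in _ + X]mulr_natr.
  have : K ^+ 2 * (e1 * e1) * n%:R <= K ^+ 2 * (e1 * e1) * (n%:R * n%:R).
    by rewrite ler_wpM2l.
  have -> : 2 * (2 * K * e1) ^+ 2 * n%:R = 8 * (K ^+ 2 * (e1 * e1) * n%:R) by ring.
  by lra.
- have -> : \sum_(0 <= k < n) D k w = \sum_(0 <= k < n) Jpsi k w +
      \sum_(0 <= k < n) (D k w - Jpsi k w).
    by rewrite -big_split/=; apply: eq_bigr => k _; rewrite addrC subrK.
  apply: le_trans (sqrD_le _ _) _.
  have : `|\sum_(0 <= k < n) (D k w - Jpsi k w)| <= 2 * K * e1 * n%:R.
    apply: le_trans (ler_norm_sum _ _ _) _.
    apply: (@le_trans _ _ (\sum_(0 <= k < n) 2 * K * e1)).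
      by apply: ler_sum_nat => k /andP[_ kn]; exact: DJ.
    by rewrite sumr_const_nat subn0 mulr_natr.
  have K2e0 : 0 <= 2 * K * e1 * n%:R by rewrite !mulr_ge0// ltW.
  rewrite -(ler_pXn2r (ltn0Sn 1)) ?nnegrE// real_normK ?num_real//.
  have -> : (2 * K * e1 * n%:R) ^+ 2 = 4 * (n%:R * n%:R * (K ^+ 2 * (e1 * e1))) by ring.
  by lra.
Qed.

End Blocks.

End ItoApproximation.

(** * Ito's formula for the logarithm *)

(** Mean value theorem: the derivative of ln (1 + y) - y + y^2/2 is y^2 / (1 + y), at most 2 x^2 for
    |y| <= |x| <= 1/2. *)
Lemma ln1D_taylor2 (R : realType) (x : R) : `|x| <= 1 / 2 ->
  `|ln (1 + x) - x + x ^+ 2 / 2| <= 2 * `|x| ^+ 3.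
Proof.
move=> x2; pose f (y : R) := ln (1 + y) - y + y ^+ 2 / 2.
pose df (y : R) := (1 + y)^-1 - 1 + y.
have fd (y : R) : `|y| <= 1 / 2 -> is_derive y 1 f (df y).
  move=> y2; have y0 : 0 < 1 + y by move: y2; rewrite ler_norml => /andP[]; lra.
  have d1 := is_derive1_ln y0.
  rewrite /f /df; apply: is_derive_eq.
  have yN0 := lt0r_neq0 y0.
  by rewrite scaler0 add0r /GRing.scale/=; field.
have fc (a b : R) : `|a| <= 1 / 2 -> `|b| <= 1 / 2 -> {within `[a, b], continuous f}.
  move=> ha hb; apply: derivable_within_continuous => y; rewrite in_itv/= => /andP[ay yb].
  apply: ex_derive; apply: fd; move: ha hb; rewrite !ler_norml.
  by move=> /andP[? ?] /andP[? ?]; apply/andP; split; lra.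
have f0 : f 0 = 0 by rewrite /f addr0 ln1 subrr expr0n/= mul0r addr0.
have n0 : `|0 : R| <= 1 / 2 by rewrite normr0.
have dfle (c : R) : `|c| <= `|x| -> `|df c * x| <= 2 * `|x| ^+ 3.
  move=> cx; have c2 := le_trans cx x2.
  have c0 : 1 / 2 <= 1 + c by move: c2; rewrite ler_norml => /andP[]; lra.
  have cp : 0 < 1 + c by lra.
  have -> : df c = c ^+ 2 / (1 + c) by rewrite /df; field; exact: lt0r_neq0.
  rewrite normrM (_ : 2 * `|x| ^+ 3 = 2 * `|x| ^+ 2 * `|x|); last by ring.
  rewrite ler_wpM2r// normrM normfV (gtr0_norm cp) ler_pdivrMr// normrX.
  have : `|c| ^+ 2 <= `|x| ^+ 2 by rewrite lerXn2r ?nnegrE.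
  have := sqr_ge0 `|x|; nra.
have -> : ln (1 + x) - x + x ^+ 2 / 2 = f x by [].
have [x0|x0] := leP 0 x.
- have fd' y : y \in `]0, x[ -> is_derive y 1 f (df y).
    rewrite in_itv/= => /andP[y0 yx]; apply: fd.
    by move: x2; rewrite !ler_norml => /andP[? ?]; apply/andP; split; lra.
  have [c cx] := MVT_segment x0 fd' (fc _ _ n0 x2).
  rewrite f0 !subr0 => ->; apply: dfle; move: cx; rewrite in_itv/= => /andP[c0 cx].
  by rewrite !ger0_norm.
- have fd' y : y \in `]x, 0[ -> is_derive y 1 f (df y).
    rewrite in_itv/= => /andP[y0 yx]; apply: fd.
    by move: x2; rewrite !ler_norml => /andP[? ?]; apply/andP; split; lra.
  have [c cx] := MVT_segment (ltW x0) fd' (fc _ _ x2 n0).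
  rewrite f0 sub0r mulrDr mulr0 add0r mulrN => /oppr_inj ->; apply: dfle.
  move: cx; rewrite in_itv/= => /andP[cx c0].
  by rewrite !ler0_norm ?lerN2// ltW.
Qed.

(** Here rho is a relative increment of the solution, al its drift part, be the integrated drift
    rate, y the noise sigma dB and D the error of [whp_ito_increments]. The Taylor remainder is
    cubic, hence at most 2 om rho^2. With e = al + D, the difference rho^2 - y^2 = e^2 + 2 e y is
    split by Young's inequality with parameter ka, because the sum of the y^2 is not small. *)
Lemma ito_sum_estimate (R : realType) (n : nat) (rho al be D y : nat -> R)
    (Q om A1 A2 et ka : R) :
  (forall k, (k < n)%N -> rho k = al k + D k + y k) ->
  (forall k, (k < n)%N -> `|rho k| <= om) -> 0 <= om -> om <= 1 / 2 ->
  `|\sum_(0 <= k < n) (al k - be k)| <= A1 ->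
  \sum_(0 <= k < n) al k ^+ 2 <= A2 ->
  `|\sum_(0 <= k < n) D k| <= et ->
  \sum_(0 <= k < n) D k ^+ 2 <= et ->
  `|\sum_(0 <= k < n) y k ^+ 2 - Q| <= et -> 0 < ka ->
  `|\sum_(0 <= k < n) (ln (1 + rho k) - be k - y k) + Q / 2| <=
    2 * om * (2 * (2 * A2 + 2 * et) + 2 * (Q + et)) + A1 + et +
    ((1 + ka^-1) * (2 * A2 + 2 * et) + ka * (Q + et)) + et.
Proof.
move=> rhoE rho_le om0 om2 A1le A2le Dle D2le yQ ka0.
pose e k := al k + D k; pose E := \sum_(0 <= k < n) e k ^+ 2.
pose Y := \sum_(0 <= k < n) y k ^+ 2.
have E0 : 0 <= E by apply: sumr_ge0 => k _; exact: sqr_ge0.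
have Y0 : 0 <= Y by apply: sumr_ge0 => k _; exact: sqr_ge0.
have El : E <= 2 * A2 + 2 * et.
  apply: (@le_trans _ _ (\sum_(0 <= k < n) (2 * al k ^+ 2 + 2 * D k ^+ 2))).
    by apply: ler_sum_nat => k _; exact: sqrD_le.
  by rewrite big_split/= -!mulr_sumr lerD// ler_wpM2l.
have Yl : Y <= Q + et by move: yQ; rewrite -/Y ler_norml => /andP[]; lra.
have S1 : `|\sum_(0 <= k < n) (ln (1 + rho k) - rho k + rho k ^+ 2 / 2)| <=
    2 * om * (2 * E + 2 * Y).
  apply: le_trans (ler_norm_sum _ _ _) _.
  apply: (@le_trans _ _ (\sum_(0 <= k < n) 2 * om * (2 * e k ^+ 2 + 2 * y k ^+ 2))); last first.
    by rewrite -mulr_sumr big_split/= -!mulr_sumr.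
  apply: ler_sum_nat => k /andP[_ kn]; have rk := rho_le k kn.
  apply: le_trans (ln1D_taylor2 (le_trans rk om2)) _.
  rewrite -mulrA ler_wpM2l// exprS; apply: ler_pM => //.
  by rewrite real_normK ?num_real// rhoE//; exact: sqrD_le.
have S2 : `|\sum_(0 <= k < n) (rho k ^+ 2 - y k ^+ 2)| <= (1 + ka^-1) * E + ka * Y.
  apply: le_trans (ler_norm_sum _ _ _) _.
  apply: (@le_trans _ _ (\sum_(0 <= k < n) ((1 + ka^-1) * e k ^+ 2 + ka * y k ^+ 2))); last first.
    by rewrite big_split/= -!mulr_sumr.
  apply: ler_sum_nat => k /andP[_ kn]; rewrite rhoE// -/(e k).
  have k1 : ka^-1 * ka = 1 by rewrite mulVf// lt0r_neq0.
  have ki0 : 0 < ka^-1 by rewrite invr_gt0.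
  have h1 : 0 <= ka^-1 * (e k - ka * y k) ^+ 2 by rewrite mulr_ge0 ?sqr_ge0// ltW.
  have h2 : 0 <= ka^-1 * (e k + ka * y k) ^+ 2 by rewrite mulr_ge0 ?sqr_ge0// ltW.
  have h3 : 0 <= e k ^+ 2 by exact: sqr_ge0.
  have e1 : ka^-1 * (e k - ka * y k) ^+ 2 = ka^-1 * e k ^+ 2 - 2 * e k * y k + ka * y k ^+ 2.
    by field; rewrite lt0r_neq0.
  have e2 : ka^-1 * (e k + ka * y k) ^+ 2 = ka^-1 * e k ^+ 2 + 2 * e k * y k + ka * y k ^+ 2.
    by field; rewrite lt0r_neq0.
  rewrite e1 in h1; rewrite e2 in h2.
  have -> : (e k + y k) ^+ 2 - y k ^+ 2 = e k ^+ 2 + 2 * e k * y k by ring.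
  have -> : (1 + ka^-1) * e k ^+ 2 = e k ^+ 2 + ka^-1 * e k ^+ 2 by ring.
  by rewrite ler_norml; apply/andP; split; lra.
have -> : \sum_(0 <= k < n) (ln (1 + rho k) - be k - y k) + Q / 2 =
  \sum_(0 <= k < n) (ln (1 + rho k) - rho k + rho k ^+ 2 / 2) +
  \sum_(0 <= k < n) (al k - be k) + \sum_(0 <= k < n) D k
  - (\sum_(0 <= k < n) (rho k ^+ 2 - y k ^+ 2)) / 2 - (Y - Q) / 2.
  have -> : \sum_(0 <= k < n) (ln (1 + rho k) - be k - y k) =
    \sum_(0 <= k < n) ((ln (1 + rho k) - rho k + rho k ^+ 2 / 2) + (al k - be k) + D k
      + (- 1 / 2) * (rho k ^+ 2 - y k ^+ 2) + (- 1 / 2) * y k ^+ 2).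
    by apply: eq_big_nat => k /andP[_ kn]; move: (rhoE k kn) (ln _) => -> l; field.
  by rewrite !big_split/= -!mulr_sumr !big_split/= -/Y; field.
have b1 : 2 * om * (2 * E + 2 * Y) <=
    2 * om * (2 * (2 * A2 + 2 * et) + 2 * (Q + et)).
  by rewrite ler_wpM2l ?mulr_ge0//; lra.
have ki0 : 0 < 1 + ka^-1 by rewrite addr_gt0 ?invr_gt0.
have b2 : (1 + ka^-1) * E <= (1 + ka^-1) * (2 * A2 + 2 * et) by rewrite ler_wpM2l// ltW.
have b3 : ka * Y <= ka * (Q + et) by rewrite ler_wpM2l// ltW.
have b4 : 0 <= (1 + ka^-1) * E by rewrite mulr_ge0// ltW.
have b5 : 0 <= ka * Y by rewrite mulr_ge0// ltW.
move: S1 S2 A1le Dle yQ; rewrite -/Y !ler_norml.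
move=> /andP[? ?] /andP[? ?] /andP[? ?] /andP[? ?] /andP[? ?].
by apply/andP; split; lra.
Qed.

(** * Continuous functions on segments and uniform grids *)

Section ContinuousFunctions.
Context (R : realType).
Local Notation mu := (@lebesgue_measure R).
Implicit Types (f : R -> R) (a b c t : R).

(** Coefficients and paths are continuous only for nonnegative times; frozen at their value at 0 on
    the left, they become continuous on the whole line and need no side conditions in integrals. *)
Lemma continuous_extend0 f : {within `[0, +oo[, continuous f} ->
  continuous (fun s : R => f (Num.max 0 s)).
Proof.
move=> /subspace_continuousP fc s; have m0 (u : R) : 0 <= Num.max 0 u by rewrite le_max lexx.
have ms : [set` `[0, +oo[] (Num.max 0 s) by rewrite /= in_itv/= m0.
apply/cvgrPdist_lt => e e0.
have /cvgrPdist_lt/(_ e e0) := fc _ ms.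
move=> /nbhs_ballP[r /= r0 xr]; apply/nbhs_ballP; exists r => // x sx /=.
apply: xr; last by rewrite /= in_itv/= m0.
move: sx; rewrite /ball/=; apply: le_lt_trans.
have [s0|s0] := leP 0 s; have [x0|x0] := leP 0 x => //; rewrite ler_norml;
  have := ler_norm (s - x); have := ler_norm (x - s); rewrite (distrC x s) => ? ?;
  by apply/andP; split; lra.
Qed.

Lemma continuous_integrable f a b : continuous f -> mu.-integrable `[a, b] (EFin \o f).
Proof.
move=> fc; apply: continuous_compact_integrable; first exact: segment_compact.
exact: continuous_subspaceT.
Qed.

Lemma Rintegral_chasles f a b c : continuous f -> a <= b -> b <= c ->
  \int[mu]_(x in `[a, c]) f x = \int[mu]_(x in `[a, b]) f x + \int[mu]_(x in `[b, c]) f x.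
Proof.
move=> fc ab bc; have i := continuous_integrable a c fc.
have := @Rintegral_itvB R f (BLeft a) (BRight c) b i; rewrite !bnd_simp => /(_ ab bc).
rewrite Rintegral_itv_obnd_cbnd; last first.
  apply: integrableS (continuous_integrable b c fc) => //.
  by apply: subset_itvr; rewrite bnd_simp.
by move=> <-; rewrite addrC subrK.
Qed.

Lemma Rintegral_norm_le f a b M : continuous f -> a <= b ->
  (forall x, a <= x <= b -> `|f x| <= M) ->
  `|\int[mu]_(x in `[a, b]) f x| <= M * (b - a).
Proof.
move=> fc ab fM; have i := continuous_integrable a b fc.
apply: le_trans (le_normr_Rintegral _ i) _ => //.
have cM : \int[mu]_(x in `[a, b]) M = M * (b - a).
  rewrite Rintegral_cst//; have /= -> := @lebesgue_measure_itv R `[a, b].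
  rewrite lte_fin; case: ltP => [_|ba]; first by rewrite -EFinB.
  by rewrite (le_anti (introT andP (conj ab ba))) subrr.
rewrite -cM; apply: le_Rintegral => //.
- apply: (continuous_integrable (f := fun x => `|f x|)) => x.
  by apply: cvg_norm; exact: fc.
- by apply: (continuous_integrable (f := cst M)) => x; exact: cvg_cst.
Qed.

(** Heine's theorem by compactness of the segment; only one of the two points has to lie in it. *)
Lemma continuous_segment_uniform f a b e : continuous f -> 0 < e ->
  exists2 de, 0 < de & forall x y, a <= x <= b -> `|x - y| < de -> `|f x - f y| <= e.
Proof.
move=> fc e0; have /compact_near_coveringP cK := @segment_compact R a b.
have := cK _ (0^'+) (fun de x => forall y, `|x - y| < de -> `|f x - f y| <= e) _.
case.
  move=> x _; have /cvgrPdist_lt/(_ (e / 2) (divr_gt0 e0 (ltr0Sn _ 1))) := fc x.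
  move=> /nbhs_ballP[r /= r0 xr].
  have r20 : 0 < r / 2 by rewrite divr_gt0.
  exists (ball x (r / 2), [set de : R | 0 < de < r / 2]) => /=.
    split; first exact: nbhsx_ballx.
    near=> de; apply/andP; split; near: de; first exact: nbhs_right_gt.
    exact: nbhs_right_lt.
  move=> [u de] /= [xu /andP[_ dr]] y uy.
  have h1 : `|f x - f u| < e / 2 by apply: xr; move: xu; rewrite /ball/=; lra.
  have h2 : `|f x - f y| < e / 2.
    apply: xr; rewrite /ball/= -(subrK u x) -addrA.
    by apply: le_lt_trans (ler_normD _ _) _; move: xu; rewrite /ball/=; lra.
  rewrite -(subrK (f x) (f u)) -addrA; apply: le_trans (ler_normD _ _) _.
  by rewrite distrC; lra.
move=> r /= r0 H; have r20 : 0 < r / 2 by rewrite divr_gt0.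
exists (r / 2) => // x y xab xy.
by apply: (H (r / 2)) => //=; rewrite sub0r normrN gtr0_norm//; lra.
Unshelve. all: by end_near. Qed.

Lemma grid_approx t s de : 0 < t -> 0 <= s <= t -> 0 < de ->
  exists M, forall m, (M <= m)%N ->
    exists2 j, (j <= m.+1)%N & `|s - t * j%:R / m.+1%:R| < de.
Proof.
move=> t0 /andP[s0 st] de0; exists (Num.truncn (t / de)) => m Mm.
have m0 : 0 < m.+1%:R :> R by [].
have x0 : 0 <= s * m.+1%:R / t by rewrite divr_ge0 ?mulr_ge0// ltW.
have /andP[j1 j2] := truncn_itv x0; set j := Num.truncn _ in j1 j2.
exists j.
  rewrite -(ler_nat R); apply: le_trans j1 _; rewrite ler_pdivrMr//.
  by rewrite mulrC ler_wpM2l.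
have tm : t < de * m.+1%:R.
  rewrite mulrC -ltr_pdivrMr//; apply: lt_le_trans (truncnS_gt _) _.
  by rewrite ler_nat.
have h1 : t * j%:R <= s * m.+1%:R by rewrite mulrC -ler_pdivlMr.
have h2 : s * m.+1%:R < t * j%:R + t.
  have jE : j.+1%:R = j%:R + 1 :> R by rewrite natr1.
  by move: j2; rewrite ltr_pdivrMr// jE; lra.
have -> : s - t * j%:R / m.+1%:R = (s * m.+1%:R - t * j%:R) / m.+1%:R.
  by rewrite mulrBl mulfK// lt0r_neq0.
by rewrite ger0_norm ?divr_ge0 ?subr_ge0// ltr_pdivrMr//; lra.
Qed.

End ContinuousFunctions.

Definition grid_point (R : realType) (t : R) (n k : nat) : R := t * k%:R / n%:R.

(** * Ito's formula for the logarithm along one fixed path *)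

Section ItoPathwise.
Context (R : realType).
Local Notation mu := (@lebesgue_measure R).
Variables (x r a sg : R -> R) (t : R) (n : nat).
Hypotheses (xc : continuous x) (rc : continuous r) (ac : continuous a)
  (sc : continuous sg) (t0 : 0 < t) (n0 : (0 < n)%N).
Local Notation tau := (grid_point t n).

Let nR0 : 0 < n%:R :> R. Proof. by rewrite ltr0n. Qed.

Lemma grid_point0 : tau 0 = 0. Proof. by rewrite /grid_point mulr0 mul0r. Qed.

Lemma grid_pointn : tau n = t. Proof. by rewrite /grid_point mulfK// lt0r_neq0. Qed.

Lemma grid_step k : tau k.+1 - tau k = t / n%:R.
Proof. by rewrite /grid_point -natr1; field; rewrite lt0r_neq0. Qed.

Lemma grid_lt k : tau k < tau k.+1.
Proof. by rewrite -subr_gt0 grid_step divr_gt0. Qed.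

Lemma grid_le i k : (i <= k)%N -> tau i <= tau k.
Proof. by move=> ik; rewrite /grid_point ler_wpM2r ?invr_ge0 ?ler_wpM2l ?ler_nat// ltW. Qed.

Lemma sum_Rintegral_grid (f : R -> R) : continuous f ->
  \sum_(0 <= k < n) \int[mu]_(u in `[tau k, tau k.+1]) f u =
  \int[mu]_(u in `[0, t]) f u.
Proof.
move=> fc; suff H m : \sum_(0 <= k < m) \int[mu]_(u in `[tau k, tau k.+1]) f u =
    \int[mu]_(u in `[0, tau m]) f u by rewrite H grid_pointn.
elim: m => [|m ih]; first by rewrite big_geq// grid_point0 set_itv1 Rintegral_set1.
rewrite big_nat_recr//= ih [RHS](@Rintegral_chasles _ _ _ (tau m))//.
- by rewrite -[leLHS]grid_point0 grid_le.
- exact/ltW/grid_lt.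
Qed.

Variables (K M th eta ka : R) (dI dB : nat -> R).
Hypotheses (K1 : 1 <= K) (xK : forall s, 0 <= s <= t -> K^-1 <= x s <= K)
  (rM : forall s, 0 <= s <= t -> `|r s| <= M)
  (aM : forall s, 0 <= s <= t -> `|a s| <= M)
  (xth : forall k, (k < n)%N -> forall s, tau k <= s <= tau k.+1 -> `|x s - x (tau k)| <= th)
  (th2 : K * th <= 1 / 2)
  (xE : forall k, (k < n)%N -> x (tau k.+1) - x (tau k) =
    \int[mu]_(u in `[tau k, tau k.+1]) (x u * (r u - a u * x u)) + dI k).
Let D k := (x (tau k))^-1 * dI k - sg (tau k) * dB k.
Hypotheses (D1 : `|\sum_(0 <= k < n) D k| <= eta)
  (D2 : \sum_(0 <= k < n) D k ^+ 2 <= eta)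
  (QV : `|\sum_(0 <= k < n) (sg (tau k) * dB k) ^+ 2
    - \int[mu]_(u in `[0, t]) (sg u ^+ 2)| <= eta)
  (ka0 : 0 < ka).

(** No probability is left: the path satisfies the grid bounds and [ito_sum_estimate] is applied.
    With C = M (1 + K) bounding |r - a x|, A1 comes from |x u / x(t_k) - 1| <= K th = om under the
    drift integral, and A2 from n drift parts of size at most K^2 C t / n. *)
Lemma ito_pathwise :
  let Q := \int[mu]_(u in `[0, t]) (sg u ^+ 2) in
  let om := K * th in
  let A1 := t * (M * (1 + K)) * om in
  let A2 := (K ^+ 2 * (M * (1 + K)) * t) ^+ 2 / n%:R in
  (`|ln (x t) - ln (x 0) - \int[mu]_(u in `[0, t]) (r u - 2^-1 * sg u ^+ 2 - a u * x u)
    - \sum_(0 <= k < n) sg (tau k) * dB k| <=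
    2 * om * (2 * (2 * A2 + 2 * eta) + 2 * (Q + eta)) + A1 + eta +
    ((1 + ka^-1) * (2 * A2 + 2 * eta) + ka * (Q + eta)) + eta : Prop).
Proof.
move=> Q om A1 A2.
have K0 : 0 < K by exact: lt_le_trans K1.
have tau0t k : (k <= n)%N -> 0 <= tau k <= t.
  move=> kn; apply/andP; split; first by rewrite -[leLHS]grid_point0 grid_le.
  by rewrite -[leRHS]grid_pointn grid_le.
have in0t k s : (k < n)%N -> tau k <= s <= tau k.+1 -> 0 <= s <= t.
  move=> kn /andP[ks sk]; have /andP[h1 _] := tau0t k (ltnW kn).
  by have /andP[_ h2] := tau0t k.+1 kn; rewrite (le_trans h1)//= (le_trans sk).
have xp s : 0 <= s <= t -> 0 < x s.
  by move=> /xK/andP[h _]; apply: lt_le_trans h; rewrite invr_gt0.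
have xinv s : 0 <= s <= t -> (x s)^-1 <= K.
  move=> st; rewrite -[leRHS]invrK lef_pV2 ?posrE ?invr_gt0 ?xp//.
  by have /andP[] := xK st.
pose f u := r u - a u * x u; pose C := M * (1 + K).
have fc : continuous f by move=> u; apply: cvgB; [exact: rc|apply: cvgM; [exact: ac|exact: xc]].
have xfc : continuous (fun u => x u * f u) by move=> u; apply: cvgM; [exact: xc|exact: fc].
have s2c : continuous (fun u => sg u ^+ 2) by move=> u; apply: cvgM; exact: sc.
have t00 : (0 : R) <= 0 <= t by rewrite lexx ltW.
have M0 : 0 <= M by apply: le_trans (rM t00).
have C0 : 0 <= C by rewrite mulr_ge0// addr_ge0// ltW.
have fC s : 0 <= s <= t -> `|f s| <= C.
  move=> st; rewrite /f /C mulrDr mulr1; apply: le_trans (ler_normB _ _) _.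
  rewrite lerD ?rM// normrM ler_pM ?aM// gtr0_norm ?xp//.
  by have /andP[] := xK st.
pose rho k := (x (tau k.+1) - x (tau k)) / x (tau k).
pose al k := (x (tau k))^-1 * \int[mu]_(u in `[tau k, tau k.+1]) (x u * f u).
pose be k := \int[mu]_(u in `[tau k, tau k.+1]) f u.
have th0 : 0 <= th.
  by apply: le_trans (xth n0 (_ : tau 0 <= tau 0 <= tau 1)); rewrite // !lexx /= ltW// grid_lt.
have om0 : 0 <= om by rewrite mulr_ge0// ltW.
have := @ito_sum_estimate R n rho al be D (fun k => sg (tau k) * dB k) Q om A1 A2 eta ka.
have sumE : \sum_(0 <= k < n) (ln (1 + rho k) - be k - sg (tau k) * dB k) + Q / 2 =
  ln (x t) - ln (x 0) - \int[mu]_(u in `[0, t]) (r u - 2^-1 * sg u ^+ 2 - a u * x u)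
    - \sum_(0 <= k < n) sg (tau k) * dB k.
  rewrite !sumrB /be sum_Rintegral_grid//.
  have -> : \sum_(0 <= k < n) ln (1 + rho k) = ln (x t) - ln (x 0).
    transitivity (\sum_(0 <= k < n) (ln (x (tau k.+1)) - ln (x (tau k)))); last first.
      by rewrite (telescope_sumr (fun k => ln (x (tau k))))// grid_pointn grid_point0.
    apply: eq_big_nat => k /andP[_ kn].
    have h1 := xp _ (tau0t k (ltnW kn)); have h2 := xp _ (tau0t k.+1 kn).
    rewrite -ln_div ?posrE//; congr ln; rewrite /rho; field; exact: lt0r_neq0.
  have -> : \int[mu]_(u in `[0, t]) (r u - 2^-1 * sg u ^+ 2 - a u * x u) =
    \int[mu]_(u in `[0, t]) f u - 2^-1 * Q.
    rewrite /Q -RintegralZl//; last exact: continuous_integrable.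
    rewrite -RintegralB//; first by apply: eq_Rintegral => u _; rewrite /f; ring.
      exact: continuous_integrable.
    apply: (@continuous_integrable _ (fun u => 2^-1 * sg u ^+ 2)) => u.
    by apply: cvgM; [exact: cvg_cst|exact: s2c].
  by field.
rewrite sumE; apply => //.
- move=> k kn; rewrite /rho xE// -/(f _) /al /D; move: (\int[mu]_(_ in _) _) => J; ring.
- move=> k kn; have kt := tau0t k (ltnW kn).
  rewrite /rho normrM mulrC; apply: ler_pM => //.
    by rewrite normfV gtr0_norm ?xp// xinv.
  by apply: xth => //; rewrite lexx ltW// grid_lt.
- apply: le_trans (ler_norm_sum _ _ _) _.
  apply: (@le_trans _ _ (\sum_(0 <= k < n) om * C * (t / n%:R))); last first.
    rewrite sumr_const_nat subn0 -mulr_natr /A1 le_eqVlt; apply/orP; left; apply/eqP.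
    by rewrite -/C; field; exact: lt0r_neq0.
  apply: ler_sum_nat => k /andP[_ kn]; have kt := tau0t k (ltnW kn).
  have xk := xp _ kt.
  have -> : al k - be k = \int[mu]_(u in `[tau k, tau k.+1]) ((x (tau k))^-1 * (x u * f u) - f u).
    rewrite RintegralB//; last exact: continuous_integrable.
      by rewrite RintegralZl//; exact: continuous_integrable.
    apply: (@continuous_integrable _ (fun u => (x (tau k))^-1 * (x u * f u))) => u.
    by apply: cvgM; [exact: cvg_cst|exact: xfc].
  rewrite -(grid_step k); apply: Rintegral_norm_le.
  + move=> u; apply: cvgB; last exact: fc.
    by apply: cvgM; [exact: cvg_cst|exact: xfc].
  + exact/ltW/grid_lt.
  + move=> u uk; have ut := in0t k u kn uk.
    have -> : (x (tau k))^-1 * (x u * f u) - f u = (x (tau k))^-1 * (x u - x (tau k)) * f u.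
      by field; exact: lt0r_neq0.
    rewrite normrM; apply: ler_pM => //; last exact: fC.
    rewrite normrM; apply: ler_pM => //; last exact: xth.
    by rewrite normfV gtr0_norm// xinv.
- apply: (@le_trans _ _ (\sum_(0 <= k < n) (K ^+ 2 * C * (t / n%:R)) ^+ 2)); last first.
    rewrite sumr_const_nat subn0 -mulr_natr /A2 le_eqVlt; apply/orP; left; apply/eqP.
    by rewrite -/C; field; exact: lt0r_neq0.
  apply: ler_sum_nat => k /andP[_ kn]; have kt := tau0t k (ltnW kn).
  rewrite -[leLHS]real_normK ?num_real// lerXn2r ?nnegrE//.
    by rewrite mulr_ge0 ?divr_ge0 ?(ltW t0)// mulr_ge0 ?sqr_ge0.
  have -> : K ^+ 2 * C * (t / n%:R) = K * (K * C * (t / n%:R)) by ring.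
  rewrite /al normrM; apply: ler_pM => //.
    by rewrite normfV gtr0_norm ?xp// xinv.
  rewrite -(grid_step k); apply: Rintegral_norm_le => //; first exact/ltW/grid_lt.
  move=> u uk; have ut := in0t k u kn uk.
  rewrite normrM; apply: ler_pM => //; last exact: fC.
  by rewrite gtr0_norm ?xp//; have /andP[] := xK ut.
Qed.

End ItoPathwise.

(** * Uniform bounds and moduli of continuity of the paths *)

Section PathRegularity.
Context (R : realType) (d : measure_display) (T : measurableType d)
  (P : probability T R).
Variables (X : R -> T -> R) (t : R).
Hypotheses (mX : forall s, 0 <= s -> measurable_fun setT (X s))
  (cX : continuous_paths P X) (t0 : 0 < t).

Let tau m j : R := t * j%:R / m.+1%:R.

Let tau0t m j : (j <= m.+1)%N -> 0 <= tau m j <= t.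
Proof.
move=> jm; apply/andP; split; first by rewrite divr_ge0// mulr_ge0// ltW.
by rewrite ler_pdivrMr// ler_wpM2l ?ler_nat// ltW.
Qed.

Lemma measurable_forall (Q : nat -> T -> Prop) :
  (forall n, measurable [set w | Q n w]) -> measurable [set w | forall n, Q n w].
Proof.
move=> mQ; rewrite (_ : [set w | _] = \bigcap_n [set w | Q n w]).
  exact: bigcapT_measurable.
by apply/seteqP; split=> w /= Qw n; [move=> _; exact: Qw|exact: Qw].
Qed.

Lemma measurable_imply (b : Prop) (Q : T -> Prop) :
  (b -> measurable [set w | Q w]) -> measurable [set w | b -> Q w].
Proof.
move=> mQ; have [hb|nb] := pselect b.
  rewrite (_ : [set w | _] = [set w | Q w]); first exact: mQ.
  by apply/seteqP; split=> w /= Qw; [exact: Qw|move=> _].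
rewrite (_ : [set w | _] = setT)//; apply/seteqP; split=> // w _ hb.
by case: (nb hb).
Qed.

Let cXe : {ae P, forall w, continuous (fun s : R => X (Num.max 0 s) w)}.
Proof. by apply: filterS cX => w; exact: continuous_extend0. Qed.

Let max0 (s : R) : 0 <= s -> Num.max 0 s = s.
Proof. by move=> s0; apply/max_idPr. Qed.

(** A positive continuous path has such bounds on [0, t], but they depend on the path. Testing them
    at the countably many points [tau m j] makes the event measurable, [whp_ex_of_ae] then yields
    one constant, and density with continuity gives back all times. *)
Lemma whp_path_bounds q : 0 < q ->
  {ae P, forall w, forall s, 0 <= s -> 0 < X s w} ->
  exists K, 1 <= K /\ whp P q (fun w => forall s, 0 <= s <= t -> K^-1 <= X s w <= K).
Proof.
move=> q0 pX.
pose Q n w := forall m j, (j <= m.+1)%N -> n.+1%:R^-1 <= X (tau m j) w <= n.+1%:R.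
have mQ n : measurable [set w | Q n w].
  apply: measurable_forall => m; apply: measurable_forall => j.
  apply: measurable_imply => jm; have /andP[s0 _] := tau0t jm.
  rewrite (_ : [set w | _] = setT `&` X (tau m j) @^-1` `[n.+1%:R^-1, n.+1%:R]).
    exact: mX.
  by apply/seteqP; split=> w /=; rewrite in_itv/=; [move=> ->|move=> []].
have QS n w : Q n w -> Q n.+1 w.
  move=> Qw m j jm; have /andP[h1 h2] := Qw m j jm.
  rewrite (le_trans _ h1) ?(le_trans h2)//= ?ler_nat//.
  by rewrite lef_pV2 ?posrE// ler_nat.
have Qex : {ae P, forall w, exists n, Q n w}.
  apply: filterS2 cXe pX => w cw pw.
  have [c1 _ max1] := EVT_max (ltW t0) (continuous_subspaceT cw).
  have [c2 c2t min2] := EVT_min (ltW t0) (continuous_subspaceT cw).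
  set M := X _ w in max1; set m := X _ w in min2.
  have m_gt0 : 0 < m by apply: pw; rewrite le_max lexx.
  pose n := maxn (Num.truncn M) (Num.truncn m^-1); exists n => i j ji.
  have tij := tau0t ji; have /andP[s0 st] := tij.
  have := max1 (tau i j); have := min2 (tau i j); rewrite !in_itv/= tij max0//.
  move=> /(_ isT) h1 /(_ isT) h2; apply/andP; split.
    apply: le_trans h1; rewrite -[leRHS]invrK lef_pV2 ?posrE ?invr_gt0//.
    by rewrite (le_trans (ltW (truncnS_gt _)))// ler_nat ltnS leq_maxr.
  by rewrite (le_trans h2)// (le_trans (ltW (truncnS_gt _)))// ler_nat ltnS leq_maxl.
have q20 : 0 < q / 2 by rewrite divr_gt0.
have [n Qn] := whp_ex_of_ae mQ QS Qex q20.
exists n.+1%:R; split; first by rewrite ler1n.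
have := whp_and Qn (whp_ae (ltW q20) cXe); apply: whp_mono => [|w [Qw cw] s st]; first lra.
have /andP[s0 _] := st.
have approx (U : set R) : nbhs (X s w) U -> exists m j, (j <= m.+1)%N /\ U (X (tau m j) w).
  move=> sU; have := cw s; rewrite /continuous_at max0// => /(_ U sU).
  move=> /nbhs_ballP[r /= r0 rU]; have [m H] := grid_approx t0 st r0.
  have [j jm sj] := H m (leqnn _); exists m, j; split=> //.
  have /andP[tj0 _] := tau0t jm.
  by have /= := rU (tau m j) sj; rewrite max0.
apply/andP; split; rewrite leNgt; apply/negP => lt.
- have [m [j [jm]]] := approx _ (lt_nbhsl lt).
  by have /andP[h _] := Qw m j jm; rewrite ltNge h.
- have [m [j [jm]]] := approx _ (lt_nbhsr lt).
  by have /andP[_ h] := Qw m j jm; rewrite ltNge h.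
Qed.

(** The same passage through countably many grid points as for the bounds, starting from uniform
    continuity of each path. *)
Lemma whp_path_modulus q th : 0 < q -> 0 < th ->
  exists de, 0 < de /\ whp P q (fun w => forall s s', 0 <= s <= t -> 0 <= s' <= t ->
    `|s - s'| < de -> `|X s w - X s' w| <= th).
Proof.
move=> q0 th0.
pose Q n w := forall m j j', (j <= m.+1)%N /\ (j' <= m.+1)%N /\
  `|tau m j - tau m j'| < n.+1%:R^-1 -> `|X (tau m j) w - X (tau m j') w| <= th.
have mQ n : measurable [set w | Q n w].
  apply: measurable_forall => m; apply: measurable_forall => j.
  apply: measurable_forall => j'; apply: measurable_imply => -[jm [jm' _]].
  have /andP[s0 _] := tau0t jm; have /andP[s0' _] := tau0t jm'.
  have mf : measurable_fun setT (fun w => `|X (tau m j) w - X (tau m j') w|).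
    by apply: measurableT_comp => //; apply: measurable_funB; exact: mX.
  have := mf measurableT `]-oo, th]%classic (measurable_itv _).
  by rewrite setTI; congr measurable; apply/seteqP; split=> w /=; rewrite in_itv.
have QS n w : Q n w -> Q n.+1 w.
  move=> Qw m j j' [jm [jm' lt]]; apply: Qw; split=> //; split=> //.
  by apply: lt_le_trans lt _; rewrite lef_pV2 ?posrE// ler_nat.
have Qex : {ae P, forall w, exists n, Q n w}.
  apply: filterS cXe => w cw.
  have [de de0 H] := continuous_segment_uniform 0 t cw th0.
  have [n _ nde] := near_infty_natSinv_lt (PosNum de0).
  exists n => m j j' [jm [jm' lt]].
  have st := tau0t jm; have /andP[s0 _] := st; have /andP[s0' _] := tau0t jm'.
  have := H _ (tau m j') st (lt_trans lt (nde n (leqnn n))).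
  by rewrite !max0.
have q20 : 0 < q / 2 by rewrite divr_gt0.
have [n Qn] := whp_ex_of_ae mQ QS Qex q20.
exists n.+1%:R^-1; split; first by rewrite invr_gt0.
have := whp_and Qn (whp_ae (ltW q20) cXe); apply: whp_mono => [|w [Qw cw] s s' st st' ss']; first lra.
have /andP[s0 _] := st; have /andP[s0' _] := st'.
apply/ler_addgt0Pr => e e0; have e20 : 0 < e / 2 by rewrite divr_gt0.
have near_s (u : R) : 0 <= u <= t -> exists2 r, 0 < r & forall v, 0 <= v ->
    `|u - v| < r -> `|X u w - X v w| < e / 2.
  move=> /andP[u0 _]; have /cvgrPdist_lt/(_ _ e20) := cw u.
  rewrite max0// => /nbhs_ballP[r /= r0 rH]; exists r => // v v0 uv.
  by have := rH v uv; rewrite /= max0.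
have [r1 r10 H1] := near_s s st; have [r2 r20 H2] := near_s s' st'.
(* Half of the slack: grid points within [g] of [s] and [s'] are still less than 1/(n+1) apart. *)
pose g := (n.+1%:R^-1 - `|s - s'|) / 2.
have g0 : 0 < g by rewrite divr_gt0// subr_gt0.
have rg1 : 0 < Num.min r1 g by rewrite lt_min r10.
have rg2 : 0 < Num.min r2 g by rewrite lt_min r20.
have [M1 G1] := grid_approx t0 st rg1; have [M2 G2] := grid_approx t0 st' rg2.
have [j jm sj] := G1 (maxn M1 M2) (leq_maxl _ _).
have [j' jm' sj'] := G2 (maxn M1 M2) (leq_maxr _ _).
move: sj sj'; rewrite !lt_min -!/(tau _ _) => /andP[sj1 sjg] /andP[sj1' sjg'].
have /andP[tj0 _] := tau0t jm; have /andP[tj0' _] := tau0t jm'.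
have h1 := H1 _ tj0 sj1; have h2 := H2 _ tj0' sj1'.
have h3 : `|X (tau (maxn M1 M2) j) w - X (tau (maxn M1 M2) j') w| <= th.
  apply: Qw; split=> //; split=> //.
  have {}sjg : `|s - tau (maxn M1 M2) j| < g by [].
  have {}sjg' : `|s' - tau (maxn M1 M2) j'| < g by [].
  move: sjg sjg'; set u := tau _ j; set u' := tau _ j' => sjg sjg'.
  have -> : u - u' = (s - s') + (s' - u') - (s - u) by ring.
  apply: le_lt_trans (ler_normB _ _) _.
  have := ler_normD (s - s') (s' - u').
  have : 2 * g = n.+1%:R^-1 - `|s - s'| by rewrite /g; field.
  move: sjg sjg'; clearbody g; move: (n.+1%:R^-1) => iv; lra.
move: h1 h2 h3; set u := X (tau _ j) w; set u' := X (tau _ j') w => h1 h2 h3.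
have -> : X s w - X s' w = (X s w - u) + (u - u') - (X s' w - u') by ring.
apply: le_trans (ler_normB _ _) _.
by have := ler_normD (X s w - u) (u - u'); lra.
Qed.

End PathRegularity.

Lemma eventually_div_lt (R : realType) (c e : R) : 0 < e ->
  exists n0, forall n, (n0 <= n)%N -> (0 < n)%N -> c / n%:R < e.
Proof.
move=> e0; exists (Num.truncn (c / e)).+1 => n n0n nn.
rewrite ltr_pdivrMr ?ltr0n// mulrC -ltr_pdivrMr//.
by apply: lt_le_trans (truncnS_gt _) _; rewrite ler_nat.
Qed.

Lemma riemann_sum_sqr (R : realType) (sg : R -> R) (t : R) (n : nat) (M th : R) :
  continuous sg -> 0 < t -> (0 < n)%N ->
  (forall s, 0 <= s <= t -> `|sg s| <= M) ->
  (forall k, (k < n)%N -> forall s, grid_point t n k <= s <= grid_point t n k.+1 ->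
    `|sg (grid_point t n k) - sg s| <= th) ->
  `|\sum_(0 <= k < n) sg (grid_point t n k) ^+ 2 * (t / n%:R)
    - \int[lebesgue_measure]_(u in `[0, t]) (sg u ^+ 2)| <= 2 * M * th * t.
Proof.
move=> sc t0 n0 sM sth; pose tau := grid_point t n.
have s2c : continuous (fun u => sg u ^+ 2) by move=> u; apply: cvgM; exact: sc.
have tlt k : tau k <= tau k.+1 by apply: ltW; exact: grid_lt.
rewrite -(@sum_Rintegral_grid _ t n t0 n0 (fun u => sg u ^+ 2) s2c) -sumrB.
apply: le_trans (ler_norm_sum _ _ _) _.
apply: (@le_trans _ _ (\sum_(0 <= k < n) 2 * M * th * (t / n%:R))); last first.
  rewrite sumr_const_nat subn0 -mulr_natr le_eqVlt; apply/orP; left; apply/eqP.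
  by field; rewrite pnatr_eq0 -lt0n.
apply: ler_sum_nat => k /andP[_ kn].
have ck : continuous (fun _ : R => sg (tau k) ^+ 2) by move=> u; exact: cvg_cst.
have -> : sg (tau k) ^+ 2 * (t / n%:R) = \int[lebesgue_measure]_(u in `[tau k, tau k.+1]) (sg (tau k) ^+ 2).
  rewrite Rintegral_cst//; have /= -> := @lebesgue_measure_itv R `[tau k, tau k.+1].
  by rewrite lte_fin grid_lt// -EFinB /= grid_step.
rewrite -RintegralB//; [|exact: continuous_integrable..].
rewrite -(grid_step t n0 k); apply: Rintegral_norm_le => //.
  by move=> u; apply: cvgB; [exact: ck|exact: s2c].
move=> u /[dup] uk /andP[ku uk1]; rewrite subr_sqr normrM mulrC.
have t0k : 0 <= tau k <= t.
  rewrite -[X in X <= tau k](grid_point0 t n) grid_le//=.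
  by rewrite -[leRHS](grid_pointn t n0) grid_le// ltnW.
have t0k1 : tau k.+1 <= t by rewrite -[leRHS](grid_pointn t n0) grid_le.
have ut : 0 <= u <= t.
  by have /andP[h _] := t0k; rewrite (le_trans h)//= (le_trans uk1).
apply: ler_pM => //; last exact: sth.
by apply: le_trans (ler_normD _ _) _; have := sM _ t0k; have := sM _ ut; lra.
Qed.

(** * The noise of ln X as a limit of Riemann sums *)

Section ItoLog.
Context (R : realType) (d : measure_display) (T : measurableType d)
  (P : probability T R) (F : R -> set (set T)) (B : R -> T -> R).
Hypotheses (F_usual : usual_filtration P F)
  (B_brownian : standard_brownian_motion P F B).
Local Notation mu := (@lebesgue_measure R).
Variables (r a sigma : R -> R) (X I : R -> T -> R) (x0 : R).
Hypotheses (r_cb : continuous_bounded r) (a_cb : continuous_bounded a)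
  (sigma_cb : continuous_bounded sigma)
  (aX : adapted F X) (cX : continuous_paths P X)
  (pX : {ae P, forall w, forall s, 0 <= s -> 0 < X s w})
  (X0 : {ae P, forall w, X 0 w = x0})
  (HI : forall p, 0 <= p -> is_ito_integral P F B (fun u w => X u w * sigma u) p (I p))
  (XE : forall p, 0 <= p -> {ae P, forall w, X p w =
     x0 + \int[mu]_(u in `[0, p]) (X u w * (r u - a u * X u w)) + I p w}).

(** The noise [N] of the solution, defined through ln X; [ito_log] identifies it with the integral
    of sigma dB. *)
Definition log_drift_free (s : R) (w : T) :=
  ln (X s w) - ln x0
  - \int[mu]_(u in `[0, s]) (r u - 2^-1 * sigma u ^+ 2 - a u * X u w).

Let ext (f : R -> R) (s : R) := f (Num.max 0 s).

Let extE f (s : R) : 0 <= s -> ext f s = f s.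
Proof. by move=> s0; rewrite /ext (max_idPr s0). Qed.

(** The constants are fixed so that none depends on a later one: W, ka and eta from e, then K from
    q, then om and the moduli of continuity, and n last. *)
Lemma ito_log (t q e : R) : 0 < t -> 0 < q -> 0 < e ->
  exists n0, forall n, (n0 <= n)%N -> (0 < n)%N ->
    whp P q (fun w => `|log_drift_free t w - \sum_(0 <= k < n) sigma (grid_point t n k) *
      (B (grid_point t n k.+1) w - B (grid_point t n k) w)| <= e).
Proof.
move=> t0 q0 e0.
have [rc [Mr rM]] := r_cb; have [ac [Ma aM]] := a_cb; have [sc [Ms sM]] := sigma_cb.
pose M := Num.max 1 (Num.max Mr (Num.max Ma Ms)).
have M1 : 1 <= M by rewrite le_max lexx.
have M0 : 0 < M by exact: lt_le_trans M1.
have {}rM s : 0 <= s -> `|r s| <= M by move=> /rM/le_trans; apply; rewrite !le_max lexx !orbT.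
have {}aM s : 0 <= s -> `|a s| <= M by move=> /aM/le_trans; apply; rewrite !le_max lexx !orbT.
have {}sM s : 0 <= s -> `|sigma s| <= M by move=> /sM/le_trans; apply; rewrite !le_max lexx !orbT.
have rec := continuous_extend0 rc; have aec := continuous_extend0 ac.
have sec := continuous_extend0 sc.
(* A bound for Q + eta, known before [eta] is chosen; it makes the Young term ka (Q + eta) at most
   e/8. *)
pose W := M ^+ 2 * t + 2.
have W0 : 0 < W by rewrite addr_gt0// mulr_gt0// exprn_gt0.
pose ka := e / (8 * W); have ka0 : 0 < ka by rewrite divr_gt0// mulr_gt0.
have ki0 : 0 < 1 + ka^-1 by rewrite addr_gt0// invr_gt0.
pose eta := Num.min 1 (Num.min (e / 16) (e / (32 * (1 + ka^-1)))).
have eta0 : 0 < eta by rewrite !lt_min ltr01 !divr_gt0// mulr_gt0.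
have eta1 : eta <= 1 by rewrite ge_min lexx.
have eta2 : eta <= e / 16 by rewrite !ge_min lexx orbT.
have eta3 : (1 + ka^-1) * (4 * eta) <= e / 8.
  have : eta <= e / (32 * (1 + ka^-1)) by rewrite !ge_min lexx !orbT.
  by rewrite ler_pdivlMr ?mulr_gt0//; lra.
have q80 : 0 < q / 8 by rewrite divr_gt0.
have mX s : 0 <= s -> measurable_fun setT (X s).
  by move=> s0; apply: (fmeas_measurable F_usual s0); exact: aX.
have [K [K1 whK]] := whp_path_bounds mX cX t0 q80 pX.
have K0 : 0 < K by exact: lt_le_trans K1.
pose C := M * (1 + K); have C0 : 0 < C by rewrite mulr_gt0// addr_gt0.
(* Then 3 eD = eta^2 bounds the sum of the errors by eta and the sum of their squares by eta^2 <=
   eta. *)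
pose eD := eta ^+ 2 / 3; have eD0 : 0 < eD by rewrite divr_gt0// exprn_gt0.
(* The four bounds serve, in order, the Taylor estimate, the cubic remainder, the drift error A1 and
   the probability lost in [whp_ito_increments]. *)
pose om := Num.min (1 / 2) (Num.min (e / (16 * (8 + 2 * W)))
   (Num.min (e / (8 * (t * C))) (q * eD / (32 * (M + 1) ^+ 2 * t)))).
have om0 : 0 < om.
  rewrite !lt_min !divr_gt0 ?mulr_gt0 ?exprn_gt0 ?addr_gt0 ?mulr_gt0//.
have om2 : om <= 1 / 2 by rewrite ge_min lexx.
have omW : 2 * om * (8 + 2 * W) <= e / 8.
  have : om <= e / (16 * (8 + 2 * W)) by rewrite !ge_min lexx !orbT.
  by rewrite ler_pdivlMr ?mulr_gt0 ?addr_gt0 ?mulr_gt0//; lra.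
have omC : t * C * om <= e / 8.
  have : om <= e / (8 * (t * C)) by rewrite !ge_min lexx !orbT.
  by rewrite ler_pdivlMr ?mulr_gt0//; lra.
have omq : 4 * ((M + 1) * om) ^+ 2 * t / eD <= q / 8.
  have : om <= q * eD / (32 * (M + 1) ^+ 2 * t) by rewrite !ge_min lexx !orbT.
  rewrite ler_pdivlMr ?mulr_gt0 ?exprn_gt0 ?addr_gt0// => h.
  rewrite ler_pdivrMr//.
  have : (M + 1) ^+ 2 * t * (om * om) <= (M + 1) ^+ 2 * t * om.
    apply: ler_wpM2l; first by rewrite mulr_ge0 ?sqr_ge0// ltW.
    by rewrite ler_piMr ?(ltW om0)//; lra.
  have -> : 4 * ((M + 1) * om) ^+ 2 * t = 4 * ((M + 1) ^+ 2 * t * (om * om)) by ring.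
  by lra.
pose th := om / K; have th0 : 0 < th by rewrite divr_gt0.
have Kth : K * th = om by rewrite /th mulrC divfK// lt0r_neq0.
have [de1 [de10 whm]] := whp_path_modulus mX cX t0 q80 th0.
pose ths := Num.min om (eta / (4 * M * t)).
have ths0 : 0 < ths by rewrite lt_min om0 divr_gt0// !mulr_gt0.
have ths_om : ths <= om by rewrite ge_min lexx.
have ths_eta : 2 * M * ths * t <= eta / 2.
  have : ths <= eta / (4 * M * t) by rewrite ge_min lexx orbT.
  by rewrite ler_pdivlMr ?mulr_gt0//; lra.
have [de2 de20 smod] := continuous_segment_uniform 0 t sec ths0.
have [n1 Hn1] := eventually_div_lt t de10.
have [n2 Hn2] := eventually_div_lt t de20.
have [n3 Hn3] := eventually_div_lt ((K ^+ 2 * C * t) ^+ 2) eta0.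
have [n4 Hn4] := eventually_div_lt (30 * M ^+ 4 * t ^+ 2 / (eta / 2) ^+ 2) q80.
exists (maxn (maxn n1 n2) (maxn n3 n4)) => n; rewrite !geq_max.
move=> /andP[/andP[/Hn1 {}Hn1 /Hn2 {}Hn2] /andP[/Hn3 {}Hn3 /Hn4 {}Hn4]] n0.
have {}Hn1 := Hn1 n0; have {}Hn2 := Hn2 n0; have {}Hn3 := Hn3 n0; have {}Hn4 := Hn4 n0.
pose tau := grid_point t n.
have tau0 : tau 0%N = 0 by exact: grid_point0.
have taun : tau n = t by exact: grid_pointn.
have tau_lt k : tau k < tau k.+1 by exact: grid_lt.
have tau_step k : tau k.+1 - tau k = t / n%:R by exact: grid_step.
have tau_le i k : (i <= k)%N -> tau i <= tau k by exact: grid_le.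
have tau_ge0 k : 0 <= tau k by rewrite -tau0 tau_le.
have tau_let k : (k <= n)%N -> tau k <= t by move=> kn; rewrite -taun tau_le.
have in0t k s : (k < n)%N -> tau k <= s <= tau k.+1 -> 0 <= s <= t.
  by move=> kn /andP[h1 h2]; rewrite (le_trans _ h1)//= (le_trans h2)// tau_let.
have near_tau k s : tau k <= s <= tau k.+1 -> `|tau k - s| <= t / n%:R.
  by move=> /andP[h1 h2]; rewrite distrC ger0_norm ?subr_ge0// -(tau_step k) lerB.
have sth k : (k < n)%N -> forall s, tau k <= s <= tau k.+1 -> `|ext sigma (tau k) - ext sigma s| <= ths.
  move=> kn s sk; apply: smod; first by rewrite tau_ge0 tau_let// ltnW.
  by apply: le_lt_trans Hn2; exact: near_tau.
(* Cutting off below at 1/K makes the coefficient bounded on the whole space, as elementary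
   integrands require; on the good event it is 1/X. *)
pose g k w := (Num.max (X (tau k) w) K^-1)^-1.
have gK k w : `|g k w| <= K.
  have m0 : 0 < Num.max (X (tau k) w) K^-1 by rewrite lt_max invr_gt0 K0 orbT.
  rewrite gtr0_norm ?invr_gt0// -[leRHS]invrK lef_pV2 ?posrE ?invr_gt0//.
  by rewrite le_max lexx orbT.
have mg k : fmeas (F (tau k)) (g k).
  have m0 w : 0 < Num.max (X (tau k) w) K^-1 by rewrite lt_max invr_gt0 K0 orbT.
  rewrite (_ : g k = fun w => expR (- ln (Num.max (X (tau k) w) K^-1))); last first.
    by apply/funext => w; rewrite expRN lnK ?posrE.
  apply/(fmeasFP F_usual) => //; apply: measurableT_comp => //.
  apply: measurableT_comp => //; apply: measurableT_comp; first exact: measurable_ln.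
  by apply: measurable_maxr => //; apply/(fmeasFP F_usual) => //; exact: aX.
pose bounded_path w := (forall s, 0 <= s <= t -> K^-1 <= X s w <= K) /\
  (forall s s', 0 <= s <= t -> 0 <= s' <= t -> `|s - s'| < de1 -> `|X s w - X s' w| <= th).
have whp_bounded : whp P (q / 8 + q / 8) bounded_path by exact: whp_and.
have gE w k : (k < n)%N -> bounded_path w -> g k w = (X (tau k) w)^-1 /\ 0 < X (tau k) w.
  move=> kn [bK _]; have /andP[h _] := bK _ (in0t k (tau k) kn (introT andP (conj (lexx _) (ltW (tau_lt k))))).
  by rewrite /g (max_idPl h); split=> //; apply: lt_le_trans h; rewrite invr_gt0.
have modX w k s : bounded_path w -> (k < n)%N -> tau k <= s <= tau k.+1 ->
    `|X s w - X (tau k) w| <= th.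
  move=> [_ bm] kn sk; apply: bm; first exact: in0t sk.
    by rewrite tau_ge0 tau_let// ltnW.
  by rewrite distrC; apply: le_lt_trans Hn1; exact: near_tau.
have gH : whp P (q / 8 + q / 8) (fun w => forall k, (k < n)%N -> forall x,
    tau k < x <= tau k.+1 -> `|g k w * (X x w * sigma x) - sigma (tau k)| <= (M + 1) * om).
  apply: whpW whp_bounded => w bw k kn x /andP[kx xk].
  have kxk : tau k <= x <= tau k.+1 by rewrite ltW.
  have [-> Xk0] := gE w k kn bw; have /andP[x0' xt] := in0t k x kn kxk.
  (* The oscillation of X contributes om M and that of sigma contributes om. *)
  have -> : (X (tau k) w)^-1 * (X x w * sigma x) - sigma (tau k) =
    (X (tau k) w)^-1 * (X x w - X (tau k) w) * sigma x + (sigma x - sigma (tau k)).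
    by field; exact: lt0r_neq0.
  apply: le_trans (ler_normD _ _) _; rewrite mulrDl mul1r; apply: lerD.
    rewrite normrM mulrC; apply: ler_pM => //; first exact: sM.
    rewrite -Kth normrM; apply: ler_pM => //; last exact: modX.
    by have [<- _] := gE w k kn bw; exact: gK.
  by apply: le_trans ths_om; have := sth k kn x kxk; rewrite distrC !extE.
have incr := whp_ito_increments F_usual B_brownian tau0 taun (fun k _ => tau_lt k) HI
  (fun k _ => mg k) (fun k _ w => gK k w) K0 q80 eD0 gH.
have qv := whp_brownian_sqr_sum F_usual B_brownian (tau_ge0 0%N) (fun k (_ : (k < n)%N) => tau_lt k)
  (fun k => sigma (tau k) ^+ 2) (divr_gt0 eta0 (ltr0Sn _ 1)).
have eqs : whp P 0 (fun w => X 0 w = x0 /\ (forall k, X (tau k) w =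
     x0 + \int[mu]_(u in `[0, tau k]) (X u w * (r u - a u * X u w)) + I (tau k) w) /\
     continuous (fun s : R => X (Num.max 0 s) w)).
  apply: whp_ae => //; have h1 := ae_foralln (fun k => XE (tau_ge0 k)).
  have h2 : {ae P, forall w, continuous (fun s : R => X (Num.max 0 s) w)}.
    by apply: filterS cX => w; exact: continuous_extend0.
  by apply: filterS2 X0 (filterI h1 h2) => w ? [? ?]; split=> //; split.
(* The exceptional probabilities add up to at most 7 q / 8: q/4, q/2, q/8 and 0. *)
have := whp_and whp_bounded (whp_and incr (whp_and qv eqs)).
apply: whp_mono => [|w [bw [[D2 D1] [QV [X0w [Xeq Xc]]]]]].
  have : (\sum_(0 <= k < n) (sigma (tau k) ^+ 2) ^+ 2 * (30 * (tau k.+1 - tau k) ^+ 2)) / (eta / 2) ^+ 2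
     <= q / 8.
    apply: le_trans (ltW Hn4); rewrite mulrAC ler_wpM2r ?invr_ge0 ?sqr_ge0//.
    apply: (@le_trans _ _ (\sum_(0 <= k < n) M ^+ 4 * (30 * (t / n%:R) ^+ 2))).
      apply: ler_sum_nat => k _; rewrite tau_step; apply: ler_wpM2r.
        by apply: mulr_ge0 => //; exact: sqr_ge0.
      rewrite -exprM -[leLHS]ger0_norm ?exprn_even_ge0// normrX.
      by apply: lerXn2r; rewrite ?nnegrE ?sM// ltW.
    rewrite sumr_const_nat subn0 -mulr_natr le_eqVlt; apply/orP; left; apply/eqP.
    by field; rewrite pnatr_eq0 -lt0n.
  by clear -q0 omq F_usual B_brownian r_cb a_cb sigma_cb aX cX pX X0 HI XE; lra.
pose Q := \int[mu]_(u in `[0, t]) (ext sigma u ^+ 2).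
have Q0 : 0 <= Q by apply: Rintegral_ge0 => u _; exact: sqr_ge0.
have QM : Q <= M ^+ 2 * t.
  have -> : t = t - 0 by rewrite subr0.
  apply: le_trans (ler_norm _) _; apply: Rintegral_norm_le; last 2 first.
  - exact: ltW.
  - move=> u /andP[u0 ut]; rewrite normrX lerXn2r ?nnegrE ?(ltW M0)//.
    by rewrite extE// sM.
  - by move=> u; apply: cvgM; exact: sec.
have bnd_ext (f : R -> R) (fM : forall s, 0 <= s -> `|f s| <= M) s : 0 <= s <= t -> `|ext f s| <= M.
  by move=> /andP[s0 _]; rewrite extE// fM.
have QVQ : `|\sum_(0 <= k < n) (ext sigma (tau k) * (B (tau k.+1) w - B (tau k) w)) ^+ 2 - Q| <= eta.
  have rs := riemann_sum_sqr sec t0 n0 (bnd_ext sigma sM) sth.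
  (* Centered squares plus the error of a Riemann sum, each at most eta/2. *)
  have -> : \sum_(0 <= k < n) (ext sigma (tau k) * (B (tau k.+1) w - B (tau k) w)) ^+ 2 - Q =
    \sum_(0 <= k < n) sigma (tau k) ^+ 2 *
       ((B (tau k.+1) w - B (tau k) w) ^+ 2 - (tau k.+1 - tau k)) +
    (\sum_(0 <= k < n) ext sigma (tau k) ^+ 2 * (t / n%:R) - Q).
    rewrite addrA -big_split/=; congr (_ - _); apply: eq_bigr => k _.
    by rewrite tau_step extE//; ring.
  apply: le_trans (ler_normD _ _) _; have := le_trans rs ths_eta.
  by rewrite -/Q; clear -QV F_usual B_brownian r_cb a_cb sigma_cb aX cX pX X0 HI XE; lra.
have Xext s : 0 <= s -> X (Num.max 0 s) w = X s w by move=> s0; rewrite (max_idPr s0).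
pose dI k := I (tau k.+1) w - I (tau k) w.
pose dB k := B (tau k.+1) w - B (tau k) w.
have xbc : continuous (fun u : R => X (Num.max 0 u) w * (ext r u - ext a u * X (Num.max 0 u) w)).
  move=> u; apply: cvgM; first exact: Xc.
  by apply: cvgB; [exact: rec|apply: cvgM; [exact: aec|exact: Xc]].
have intE p : 0 <= p -> \int[mu]_(u in `[0, p]) (X u w * (r u - a u * X u w)) =
    \int[mu]_(u in `[0, p]) (X (Num.max 0 u) w * (ext r u - ext a u * X (Num.max 0 u) w)).
  move=> p0; apply: eq_Rintegral => u; rewrite inE/= in_itv/= => /andP[u0 _].
  by rewrite !extE// Xext.
have DE k : (k < n)%N -> (X (Num.max 0 (tau k)) w)^-1 * dI k - ext sigma (tau k) * dB k =
   g k w * (I (tau k.+1) w - I (tau k) w) - sigma (tau k) * (B (tau k.+1) w - B (tau k) w).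
  by move=> kn; rewrite Xext// extE//; have [-> _] := gE w k kn bw.
have xK s : 0 <= s <= t -> K^-1 <= X (Num.max 0 s) w <= K.
  by move=> st; have /andP[s0 _] := st; rewrite Xext//; apply: bw.1.
have xth k : (k < n)%N -> forall s, tau k <= s <= tau k.+1 ->
    `|X (Num.max 0 s) w - X (Num.max 0 (tau k)) w| <= th.
  move=> kn s sk; have /andP[s0 _] := in0t k s kn sk.
  by rewrite !Xext//; exact: modX.
have th2 : K * th <= 1 / 2 by rewrite Kth.
have xE k : (k < n)%N -> X (Num.max 0 (tau k.+1)) w - X (Num.max 0 (tau k)) w =
    \int[mu]_(u in `[tau k, tau k.+1])
      (X (Num.max 0 u) w * (ext r u - ext a u * X (Num.max 0 u) w)) + dI k.
  move=> kn; rewrite !Xext// (Xeq k) (Xeq k.+1) !intE// /dI.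
  by rewrite (Rintegral_chasles xbc (tau_ge0 k) (ltW (tau_lt k))); ring.
have D1' : `|\sum_(0 <= k < n) ((X (Num.max 0 (tau k)) w)^-1 * dI k
    - ext sigma (tau k) * dB k)| <= eta.
  rewrite (eq_big_nat _ _ (F2 := fun k => g k w * (I (tau k.+1) w - I (tau k) w)
    - sigma (tau k) * (B (tau k.+1) w - B (tau k) w))); last by move=> k /andP[_]; exact: DE.
  rewrite -(ler_pXn2r (ltn0Sn 1)) ?nnegrE ?(ltW eta0)// real_normK ?num_real//.
  by apply: le_trans D1 _; rewrite /eD mulrC divfK.
have D2' : \sum_(0 <= k < n) ((X (Num.max 0 (tau k)) w)^-1 * dI k
    - ext sigma (tau k) * dB k) ^+ 2 <= eta.
  rewrite (eq_big_nat _ _ (F2 := fun k => (g k w * (I (tau k.+1) w - I (tau k) w)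
    - sigma (tau k) * (B (tau k.+1) w - B (tau k) w)) ^+ 2)); last first.
    by move=> k /andP[_ kn]; rewrite DE.
  by apply: le_trans D2 _; rewrite /eD mulrC divfK// expr2 ler_piMr// ltW.
have := ito_pathwise Xc rec aec sec t0 n0 K1 xK (bnd_ext r rM) (bnd_ext a aM) xth th2 xE
  D1' D2' QVQ ka0.
rewrite -/Q -/C Kth /= Xext ?(ltW t0)// Xext// X0w.
have -> : \sum_(0 <= k < n) ext sigma (grid_point t n k) * dB k =
  \sum_(0 <= k < n) sigma (grid_point t n k) *
      (B (grid_point t n k.+1) w - B (grid_point t n k) w).
  by apply: eq_bigr => k _; rewrite extE.
have -> : \int[mu]_(u in `[0, t]) (ext r u - 2^-1 * ext sigma u ^+ 2 - ext a u * X (Num.max 0 u) w)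
  = \int[mu]_(u in `[0, t]) (r u - 2^-1 * sigma u ^+ 2 - a u * X u w).
  by apply: eq_Rintegral => u; rewrite inE/= in_itv/= => /andP[u0 _]; rewrite !extE// Xext.
move=> /le_trans; apply.
set A2 := (K ^+ 2 * C * t) ^+ 2 / n%:R in Hn3 *.
have A2le := ltW Hn3.
have QW : Q + eta <= W by rewrite /W; clear -QM eta1 F_usual B_brownian r_cb a_cb sigma_cb aX cX pX X0 HI XE; lra.
have t1 : 2 * om * (2 * (2 * A2 + 2 * eta) + 2 * (Q + eta)) <= e / 8.
  apply: le_trans omW; rewrite ler_wpM2l ?mulr_ge0 ?(ltW om0)//.
  by clear -A2le QW eta1 F_usual B_brownian r_cb a_cb sigma_cb aX cX pX X0 HI XE; lra.
have t2 : (1 + ka^-1) * (2 * A2 + 2 * eta) <= e / 8.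
  apply: le_trans eta3; rewrite ler_wpM2l ?(ltW ki0)//.
  by clear -A2le F_usual B_brownian r_cb a_cb sigma_cb aX cX pX X0 HI XE; lra.
have t3 : ka * (Q + eta) <= e / 8.
  apply: (@le_trans _ _ (ka * W)); first by rewrite ler_wpM2l// ltW.
  by rewrite /ka le_eqVlt; apply/orP; left; apply/eqP; field; exact: lt0r_neq0.
by clear -e0 t1 t2 t3 omC eta2 F_usual B_brownian r_cb a_cb sigma_cb aX cX pX X0 HI XE; lra.
Qed.

End ItoLog.

(** * Sublinear growth of the noise *)

Section WienerIntegral.
Context (R : realType) (d : measure_display) (T : measurableType d)
  (P : probability T R) (F : R -> set (set T)) (B : R -> T -> R).
Hypotheses (F_usual : usual_filtration P F)
  (B_brownian : standard_brownian_motion P F B).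
Variable sigma : R -> R.

(** The sums do not involve the solution and determine [N t] almost surely at each time; this is how
    the noises of two solutions are compared. *)
Definition wiener_integral (N : R -> T -> R) := forall t q e : R,
  0 < t -> 0 < q -> 0 < e -> exists n0, forall n, (n0 <= n)%N -> (0 < n)%N ->
    whp P q (fun w => `|N t w - \sum_(0 <= k < n) sigma (grid_point t n k) *
      (B (grid_point t n k.+1) w - B (grid_point t n k) w)| <= e).

Lemma wiener_integral_unique (N N' : R -> T -> R) (t : R) :
  wiener_integral N -> wiener_integral N' -> 0 < t ->
  {ae P, forall w, N t w = N' t w}.
Proof.
move=> HN HN' t0; apply: ae_eq_of_whp => q e q0 e0.
have q20 : 0 < q / 2 by rewrite divr_gt0.
have e20 : 0 < e / 2 by rewrite divr_gt0.
have [n1 H1] := HN t _ _ t0 q20 e20; have [n2 H2] := HN' t _ _ t0 q20 e20.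
pose n := (maxn n1 n2).+1.
have h1 := H1 n (leqW (leq_maxl _ _)) isT; have h2 := H2 n (leqW (leq_maxr _ _)) isT.
have := whp_and h1 h2; apply: whp_mono => [|w []]; first lra.
set S := \sum_(0 <= k < n) _ => a b.
have -> : N t w - N' t w = (N t w - S) - (N' t w - S) by ring.
by apply: le_trans (ler_normB _ _) _; lra.
Qed.

Variables (N : R -> T -> R) (M : R).
Hypotheses (HN : wiener_integral N) (M0 : 0 < M)
  (sM : forall s : R, 0 <= s -> `|sigma s| <= M)
  (N0 : {ae P, forall w, N 0 w = 0})
  (cN : {ae P, forall w, continuous (fun s : R => N (Num.max 0 s) w)}).

Let dyadic (L : R) m j : R := L * j%:R / (2 ^ m)%:R.

(** The Riemann sums for the end points L j / 2^m, taken with j p steps, are partial sums along a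
    single grid of [0, L] with n = 2^m p steps, so Kolmogorov's inequality bounds all of them at
    once; [v] pays for replacing [N] by the sums. *)
Let whp_dyadic_max (L e v : R) (m : nat) : 0 < L -> 0 < e -> 0 < v ->
  whp P (M ^+ 2 * L / e ^+ 2 + v)
    (fun w => forall j, (j <= 2 ^ m)%N -> `|N (dyadic L m j) w| <= 2 * e).
Proof.
move=> L0 e0 v0; have m0 : 0 < (2 ^ m)%:R :> R by rewrite ltr0n expn_gt0.
have d0 j : (0 < j)%N -> 0 < dyadic L m j.
  by move=> j0; apply: divr_gt0 => //; apply: mulr_gt0 => //; rewrite ltr0n.
pose v' := v / (2 * (2 ^ m).+1%:R); have v'0 : 0 < v' by rewrite divr_gt0 ?mulr_gt0.
have /choice[n1 Hn1] : forall j, exists n0, (0 < j)%N -> forall n, (n0 <= n)%N -> (0 < n)%N ->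
    whp P v' (fun w => `|N (dyadic L m j) w - \sum_(0 <= k < n)
      sigma (grid_point (dyadic L m j) n k) *
      (B (grid_point (dyadic L m j) n k.+1) w - B (grid_point (dyadic L m j) n k) w)| <= e).
  move=> j; have [j0|_] := ltnP 0 j; last by exists 0%N.
  by have [n0 H] := HN (d0 j j0) v'0 e0; exists n0.
(* Beyond every threshold [n1 j], so that j p steps suffice for each j > 0. *)
pose p := (\max_(j < (2 ^ m).+1) n1 j).+1.
have pn j : (j <= 2 ^ m)%N -> (n1 j <= p)%N.
  by move=> jm; rewrite leqW// (leq_bigmax (Ordinal (jm : (j < (2 ^ m).+1)%N))).
pose n := (2 ^ m * p)%N; have n0 : (0 < n)%N by rewrite muln_gt0 expn_gt0.
have gridE j k : (0 < j)%N -> grid_point (dyadic L m j) (j * p) k = grid_point L n k.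
  move=> j0; rewrite /grid_point /dyadic /n !natrM; field.
  by rewrite !pnatr_eq0 -!lt0n j0 /= expn_gt0.
pose S i w := \sum_(0 <= k < i) sigma (grid_point L n k) *
   (B (grid_point L n k.+1) w - B (grid_point L n k) w).
have close j : (j < (2 ^ m).+1)%N -> whp P v' (fun w => `|N (dyadic L m j) w - S (j * p)%N w| <= e).
  move=> jm; have [j0|] := ltnP 0 j; last first.
    rewrite leqn0 => /eqP ->; apply: (whp_ae (ltW v'0)); apply: filterS N0 => w Nw.
    by rewrite /dyadic mulr0 mul0r Nw /S mul0n big_geq// subrr normr0 ltW.
  have jp : (n1 j <= j * p)%N by rewrite (leq_trans (pn j jm))// leq_pmull.
  have := Hn1 j j0 (j * p)%N jp; rewrite muln_gt0 j0 => /(_ isT).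
  by apply: whpW => w; under eq_bigr do rewrite !gridE//.
have s_lt i : (i < n)%N -> grid_point L n i < grid_point L n i.+1.
  by move=> _; exact: grid_lt.
have s_0 : 0 <= grid_point L n 0 by rewrite grid_point0.
have kol := whp_max_brownian_sum F_usual B_brownian s_0 s_lt
  (fun k => sigma (grid_point L n k)) e0.
have := whp_and kol (whp_forall_lt (ltW v'0) close).
apply: whp_mono => [|w [Se Ne] j jm].
  apply: lerD.
    rewrite ler_wpM2r ?invr_ge0 ?sqr_ge0//.
    apply: (@le_trans _ _ (\sum_(0 <= k < n) M ^+ 2 * (L / n%:R))).
      apply: ler_sum_nat => k _; rewrite grid_step//.
      apply: ler_wpM2r; first by rewrite divr_ge0// ltW.
      have sk : 0 <= grid_point L n k by rewrite -(grid_point0 L n) grid_le.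
      rewrite -[leLHS]real_normK ?num_real//.
      by apply: lerXn2r; rewrite ?nnegrE ?sM// ltW.
    rewrite sumr_const_nat subn0 -[_ *+ n]mulr_natr le_eqVlt; apply/orP; left; apply/eqP.
    by field; rewrite pnatr_eq0 -lt0n.
  have -> : v' *+ (2 ^ m).+1 = v / 2.
    rewrite -[_ *+ _]mulr_natr /v'; move: (2 ^ m).+1%:R (lt0r_neq0 (ltr0Sn R (2 ^ m))) => z z0.
    by field; rewrite z0.
  by lra.
have jm' : (j < (2 ^ m).+1)%N by [].
rewrite -(subrK (S (j * p)%N w) (N (dyadic L m j) w)); apply: le_trans (ler_normD _ _) _.
have h1 := Ne j jm'; have h2 : `|S (j * p)%N w| <= e by apply: Se; rewrite leq_mul2r jm orbT.
by lra.
Qed.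

(** The dyadic grids are nested, so [whp_foralln] covers all levels without increasing the
    probability; continuity covers the other times. *)
Let whp_max (L e v : R) : 0 < L -> 0 < e -> 0 < v ->
  whp P (M ^+ 2 * L / e ^+ 2 + v)
    (fun w => forall s : R, 0 <= s <= L -> `|N s w| <= 2 * e).
Proof.
move=> L0 e0 v0; have v20 : 0 < v / 2 by rewrite divr_gt0.
have dS m w : (forall j, (j <= 2 ^ m.+1)%N -> `|N (dyadic L m.+1 j) w| <= 2 * e) ->
    (forall j, (j <= 2 ^ m)%N -> `|N (dyadic L m j) w| <= 2 * e).
  move=> H j jm; have := H (2 * j)%N; rewrite expnS leq_mul2l /= jm => /(_ isT).
  rewrite (_ : dyadic L m.+1 (2 * j)%N = dyadic L m j)// /dyadic expnS !natrM; field.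
  by rewrite pnatr_eq0 -lt0n expn_gt0.
have H1 := whp_foralln dS (fun m => whp_dyadic_max m L0 e0 v20).
have := whp_and H1 (whp_and (whp_ae (ltW v20) N0) (whp_ae (lexx 0) cN)).
apply: whp_mono => [|w [Hd [N0w cw]] s /andP[s0 sL]]; first lra.
move: s0; rewrite le_eqVlt => /predU1P[<-|s0].
  by rewrite N0w normr0 mulr_ge0// ltW.
rewrite leNgt; apply/negP => lt.
have gap : 0 < `|N s w| - 2 * e by rewrite subr_gt0.
have /cvgrPdist_lt/(_ _ gap) := cw s; move=> /nbhs_ballP[r /= r0 rH].
have sL' : 0 <= s <= L by rewrite sL ltW.
have [m0 Hm] := grid_approx L0 sL' r0.
(* [grid_approx] counts m + 1 steps: the predecessor gives the dyadic grid, and it is at least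
   [m0]. *)
have [|j jm] := Hm (2 ^ m0).-1.
  by rewrite -ltnS prednK ?expn_gt0// ltn_expl.
rewrite prednK ?expn_gt0// in jm *; move=> /rH.
rewrite (max_idPr (ltW s0)) max_r; last by rewrite divr_ge0// mulr_ge0// ltW.
have := Hd m0 j jm; rewrite /dyadic; set u := N _ w => uh h.
have := ler_normB (N s w) u; have := ler_normD (N s w - u) u; rewrite subrK; lra.
Qed.

(** On [0, 2^k] the variance is at most M^2 2^k while the threshold is proportional to 2^k, so the
    exceptional probabilities decay geometrically and are summable. *)
Lemma wiener_integral_sublinear :
  {ae P, forall w, forall e : R, 0 < e -> exists S, forall s, S <= s -> `|N s w| <= e * s}.
Proof.
have main (n : nat) : {ae P, forall w, exists k0, forall k, (k0 <= k)%N ->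
    forall s : R, 0 <= s <= 2 ^+ k -> `|N s w| <= 2 * (n.+1%:R^-1 * 2 ^+ k)}.
  have n0 : 0 < n.+1%:R^-1 :> R by rewrite invr_gt0.
  (* [C] / 2^(k+1) is twice the Kolmogorov bound [v] below; the second half pays for the
     approximation by Riemann sums. *)
  pose C := 4 * M ^+ 2 / n.+1%:R^-1 ^+ 2.
  have C0 : 0 < C by rewrite divr_gt0 ?mulr_gt0 ?exprn_gt0.
  apply: (@ae_eventually_of_whp _ _ _ _ (fun k => C / (2 ^ k.+1)%:R)).
    apply: le_lt_trans (epsilon_trick0 xpredT (ltW C0)) _; exact: ltry.
  move=> k; have k0 : 0 < 2 ^+ k :> R by rewrite exprn_gt0.
  have e0 : 0 < n.+1%:R^-1 * 2 ^+ k :> R by rewrite mulr_gt0.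
  pose v := M ^+ 2 * 2 ^+ k / (n.+1%:R^-1 * 2 ^+ k) ^+ 2.
  have v0 : 0 < v by rewrite divr_gt0 ?mulr_gt0 ?exprn_gt0.
  have := whp_max k0 e0 v0; apply: whp_mono => // .
  rewrite -/v le_eqVlt; apply/orP; left; apply/eqP; rewrite /v /C natrX (exprS _ k).
  by move: (n.+1%:R^-1) (lt0r_neq0 n0) (2 ^+ k) (lt0r_neq0 k0) => x x0 y y0; field; rewrite x0 y0.
have := ae_foralln main; apply: filterS => w Hw e e0.
(* The bound is used on an interval [0, 2^k] containing s with 2^k <= 4 s, and 2 (e/8) (4 s) = e
   s. *)
have e80 : 0 < e / 8 by rewrite divr_gt0.
have [n _ /(_ n (leqnn n)) ne] := near_infty_natSinv_lt (PosNum e80).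
rewrite /= in ne; have [k0 Hk] := Hw n; exists (2 ^+ k0) => s sk0.
have s_gt0 : 0 < s by apply: lt_le_trans sk0; rewrite exprn_gt0.
have ex : exists k, s <= 2 ^+ k.
  exists (Num.truncn s).+1; apply: le_trans (ltW (truncnS_gt s)) _.
  by rewrite -natrX ler_nat ltnW// ltn_expl.
have [k0k sk ks] : [/\ (k0 <= (ex_minn ex).+1)%N, s <= 2 ^+ (ex_minn ex).+1 &
    2 ^+ (ex_minn ex).+1 <= 4 * s].
  case: ex_minnP => k sk min.
  have k0k : (k0 <= k)%N by rewrite -(@ler_eXn2l R 2)// ?ltr1n// (le_trans sk0).
  split; first exact: leqW.
    by apply: le_trans sk _; rewrite exprS; have : 0 < 2 ^+ k :> R by [rewrite exprn_gt0]; lra.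
  case: k sk min k0k => [|k] sk min k0k; last first.
    have := min k; rewrite ltnn; case: (leP s (2 ^+ k)) => [_ /(_ isT)//|h _].
    by rewrite !exprS; lra.
  by move: k0k sk0; rewrite leqn0 => /eqP ->; rewrite expr0 expr1; lra.
have := Hk _ k0k s; rewrite (ltW s_gt0) => /(_ sk)/le_trans; apply.
apply: (@le_trans _ _ (2 * (e / 8 * (4 * s)))); last by lra.
by rewrite ler_pM2l// ler_pM// ltW// ?exprn_gt0.
Qed.

End WienerIntegral.

(** * Attraction *)

(** The liminf is a supremum of infima over neighbourhoods of +oo; one of these is positive, and [c]
    is its value, or 1 if it is +oo. *)
Lemma limf_einf_pinfty_gt0 (R : realType) (f : R -> R) :
  (0 < limf_einf (EFin \o f) (pinfty_nbhs R))%E ->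
  exists2 c : R, 0 < c & exists T0 : R, forall t, T0 < t -> c <= f t.
Proof.
rewrite limf_einfE => /ereal_sup_gt[_ [V [M [_ MV]] <-]] inf0.
have [c c0 cV] : exists2 c : R, 0 < c & (c%:E <= ereal_inf [set (EFin \o f) x | x in V])%E.
  move: inf0; case: (ereal_inf _) => [c| |] // c0; first by exists c.
  by exists 1; rewrite ?leey.
exists c => //; exists M => t /MV Vt; rewrite -lee_fin; apply: le_trans cV _.
by apply: ereal_inf_lbound; exists t.
Qed.

(** * The logistic equation along one path *)

Section Primitive.
Context (R : realType).
Local Notation mu := (@lebesgue_measure R).
Implicit Types (f : R -> R) (t : R).

Lemma is_derive_Rintegral f (t0 t : R) : continuous f -> t0 < t ->
  is_derive t 1 (fun s : R => \int[mu]_(u in `[t0, s]) f u) (f t).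
Proof.
move=> fc t0t.
have tt : t < t + 1 by rewrite ltrDl.
have [df f'E] := continuous_FTC1_closed tt (continuous_integrable t0 (t + 1) fc) t0t (fc t).
by rewrite -f'E derive1E; exact: DeriveDef.
Qed.

Lemma continuous_Rintegral0 f : continuous f ->
  continuous (fun s : R => \int[mu]_(u in `[0, Num.max 0 s]) f u).
Proof.
move=> fc s.
have m0 (u : R) : 0 <= Num.max 0 u by rewrite le_max lexx.
(* With -1 as lower end, time 0 becomes interior and the primitive is differentiable there too. *)
have e (u : R) : \int[mu]_(v in `[0, Num.max 0 u]) f v =
    \int[mu]_(v in `[-1, Num.max 0 u]) f v - \int[mu]_(v in `[-1, 0]) f v.
  by rewrite (@Rintegral_chasles _ f (-1) 0 (Num.max 0 u)) ?lerN10// addrC addKr.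
under eq_fun do rewrite e.
apply: cvgB; last exact: cvg_cst.
apply: (@continuous_comp _ _ _ (fun u : R => Num.max 0 u) (fun u : R => \int[mu]_(v in `[-1, u]) f v)).
  by apply: (@continuous_max R R (fun=> 0) id); [exact: cvg_cst|exact: cvg_id].
apply: differentiable_continuous; apply/derivable1_diffP.
have : -1 < Num.max 0 s by rewrite (lt_le_trans _ (m0 s))// ltrN10.
by move=> /(is_derive_Rintegral fc) [].
Qed.

Lemma logistic_closed_form (a x Phi : R -> R) (x0 t : R) :
  continuous a -> continuous x -> continuous Phi ->
  (forall s : R, 0 <= s -> x s = x0 * Phi s * expR (- \int[mu]_(u in `[0, s]) (a u * x u))) ->
  0 <= t ->
  expR (\int[mu]_(u in `[0, t]) (a u * x u)) =
    1 + x0 * \int[mu]_(u in `[0, t]) (a u * Phi u).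
Proof.
move=> ac xc pc xE; rewrite le_eqVlt => /predU1P[<-|t0].
  by rewrite set_itv1 !Rintegral_set1 expR0 mulr0 addr0.
have axc : continuous (fun u => a u * x u) by move=> u; apply: cvgM; [exact: ac|exact: xc].
have apc : continuous (fun u => a u * Phi u) by move=> u; apply: cvgM; [exact: ac|exact: pc].
pose J (s : R) := \int[mu]_(u in `[-1, s]) (a u * x u).
pose A (s : R) := \int[mu]_(u in `[-1, s]) (a u * Phi u).
have e (f : R -> R) (s : R) : continuous f -> 0 <= s -> \int[mu]_(v in `[0, s]) f v =
    \int[mu]_(v in `[-1, s]) f v - \int[mu]_(v in `[-1, 0]) f v.
  by move=> fc s0; rewrite (@Rintegral_chasles _ f (-1) 0 s) ?lerN10// addrC addKr.
(* The difference of the two sides up to the constant 1. By the equation for [x] its derivative exp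
   (J s - J 0) a x - x0 a Phi vanishes, also at 0 since [J] and [A] start at -1. *)
pose W (s : R) := expR (J s - J 0) - x0 * (A s - A 0).
have dW (s : R) : 0 <= s -> is_derive s 1 W 0.
  move=> s0; have s1 : -1 < s by rewrite (lt_le_trans _ s0)// ltrN10.
  have dJ := is_derive_Rintegral axc s1; have dA := is_derive_Rintegral apc s1.
  have dJ0 : is_derive s 1 (fun s => J s - J 0) (a s * x s).
    by have := is_deriveB dJ (is_derive_cst (J 0) s 1); rewrite subr0.
  have dA0 : is_derive s 1 (fun s => x0 * (A s - A 0)) (x0 * (a s * Phi s)).
    have := is_deriveB dA (is_derive_cst (A 0) s 1); rewrite subr0 => h.
    exact: (is_deriveZ x0 h).
  have dE := @is_derive1_comp _ expR (fun s => J s - J 0) s _ _ (is_derive_expR _) dJ0.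
  have := is_deriveB dE dA0; rewrite xE// (e _ _ axc s0) -/(J s) -/(J 0).
  set z := _ - x0 * _; have -> // : z = 0.
  rewrite /z expRN; have : expR (J s - J 0) != 0 by rewrite gt_eqF ?expR_gt0.
  by move=> h; field.
have : {within `[0, t], continuous W}.
  apply: derivable_within_continuous => s; rewrite in_itv/= => /andP[/dW[] //].
have dW' (s : R) : s \in `]0, t[ -> is_derive s 1 W 0.
  by rewrite in_itv/= => /andP[/ltW/dW].
move=> /(MVT t0 dW')[c _]; rewrite mul0r /W !subrr mulr0 subr0 expR0 => /subr0_eq h.
rewrite !e ?(ltW t0)// -/(J t) -/(J 0) -/(A t) -/(A 0); lra.
Qed.

End Primitive.

(** After [T0], each full window of length [lam] contributes at least [c]; the rest is controlled by
    the bound on [g]. *)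
Lemma Rintegral_linear_growth (R : realType) (g : R -> R) (M T0 lam c : R) :
  continuous g -> 0 <= M -> 0 <= T0 -> 0 < lam -> 0 < c ->
  (forall s : R, 0 <= s -> `|g s| <= M) ->
  (forall t : R, T0 <= t -> c <= \int[lebesgue_measure]_(s in `[t, t + lam]) g s) ->
  exists C, forall t : R, 0 <= t ->
    c / lam * t - C <= \int[lebesgue_measure]_(s in `[0, t]) g s.
Proof.
move=> gc M0 T00 lam0 c0 gM gint; set G := fun t : R => \int[lebesgue_measure]_(s in `[0, t]) g s.
have lip (s t : R) : 0 <= s -> s <= t -> G s - M * (t - s) <= G t.
  move=> s0 st; have := Rintegral_chasles gc s0 st; rewrite -/(G s) -/(G t) => ->.
  have h : forall u, s <= u <= t -> `|g u| <= M.
    by move=> u /andP[su _]; apply: gM; exact: le_trans su.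
  by have := Rintegral_norm_le gc st h; rewrite ler_norml => /andP[]; lra.
have G0 : G 0 = 0 by rewrite /G set_itv1 Rintegral_set1.
have step n : - (M * T0) + n%:R * c <= G (T0 + n%:R * lam).
  elim: n => [|n ih].
    by rewrite !mul0r !addr0; have := lip 0 T0 (lexx _) T00; rewrite G0 subr0 sub0r.
  have n0 : 0 <= n%:R * lam by rewrite mulr_ge0// ltW.
  have Tn : T0 <= T0 + n%:R * lam by rewrite lerDl.
  have Tn1 : T0 + n%:R * lam <= T0 + n%:R * lam + lam by rewrite lerDl ltW.
  have := gint _ Tn; have := Rintegral_chasles gc (le_trans T00 Tn) Tn1.
  rewrite -/(G (T0 + n%:R * lam)) -/(G (T0 + n%:R * lam + lam)) => E.
  by rewrite -natr1 !mulrDl !mul1r !addrA E; lra.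
(* M T0 is the possible loss before T0 and M lam that of the incomplete last window; the other two
   terms come from counting (t - T0)/lam windows rounded down. *)
exists (M * T0 + M * lam + c / lam * T0 + c) => t t0.
have cl : 0 < c / lam by rewrite divr_gt0.
have [Tt|tT] := leP T0 t; last first.
  have := lip 0 t (lexx _) t0; rewrite G0 sub0r subr0 => h.
  have h1 : M * t <= M * T0 by rewrite ler_wpM2l// ltW.
  have h2 : c / lam * t <= c / lam * T0 by rewrite ler_pM2l// ltW.
  by have := mulr_ge0 M0 (ltW lam0); rewrite -/(G t); lra.
have x0 : 0 <= (t - T0) / lam by rewrite divr_ge0 ?subr_ge0// ltW.
have /andP[j1 j2] := truncn_itv x0; set n := Num.truncn _ in j1 j2.
have h1 : n%:R * lam <= t - T0 by rewrite -ler_pdivlMr.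
have h2 : t - T0 < n%:R * lam + lam.
  by move: j2; rewrite ltr_pdivrMr// -natr1 mulrDl mul1r.
have h3 : (t - T0) / lam * c < n%:R * c + c.
  by move: j2; rewrite -(ltr_pM2r c0) -natr1 (mulrDl n%:R) mul1r.
have s0 : 0 <= T0 + n%:R * lam by rewrite addr_ge0// mulr_ge0// ltW.
have st : T0 + n%:R * lam <= t by lra.
have h4 : M * (t - (T0 + n%:R * lam)) <= M * lam by rewrite ler_wpM2l//; lra.
have h5 : (t - T0) / lam * c = c / lam * t - c / lam * T0 by ring.
by have := lip _ _ s0 st; have := step n; rewrite -/(G t); lra.
Qed.

Section LogisticAttraction.
Context (R : realType).
Local Notation mu := (@lebesgue_measure R).
Variables (a L : R -> R) (gam c k : R).
Hypotheses (ac : continuous a) (Lc : continuous L)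
  (a0 : forall s : R, 0 <= a s) (c0 : 0 < c) (k0 : 0 < k) (gam0 : 0 < gam)
  (aint : \forall t \near +oo, c <= \int[mu]_(s in `[t, t + gam]) a s)
  (Lgrow : \forall t \near +oo, k * t <= L t)
  (Losc : \forall t \near +oo, forall s : R, t <= s <= t + gam ->
     L (t + gam) - k / 4 * (t + gam) <= L s).

Let logistic (x0 : R) (x : R -> R) := forall s : R, 0 <= s ->
  x s = x0 * expR (L s) * expR (- \int[mu]_(u in `[0, s]) (a u * x u)).

(** The constant k/4 in [Losc]: since A >= c exp (L - k t / 4), the ratio exp L / A^2 is at most exp
    (- L + k t / 2) / c^2, and L >= k t leaves the decay exp (- k t / 2). *)
Lemma logistic_attraction (x y : R -> R) (x0 y0 : R) :
  0 < x0 -> 0 < y0 -> continuous x -> continuous y ->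
  logistic x0 x -> logistic y0 y -> `|x t - y t| @[t --> +oo] --> (0 : R).
Proof.
move=> x0p y0p xc yc xE yE.
have pc : continuous (fun s => expR (L s)).
  by move=> s; apply: continuous_comp; [exact: Lc|exact: continuous_expR].
have apc : continuous (fun u => a u * expR (L u)).
  by move=> u; apply: cvgM; [exact: ac|exact: pc].
pose A (t : R) := \int[mu]_(u in `[0, t]) (a u * expR (L u)).
have A0 t : 0 <= A t by apply: Rintegral_ge0 => u _; rewrite mulr_ge0// expR_ge0.
have closed z0 z t : 0 < z0 -> continuous z -> logistic z0 z -> 0 <= t ->
    z t = z0 * expR (L t) / (1 + z0 * A t).
  move=> z0p zc zE t0; rewrite zE// expRN.
  by rewrite (logistic_closed_form ac zc pc zE).
have Abig : \forall t \near +oo, c * expR (L (t + gam) - k / 4 * (t + gam)) <= A (t + gam).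
  near=> t; have t0 : 0 <= t by near: t; exact: nbhs_pinfty_ge.
  rewrite /A (@Rintegral_chasles _ _ 0 t (t + gam))//; last by rewrite lerDl ltW.
  apply: (@le_trans _ _ (\int[mu]_(u in `[t, t + gam]) (a u * expR (L u)))); last first.
    by rewrite lerDr; exact: A0.
  set e := expR _.
  have acc : continuous (fun u => a u * e) by move=> u; apply: cvgM; [exact: ac|exact: cvg_cst].
  apply: (@le_trans _ _ (\int[mu]_(u in `[t, t + gam]) (a u * e))).
    rewrite RintegralZr//; last exact: continuous_integrable.
    by rewrite ler_pM2r ?expR_gt0//; near: t.
  apply: le_Rintegral => //; [exact: continuous_integrable..|].
  move=> u; rewrite /= in_itv/= => ut; rewrite ler_wpM2l// ler_expR.
  by move: u ut; near: t.
have shift (Q : R -> Prop) : (\forall t \near +oo, Q (t + gam)) -> \forall t \near +oo, Q t.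
  case=> m [mr mQ]; exists (m + gam); split; first exact: num_real.
  by move=> t mt; rewrite -(subrK gam t); apply: mQ; lra.
have {}Abig := shift (fun t => c * expR (L t - k / 4 * t) <= A t) Abig; clear shift.
apply/cvgr0Pnorm_lt => eps eps0.
(* The 1 keeps [D] positive when x0 = y0, for the division by it below. *)
pose D := `|x0 - y0| / (x0 * y0 * c ^+ 2) + 1.
have D0 : 0 < D by rewrite ltr_wpDl// divr_ge0// !mulr_ge0// ?sqr_ge0 ?ltW.
near=> t; have t0 : 0 <= t by near: t; exact: nbhs_pinfty_ge.
rewrite normr_id.
rewrite (closed _ _ _ x0p xc xE)// (closed _ _ _ y0p yc yE)//.
have xA := A0 t; have At : c * expR (L t - k / 4 * t) <= A t by near: t.
have Lt : k * t <= L t by near: t.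
set E := expR (L t).
have E0 : 0 < E by exact: expR_gt0.
have Ap : 0 < A t by apply: lt_le_trans At; rewrite mulr_gt0 ?expR_gt0.
have xAp : 0 < 1 + x0 * A t by rewrite addr_gt0// mulr_gt0.
have yAp : 0 < 1 + y0 * A t by rewrite addr_gt0// mulr_gt0.
have -> : x0 * E / (1 + x0 * A t) - y0 * E / (1 + y0 * A t) =
    (x0 - y0) * (E / ((1 + x0 * A t) * (1 + y0 * A t))).
  by field; rewrite !lt0r_neq0.
rewrite normrM (gtr0_norm (divr_gt0 E0 (mulr_gt0 xAp yAp))).
apply: (@le_lt_trans _ _ (D * expR (- (k / 2 * t)))).
  apply: (@le_trans _ _ (`|x0 - y0| * (E / (x0 * y0 * (A t) ^+ 2)))).
    apply: ler_wpM2l => //; apply: ler_wpM2l; first exact: ltW.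
    rewrite lef_pV2 ?posrE//; first last.
    - by apply: mulr_gt0; [exact: mulr_gt0|exact: exprn_gt0].
    - exact: mulr_gt0.
    have := mulr_gt0 x0p Ap; have := mulr_gt0 y0p Ap.
    have -> : (1 + x0 * A t) * (1 + y0 * A t) =
      1 + x0 * A t + y0 * A t + x0 * y0 * A t ^+ 2 by ring.
    lra.
  apply: (@le_trans _ _ (`|x0 - y0| / (x0 * y0 * c ^+ 2) * expR (- (k / 2 * t)))); last first.
    by rewrite ler_wpM2r ?expR_ge0// /D lerDl.
  rewrite -[leRHS]mulrA; apply: ler_wpM2l => //.
  rewrite ler_pdivrMr; last by rewrite !mulr_gt0// exprn_gt0.
  have h : (c * expR (L t - k / 4 * t)) ^+ 2 <= A t ^+ 2.
    by rewrite lerXn2r ?nnegrE ?(ltW Ap)// mulr_ge0 ?expR_ge0// ltW.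
  have -> : (x0 * y0 * c ^+ 2)^-1 * expR (- (k / 2 * t)) * (x0 * y0 * A t ^+ 2) =
     expR (- (k / 2 * t)) / c ^+ 2 * A t ^+ 2.
    by field; rewrite !lt0r_neq0.
  apply: le_trans (ler_wpM2l _ h); last by rewrite divr_ge0 ?expR_ge0 ?sqr_ge0.
  rewrite exprMn mulrA divfK ?expf_neq0 ?lt0r_neq0//.
  rewrite -expRM_natl -expRD /E ler_expR; lra.
rewrite -ltr_pdivlMl//.
have eD : 0 < eps / D by rewrite divr_gt0.
rewrite [_^-1 * _]mulrC -[X in _ < X](lnK (x := eps / D)) ?posrE// ltr_expR.
have : - ln (eps / D) / (k / 2) < t by near: t; apply: nbhs_pinfty_gt; exact: num_real.
by rewrite ltr_pdivrMr ?divr_gt0//; lra.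
Unshelve. all: by end_near. Qed.

End LogisticAttraction.

(** * Exponential form of a positive solution *)

Section LogSolution.
Context (R : realType) (d : measure_display) (T : measurableType d)
  (P : probability T R) (F : R -> set (set T)) (B : R -> T -> R).
Hypotheses (F_usual : usual_filtration P F)
  (B_brownian : standard_brownian_motion P F B).
Local Notation mu := (@lebesgue_measure R).
Variables r a sigma : R -> R.
Hypotheses (r_cb : continuous_bounded r) (a_cb : continuous_bounded a)
  (sigma_cb : continuous_bounded sigma).

(** Exponentiates the definition of [log_drift_free]. What is kept of the equation is a pathwise
    formula and the characterization of its noise. *)
Lemma positive_solution_log X :
  positive_solution P F B (fun t x => x * (r t - a t * x)) (fun t x => x * sigma t) X ->
  exists x0 : R, exists N : R -> T -> R, [/\ 0 < x0, wiener_integral P B sigma N,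
    {ae P, forall w, N 0 w = 0},
    {ae P, forall w, continuous (fun s : R => N (Num.max 0 s) w)} &
    {ae P, forall w, continuous (fun s : R => X (Num.max 0 s) w) /\
      forall s : R, 0 <= s -> X s w =
        x0 * expR (\int[mu]_(u in `[0, s]) (r (Num.max 0 u) - 2^-1 * sigma (Num.max 0 u) ^+ 2)
                   + N s w) *
        expR (- \int[mu]_(u in `[0, s]) (a (Num.max 0 u) * X (Num.max 0 u) w))}].
Proof.
move=> [x0 [x0p [aX cX X0 _ [I HI]] pX]].
have rec := continuous_extend0 r_cb.1; have aec := continuous_extend0 a_cb.1.
have sec := continuous_extend0 sigma_cb.1.
have cX' : {ae P, forall w, continuous (fun s : R => X (Num.max 0 s) w)}.
  by apply: filterS cX => w; exact: continuous_extend0.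
exists x0, (log_drift_free r a sigma X x0); split => //.
- move=> t q e; apply: (ito_log F_usual B_brownian r_cb a_cb sigma_cb aX cX pX X0).
  + by move=> p p0; exact: (HI p p0).1.
  + by move=> p p0; exact: (HI p p0).2.
- apply: filterS X0 => w X0w.
  by rewrite /log_drift_free X0w subrr set_itv1 Rintegral_set1 subr0.
- apply: filterS2 cX' pX => w Xc Xp s.
  pose h (u : R) := r (Num.max 0 u) - 2^-1 * sigma (Num.max 0 u) ^+ 2
    - a (Num.max 0 u) * X (Num.max 0 u) w.
  have hc : continuous h.
    move=> u; apply: cvgB; last by apply: cvgM; [exact: aec|exact: Xc].
    by apply: cvgB; [exact: rec|apply: cvgM; [exact: cvg_cst|apply: cvgM; exact: sec]].
  have e (u : R) : \int[mu]_(v in `[0, Num.max 0 u])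
      (r v - 2^-1 * sigma v ^+ 2 - a v * X v w) = \int[mu]_(v in `[0, Num.max 0 u]) h v.
    by apply: eq_Rintegral => v; rewrite inE/= in_itv/= => /andP[v0 _]; rewrite /h (max_idPr v0).
  rewrite /log_drift_free; under eq_fun do rewrite e.
  apply: cvgB; last exact: continuous_Rintegral0.
  apply: cvgB; last exact: cvg_cst.
  apply: (@continuous_comp _ _ _ (fun u : R => X (Num.max 0 u) w) (@ln R)); first exact: Xc.
  by apply: continuous_ln; apply: Xp; rewrite le_max lexx.
- apply: filterS2 cX' pX => w Xc Xp; split=> // s s0.
  have gc : continuous (fun u : R => r (Num.max 0 u) - 2^-1 * sigma (Num.max 0 u) ^+ 2).
    by move=> u; apply: cvgB; [exact: rec|apply: cvgM; [exact: cvg_cst|apply: cvgM; exact: sec]].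
  have axc : continuous (fun u : R => a (Num.max 0 u) * X (Num.max 0 u) w).
    by move=> u; apply: cvgM; [exact: aec|exact: Xc].
  rewrite /log_drift_free.
  have -> : \int[mu]_(u in `[0, s]) (r u - 2^-1 * sigma u ^+ 2 - a u * X u w) =
    \int[mu]_(u in `[0, s]) (r (Num.max 0 u) - 2^-1 * sigma (Num.max 0 u) ^+ 2) -
    \int[mu]_(u in `[0, s]) (a (Num.max 0 u) * X (Num.max 0 u) w).
    rewrite -RintegralB//; [|exact: continuous_integrable..].
    by apply: eq_Rintegral => v; rewrite inE/= in_itv/= => /andP[v0 _]; rewrite (max_idPr v0).
  transitivity (expR (ln (X s w))); first by rewrite lnK ?posrE ?Xp.
  have {1}-> : x0 = expR (ln x0) by rewrite lnK.
  by rewrite -!expRD; congr expR; ring.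
Qed.

End LogSolution.

(** Two noises agree almost surely at each fixed time, hence simultaneously at these countably many
    times; they are dense, and continuity gives all times off one null set. *)
Lemma continuous_eq_rat (R : realType) (f g : R -> R) :
  continuous (fun s : R => f (Num.max 0 s)) -> continuous (fun s : R => g (Num.max 0 s)) ->
  (forall n j m : nat, f (n%:R * j%:R / m.+1%:R) = g (n%:R * j%:R / m.+1%:R)) ->
  forall s : R, 0 <= s -> f s = g s.
Proof.
move=> fc gc fg s s0; apply/eqP; rewrite -subr_eq0 -normr_eq0 eq_le normr_ge0 andbT.
apply/ler_addgt0Pl => e e0; rewrite addr0.
have e20 : 0 < e / 2 by rewrite divr_gt0.
have /cvgrPdist_lt/(_ _ e20)/nbhs_ballP[r1 /= r10 f1] := fc s.
have /cvgrPdist_lt/(_ _ e20)/nbhs_ballP[r2 /= r20 g1] := gc s.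
have rm : 0 < Num.min r1 r2 by rewrite lt_min r10.
pose n := (Num.truncn s).+1; have sn : 0 <= s <= n%:R by rewrite s0 ltW// truncnS_gt.
have n0 : 0 < n%:R :> R by [].
have [m Hm] := grid_approx n0 sn rm; have [j _] := Hm m (leqnn m).
rewrite lt_min => /andP[h1 h2]; have := f1 _ h1; have := g1 _ h2.
rewrite (max_idPr s0) max_r ?divr_ge0 ?mulr_ge0// fg.
set z := g (_ / _) => zg zf; have -> : f s - g s = (f s - z) - (g s - z) by ring.
by apply: le_trans (ler_normB _ _) _; lra.
Qed.

Theorem theorem5p1 (R : realType) (d : measure_display) (T : measurableType d)
  (P : probability T R) (F : R -> set (set T)) (B : R -> T -> R)
  (r a sigma : R -> R) (gamma lambda : R)
  (P_complete : measure_is_complete P)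
  (F_usual : usual_filtration P F)
  (B_brownian : standard_brownian_motion P F B)
  (r_cb : continuous_bounded r)
  (a_cb : continuous_bounded a)
  (sigma_cb : continuous_bounded sigma)
  (a_ge0 : forall t : R, 0 <= t -> 0 <= a t)
  (sigma_ge0 : forall t : R, 0 <= t -> 0 <= sigma t)
  (gamma_gt0 : 0 < gamma)
  (lambda_gt0 : 0 < lambda)
  (a_liminf : (0 < limf_einf (fun t : R =>
    (\int[lebesgue_measure]_(s in `[t, t + gamma]) a s)%R%:E)
    (pinfty_nbhs R))%E)
  (r_liminf : (0 < limf_einf (fun t : R =>
    (\int[lebesgue_measure]_(s in `[t, t + lambda])
      (r s - 2^-1 * sigma s ^+ 2))%R%:E)
    (pinfty_nbhs R))%E) :
  globally_attractive P F B
    (fun t x => x * (r t - a t * x)) (fun t x => x * sigma t).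
Proof.
move=> X Y.
move=> /(positive_solution_log F_usual B_brownian r_cb a_cb sigma_cb)[x0 [N [x0p wN N0 cN XE]]].
move=> /(positive_solution_log F_usual B_brownian r_cb a_cb sigma_cb)[y0 [N' [y0p wN' N'0 cN' YE]]].
have rec := continuous_extend0 r_cb.1; have aec := continuous_extend0 a_cb.1.
have sec := continuous_extend0 sigma_cb.1.
have [[_ [Mr rM]] [_ [Ms sM]]] := (r_cb, sigma_cb).
have m0 (u : R) : 0 <= Num.max 0 u by rewrite le_max lexx.
have {}sM (s : R) : 0 <= s -> `|sigma s| <= `|Ms| + 1.
  by move=> /sM; have := ler_norm Ms; lra.
have Ms0 : 0 < `|Ms| + 1 by rewrite ltr_wpDl.
have subl := wiener_integral_sublinear F_usual B_brownian wN Ms0 sM N0 cN.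
have same : {ae P, forall w, forall n j m : nat,
    N (n%:R * j%:R / m.+1%:R) w = N' (n%:R * j%:R / m.+1%:R) w}.
  do 3 (apply: ae_foralln => ?); set s := _ / _.
  have : 0 <= s by rewrite divr_ge0 ?mulr_ge0.
  rewrite le_eqVlt => /predU1P[<-|s0]; last exact: wiener_integral_unique wN wN' s0.
  by apply: filterS2 N0 N'0 => w -> ->.
set g := fun u : R => r (Num.max 0 u) - 2^-1 * sigma (Num.max 0 u) ^+ 2.
have gc : continuous g.
  by move=> u; apply: cvgB; [exact: rec|apply: cvgM; [exact: cvg_cst|apply: cvgM; exact: sec]].
pose Mg := `|Mr| + (`|Ms| + 1) ^+ 2.
have Mg0 : 0 <= Mg by rewrite addr_ge0 ?sqr_ge0.
have gM (s : R) : `|g s| <= Mg.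
  apply: le_trans (ler_normB _ _) _; apply: lerD.
    by apply: le_trans (rM _ (m0 s)) _; exact: ler_norm.
  rewrite normrM normrX gtr0_norm ?invr_gt0//.
  have h : `|sigma (Num.max 0 s)| ^+ 2 <= (`|Ms| + 1) ^+ 2.
    by rewrite lerXn2r ?nnegrE ?(ltW Ms0)// sM.
  have := sqr_ge0 `|sigma (Num.max 0 s)|; lra.
have [ca ca0 [Ta aint]] := limf_einf_pinfty_gt0 a_liminf.
have [cr cr0 [Tr rint]] := limf_einf_pinfty_gt0 r_liminf.
have T0 : 0 <= Num.max 0 (Tr + 1) by [].
have gint (t : R) : Num.max 0 (Tr + 1) <= t ->
    cr <= \int[lebesgue_measure]_(s in `[t, t + lambda]) g s.
  rewrite ge_max => /andP[t0 Tt]; have Trt : Tr < t by lra.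
  apply: le_trans (rint _ Trt) _; rewrite le_eqVlt; apply/orP; left; apply/eqP.
  apply: eq_Rintegral => s; rewrite inE/= in_itv/= => /andP[ts _].
  by rewrite /g (max_idPr (le_trans t0 ts)).
have [C GC] := Rintegral_linear_growth gc Mg0 T0 lambda_gt0 cr0 (fun s _ => gM s) gint.
set G := fun s : R => \int[lebesgue_measure]_(u in `[0, s]) g u in GC.
pose c' := cr / lambda; have c'0 : 0 < c' by rewrite divr_gt0.
apply: filterS3 (filterI XE YE) subl (filterI same (filterI cN cN')).
move=> w [[Xc {}XE] [Yc {}YE]] Nsub [same_w [cNw cN'w]].
have NE := @continuous_eq_rat R (N^~ w) (N'^~ w) cNw cN'w same_w.
pose L (s : R) := \int[lebesgue_measure]_(u in `[0, Num.max 0 s]) g u + N (Num.max 0 s) w.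
have LE (s : R) : 0 <= s -> L s = G s + N s w by move=> s0; rewrite /L (max_idPr s0).
have Lc : continuous L.
  by move=> s; apply: cvgD; [exact: continuous_Rintegral0|exact: cNw].
(* [logistic_attraction] is used with k = c'/2, so [L] may drop by c'/8 (t + gamma) over a window:
   c'/16 covers the integral of [g], and c'/32 each of the two values of the noise. *)
have c160 : 0 < c' / 32 by rewrite divr_gt0.
have [S HS] := Nsub _ c160.
have := @logistic_attraction R (fun s => a (Num.max 0 s)) L gamma ca (c' / 2) aec Lc.
have a0 (s : R) : 0 <= a (Num.max 0 s) by exact: a_ge0.
move=> /(_ a0 ca0 (divr_gt0 c'0 (ltr0Sn _ 1)) gamma_gt0).
have h1 : \forall t \near +oo,
    ca <= \int[lebesgue_measure]_(s in `[t, t + gamma]) a (Num.max 0 s).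
  near=> t; have t0 : 0 <= t by near: t; exact: nbhs_pinfty_ge.
  have Tat : Ta < t by near: t; apply: nbhs_pinfty_gt; exact: num_real.
  apply: le_trans (aint _ Tat) _; rewrite le_eqVlt; apply/orP; left; apply/eqP.
  apply: eq_Rintegral => s; rewrite inE/= in_itv/= => /andP[ts _].
  by rewrite (max_idPr (le_trans t0 ts)).
have h2 : \forall t \near +oo, c' / 2 * t <= L t.
  near=> t; have t0 : 0 <= t by near: t; exact: nbhs_pinfty_ge.
  have tS : S <= t by near: t; apply: nbhs_pinfty_ge; exact: num_real.
  (* The losses C <= c' t / 3 and c' t / 32 still leave c' t / 2. *)
  have tC : 3 * C / c' <= t by near: t; apply: nbhs_pinfty_ge; exact: num_real.
  rewrite LE//; have := HS t tS; have := GC t t0; rewrite -/(G t) -/c'.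
  move: tC; rewrite ler_pdivrMr// ler_norml => + + /andP[+ _].
  by have := mulr_ge0 (ltW c'0) t0; clear; lra.
have h3 : \forall t \near +oo, forall s : R, t <= s <= t + gamma ->
    L (t + gamma) - c' / 2 / 4 * (t + gamma) <= L s.
  near=> t => s /andP[ts st]; have t0 : 0 <= t by near: t; exact: nbhs_pinfty_ge.
  have tS : S <= t by near: t; apply: nbhs_pinfty_ge; exact: num_real.
  have tC : Mg * gamma * 16 / c' <= t by near: t; apply: nbhs_pinfty_ge; exact: num_real.
  have s0 := le_trans t0 ts.
  rewrite !LE//; last exact: le_trans st.
  have Sg : S <= t + gamma by clear -tS gamma_gt0; lra.
  have h1' : Mg * (t + gamma - s) <= Mg * gamma by rewrite ler_wpM2l//; clear -ts; lra.
  have h2' : c' * s <= c' * (t + gamma) by rewrite ler_pM2l.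
  have h3' : c' * t <= c' * (t + gamma) by rewrite ler_pM2l// lerDl ltW.
  have GE := Rintegral_chasles gc s0 st; rewrite -/(G (t + gamma)) -/(G s) in GE.
  have := HS _ (le_trans tS ts); have := HS _ Sg; rewrite !ler_norml GE.
  have := Rintegral_norm_le gc st (fun u _ => gM u); rewrite ler_norml.
  move: tC; rewrite ler_pdivrMr//; clear -h1' h2' h3' => ? /andP[? ?] /andP[? ?] /andP[? ?].
  lra.
move=> /(_ h1 h2 h3 (fun s => X (Num.max 0 s) w) (fun s => Y (Num.max 0 s) w) x0 y0 x0p y0p Xc Yc).
have lX (s : R) : 0 <= s -> X (Num.max 0 s) w = x0 * expR (L s) *
    expR (- \int[lebesgue_measure]_(u in `[0, s]) (a (Num.max 0 u) * X (Num.max 0 u) w)).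
  by move=> s0; rewrite (max_idPr s0) (XE s s0) LE.
have lY (s : R) : 0 <= s -> Y (Num.max 0 s) w = y0 * expR (L s) *
    expR (- \int[lebesgue_measure]_(u in `[0, s]) (a (Num.max 0 u) * Y (Num.max 0 u) w)).
  by move=> s0; rewrite (max_idPr s0) (YE s s0) LE// NE.
move=> /(_ lX lY); apply: cvg_trans; apply: near_eq_cvg.
near=> t; have t0 : 0 <= t by near: t; exact: nbhs_pinfty_ge.
by rewrite (max_idPr t0).
Unshelve. all: by end_near. Qed.
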